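(* Consider the system $$f_{xt}+ff_{xx}-f_x^{2}+\rho=I(t),\qquad \rho_t+f\rho_x=\rho f_x,\qquad I(t)=\int_0^1\rho\,dx-2\int_0^1 f_x^2\,dx,\qquad x\in[0,1],\ t>0,$$ with initial data $f(0,x)=f_0(x)$, $\rho(0,x)=\rho_0(x)$, subject to either (D) the Dirichlet boundary conditions $f(t,0)=f(t,1)=0$, $\rho(t,0)=\rho(t,1)=0$, or (P) the periodic boundary conditions $f(t,0)=f(t,1)$, $f_x(t,0)=f_x(t,1)$, $\rho(t,0)=\rho(t,1)$, together with $\int_0^1 f_0(x)\,dx=0$ (and, as explained in the context, $\int_0^1 f(t,x)\,dx=0$ for as long as $f$ is defined). Suppose that $f_0$ and $\rho_0$ satisfy the boundary conditions under consideration and that $f_0\in H^2([0,1])$, $f_0'\in L^\infty([0,1])$ and $\rho_0\in H^1([0,1])$. Then there exists $T=T(\|f_0\|_{H^2},\|f_0'\|_{L^\infty},\|\rho_0\|_{H^1})>0$ such that the problem has a unique solution $(f,\rho)$ on $[0,T]$ satisfying $$f\in C([0,T];H^2),\qquad f_x\in C([0,T];L^\infty),\qquad \rho\in C([0,T];H^1).$$ Moreover, if $T^*>0$ is such that $$\int_0^{T^*}\|f_x(t,\cdot)\|_{L^\infty}\,dt<+\infty,$$ then the local solution can be extended to $[0,T^*]$.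
   Context: The unknowns are real-valued functions $f(t,x)$ and $\rho(t,x)$, and all function spaces are over $x\in[0,1]$. The system arises from the inviscid 2D Boussinesq equations $u_t+(u\cdot\nabla)u=-\nabla p+\theta e_2$, $\nabla\cdot u=0$, $\theta_t+u\cdot\nabla\theta=0$ on $\{(x,y)\in[0,1]\times(0,+\infty)\}$ through $u(t,x,y)=(f(t,x),-yf_x(t,x))$, $\theta(t,x,y)=y\rho(t,x)$. In the periodic case the pressure is required to satisfy $p(t,1,y)=p(t,0,y)$. Since the horizontal component of the momentum equation reads $f_t+ff_x=-p_x$, this together with $\int_0^1 f_0\,dx=0$ means that $\int_0^1 f(t,x)\,dx=0$ for as long as $f$ is defined; solutions in the periodic case are understood subject to this condition. *)

(* Defs.v *)
From HB Require Import structures.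
From mathcomp Require Import all_boot all_order all_algebra.
From mathcomp Require Import all_classical all_reals all_analysis.

Set Implicit Arguments.
Unset Strict Implicit.
Unset Printing Implicit Defensive.

Import Order.TTheory GRing.Theory Num.Theory.
Import numFieldNormedType.Exports.

Local Open Scope classical_set_scope.
Local Open Scope ring_scope.

Section FunctionSpaces.
Context (R : realType).
Local Notation mu := (@lebesgue_measure R).
Implicit Types (u v w : R -> R).

Definition I01 : set R := `[0, 1].

(* Functions on [0,1] are functions R -> R whose values outside [0,1] are
   irrelevant: norms are taken after extending the restriction by zero. *)
Definition L2 u : Prop := u \_ I01 \in Lfun mu 2%:E.
Definition Linf u : Prop := u \_ I01 \in Lfun mu +oo%E.
Definition eLinf_norm u : \bar R := 'N[mu]_+oo%E[EFin \o (u \_ I01)]%E.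
Definition L2_norm u : R := fine 'N[mu]_2%:E[EFin \o (u \_ I01)]%E.
Definition Linf_norm u : R := fine (eLinf_norm u).

(* Test functions in C^1_c((0,1)), as in Brezis, "Functional Analysis, Sobolev
   Spaces and Partial Differential Equations", Section 8.2. *)
Definition test_function (phi : R -> R) : Prop :=
  [/\ forall x, derivable phi x 1,
      continuous (derive1 phi)
    & exists a b : R, [/\ 0 < a, b < 1 & forall x : R, x \notin `[a, b] -> phi x = 0]].

Definition weak_derivative u v : Prop :=
  forall phi, test_function phi ->
    \int[mu]_(x in I01) (u x * derive1 phi x) = - \int[mu]_(x in I01) (v x * phi x).

(* [H1 u v]: u is the continuous representative of an element of H^1([0,1])
   (so that boundary values make sense) and v is its weak derivative. *)
Definition H1 u v : Prop :=
  [/\ {within I01, continuous u}, L2 u, L2 v & weak_derivative u v].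

(* [H2 u v w]: u is in H^2([0,1]), with u' = v (continuous representative) and
   u'' = w. *)
Definition H2 u v w : Prop := H1 u v /\ H1 v w.

Definition H1_norm u v : R :=
  Num.sqrt (L2_norm u ^+ 2 + L2_norm v ^+ 2).
Definition H2_norm u v w : R :=
  Num.sqrt (L2_norm u ^+ 2 + L2_norm v ^+ 2 + L2_norm w ^+ 2).

End FunctionSpaces.

Section System.
Context (R : realType).
Local Notation mu := (@lebesgue_measure R).
Local Notation I01 := (@I01 R).

Inductive boundary_kind := Dirichlet | Periodic.

(* u, v, r stand for f, f_x and rho at a fixed time. *)
Definition boundary_conditions (bc : boundary_kind) (u v r : R -> R) : Prop :=
  match bc with
  | Dirichlet => [/\ u 0 = 0, u 1 = 0, r 0 = 0 & r 1 = 0]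
  | Periodic =>
      [/\ u 0 = u 1, v 0 = v 1, r 0 = r 1 & \int[mu]_(x in I01) u x = 0]
  end.

Definition nonlocal (v r : R -> R) : R :=
  \int[mu]_(x in I01) r x - 2 * \int[mu]_(x in I01) (v x ^+ 2).

(* A function of t and x is written u t x. [vanishes_on_diagonal T d], for d s t
   the norm of u s - u t, says that t |-> u t is continuous on [0,T]. *)
Definition vanishes_on_diagonal (T : R) (d : R -> R -> R) : Prop :=
  forall t : R, t \in `[0, T] -> d s t @[s --> within `[0, T] (nbhs t)] --> 0.

Definition L2_time_derivative (u : R -> R -> R) (t : R) (w : R -> R) : Prop :=
  L2 w /\
  L2_norm (fun x => h^-1 * (u (t + h) x - u t x) - w x) @[h --> 0^'] --> 0.

Record solution (bc : boundary_kind) (f0 rho0 : R -> R) (T : R)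
    (f fx fxx rho rhox : R -> R -> R) : Prop := Solution {
  sol_f_H2 : forall t : R, t \in `[0, T] -> H2 (f t) (fx t) (fxx t);
  sol_f_continuous : vanishes_on_diagonal T (fun s t =>
    H2_norm (f s \- f t) (fx s \- fx t) (fxx s \- fxx t));
  sol_fx_Linf : forall t : R, t \in `[0, T] -> Linf (fx t);
  sol_fx_continuous : vanishes_on_diagonal T (fun s t =>
    Linf_norm (fx s \- fx t));
  sol_rho_H1 : forall t : R, t \in `[0, T] -> H1 (rho t) (rhox t);
  sol_rho_continuous : vanishes_on_diagonal T (fun s t =>
    H1_norm (rho s \- rho t) (rhox s \- rhox t));
  sol_boundary : forall t : R, t \in `[0, T] ->
    boundary_conditions bc (f t) (fx t) (rho t);
  sol_initial : forall x : R, x \in `[0, 1] -> f 0 x = f0 x /\ rho 0 x = rho0 x;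
  (* f_xx and rho_x are only in L^2 in x, so f_xt and rho_t are derivatives of
     L^2-valued functions of t and the equations hold for almost every x. *)
  sol_equation_f : forall t : R, t \in `]0, T[ ->
    exists2 fxt, L2_time_derivative fx t fxt &
      {ae mu, forall x : R, x \in `[0, 1] ->
        fxt x + f t x * fxx t x - fx t x ^+ 2 + rho t x
        = nonlocal (fx t) (rho t)};
  sol_equation_rho : forall t : R, t \in `]0, T[ ->
    exists2 rhot, L2_time_derivative rho t rhot &
      {ae mu, forall x : R, x \in `[0, 1] ->
        rhot x + f t x * rhox t x = rho t x * fx t x}
}.

End System.

(* Main.v *)
(** Let [gamma] be the flow of [f] and [w = 1 / gamma_x]. Along the flow the system
    becomes the linear equation [w_tt = rho0 - I(t) w], with [w = 1] and [w_t = - f0']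
    at time [0], while [f_x = - (w_t / w) o gamma^-1] and [rho = (rho0 / w) o gamma^-1].
    Hence [w = u_0 - f0' u_1 + rho0 u_2] for functions [u_i] of time only, and the
    problem is an ordinary differential equation for the [u_i] and their derivatives,
    in which [I = \int rho0 / w^2 - 2 \int w_t^2 / w^3]. The length [\int 1 / w] of the
    image of [gamma] is preserved because [k = \int 1 / w - 1] solves [k'' = I k]. The
    regularity in time of [f_x] and [rho] comes from the composition of [f0'] and [rho0]
    with [gamma^-1], by approximation of [f0''] and [rho0'] by continuous functions in
    L^2. Uniqueness is an L^2 energy estimate for [f_x] and [rho].

    For the continuation criterion, [log w = \int_0^t w_t / w] is bounded by
    [M = \int_0^T* |f_x|_oo]. For two points [x, x'] the Wronskian
    [w_t(x) w(x') - w(x) w_t(x')] has the bounded derivative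
    [rho0(x) w(x') - rho0(x') w(x)], so that the oscillation of [w_t / w] is bounded; as
    [w_t / w] has mean zero with respect to [dx / w], it is bounded, then so are [I] and
    the [u_i], by constants that depend only on the data, [M] and [T*]. *)
Require Import Defs.
From HB Require Import structures.
From mathcomp Require Import all_boot all_order all_algebra.
From mathcomp Require Import all_classical all_reals all_analysis.
From mathcomp Require Import measurable_realfun ess_sup_inf ring lra.
Import Order.TTheory GRing.Theory Num.Theory.
Import numFieldNormedType.Exports.
Local Open Scope classical_set_scope.
Local Open Scope ring_scope.
Set Implicit Arguments.
Unset Strict Implicit.
Unset Printing Implicit Defensive.

(** * Integration and absolutely continuous functions *)

Section Integrable.
Context (R : realType).
Local Notation mu := (@lebesgue_measure R).
Implicit Types (u v f g : R -> R) (D : set R) (a b c x y : R).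

(** In Eulerian variables the terms [f f_xx] and [f rho_x] cost a derivative, so that a fixed point
    argument in H^2 and H^1 does not close. Along the flow the space variable is a mere parameter,
    and six scalar functions of time remain. Their vector field is only locally Lipschitz, because
    of [1 / w] and of the products; clamps make it bounded and globally Lipschitz. One global
    solution of the clamped system is taken, and it remains to see that no clamp is active: for a
    short time by continuity, for the continuation by bounds that do not depend on the clamps.

    The velocity field is recovered as the time derivative of the flow. That it satisfies the
    boundary conditions, and that [I] is its nonlocal term, has then to be proved; both rest on
    [\int 1 / w = 1]. Extending [f0'] and [rho0] to the real line, by constants or by periodicity,
    treats both boundary conditions at once and removes the end points from the analysis of the
    flow. As [f_xx] and [rho_x] are merely in L^2, derivatives of [f_x] and [rho] are handled
    through integrals and L^2 limits, never pointwise. *)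

Definition itg D f : Prop := mu.-integrable D (EFin \o f).

Lemma itg_measurable D f : itg D f -> measurable_fun D f.
Proof. by move=> /measurable_int/measurable_EFinP. Qed.

Lemma itgS D E f : @measurable _ (measurableTypeR R) D ->
  @measurable _ (measurableTypeR R) E -> D `<=` E -> itg E f -> itg D f.
Proof. by move=> mD mE DE; apply: integrableS. Qed.

Section FixedSet.
Variable D : set R.
Hypothesis mD : @measurable _ (measurableTypeR R) D.

Lemma eq_itg f g : (forall x, D x -> f x = g x) -> itg D f -> itg D g.
Proof.
by move=> fg; apply: eq_integrable => // x /set_mem Dx; rewrite /= fg.
Qed.

Lemma itgD f g : itg D f -> itg D g -> itg D (fun x => f x + g x).
Proof. by move=> itf itv; have := integrableD mD itf itv. Qed.

Lemma itgZ k f : itg D f -> itg D (fun x => k * f x).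
Proof. by move=> itf; have := integrableZl mD k itf. Qed.

Lemma itgN f : itg D f -> itg D (fun x => - f x).
Proof. by move=> /(itgZ (-1)); under eq_fun do rewrite mulN1r. Qed.

Lemma itgB f g : itg D f -> itg D g -> itg D (fun x => f x - g x).
Proof. by move=> itf /itgN; apply: itgD. Qed.

Lemma itg_norm f : itg D f -> itg D (fun x => `|f x|).
Proof. exact: integrable_norm. Qed.

Lemma itg_le f g : measurable_fun D f -> itg D g ->
  (forall x, D x -> `|f x| <= g x) -> itg D f.
Proof.
move=> mf itv fg; apply: (le_integrable mD _ _ itv); first exact/measurable_EFinP.
by move=> x Dx /=; rewrite lee_fin (le_trans (fg _ Dx)) ?ler_norm.
Qed.

Lemma itgM_bounded k f g : measurable_fun D f -> (forall x, D x -> `|f x| <= k) ->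
  itg D g -> itg D (fun x => f x * g x).
Proof.
move=> mf fk itv; apply: (@itg_le _ (fun x => k * `|g x|)).
- by apply: measurable_funM => //; exact: itg_measurable.
- exact/itgZ/itg_norm.
- by move=> x Dx; rewrite normrM ler_wpM2r ?fk.
Qed.

Lemma int_norm f : itg D f ->
  `|\int[mu]_(x in D) f x| <= \int[mu]_(x in D) `|f x|.
Proof. exact: le_normr_Rintegral. Qed.

Lemma int_le f g : itg D f -> itg D g -> (forall x, D x -> f x <= g x) ->
  \int[mu]_(x in D) f x <= \int[mu]_(x in D) g x.
Proof. exact: le_Rintegral. Qed.

Lemma int_eq f g : (forall x, D x -> f x = g x) ->
  \int[mu]_(x in D) f x = \int[mu]_(x in D) g x.
Proof. by move=> fg; apply: eq_Rintegral => x /set_mem /fg. Qed.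

Lemma intN f : itg D f -> \int[mu]_(x in D) - f x = - \int[mu]_(x in D) f x.
Proof.
move=> itf; rewrite -mulN1r -RintegralZl//.
by apply: int_eq => x _; rewrite mulN1r.
Qed.

End FixedSet.

Lemma itv_lty a b : (mu `[a, b] < +oo)%E.
Proof.
by rewrite lebesgue_measure_itv/=; case: ifP => _; rewrite ?ltry// -EFinB ltry.
Qed.

Lemma itg_cont a b f : {within `[a, b], continuous f} -> itg `[a, b] f.
Proof. by apply: continuous_compact_integrable; exact: segment_compact. Qed.

Lemma itg_cst a b k : itg `[a, b] (fun=> k).
Proof. by apply/itg_cont/continuous_subspaceT => x; exact: cvg_cst. Qed.

Lemma itg_bounded a b k f : measurable_fun `[a, b] f ->
  (forall x, x \in `[a, b] -> `|f x| <= k) -> itg `[a, b] f.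
Proof. move=> mf fk; apply: (@itg_le _ _ f (fun=> k)) => //; exact: itg_cst. Qed.

Lemma itg_sub a b c d f : a <= c -> d <= b -> itg `[a, b] f -> itg `[c, d] f.
Proof.
move=> ac db; apply: itgS => //.
by apply: subset_itv; rewrite bnd_simp.
Qed.

Lemma itg_cat a b c f : itg `[a, b] f -> itg `[b, c] f -> itg `[a, c] f.
Proof.
move=> f1 f2; have [ab|ba] := leP a b; last first.
  by apply: itg_sub f2; rewrite // ltW.
have [bc|cb] := leP b c; last first.
  by apply: itg_sub f1; rewrite // ltW.
have mf : measurable_fun `[a, c] f.
  rewrite (@itv_bndbnd_setU _ _ _ (BRight b)) ?bnd_simp//.
  rewrite measurable_funU//; split; first exact: itg_measurable.
  apply: measurable_funS (itg_measurable f2) => //.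
  by apply: subset_itvr; rewrite bnd_simp.
apply/integrableP; split; first exact/measurable_EFinP.
rewrite (@itv_bndbnd_setU _ _ _ (BRight b)) ?bnd_simp//.
rewrite ge0_integral_setU//=; first last.
- apply/disj_setPS => y [/=]; rewrite 2!in_itv/= => /andP[_ yx] /andP[].
  by rewrite ltNge yx.
- rewrite -itv_bndbnd_setU ?bnd_simp//.
  by do 2 apply: measurableT_comp => //; exact: mf.
rewrite lte_add_pinfty//.
- by have /integrableP[_] := f1.
- have /integrableP[_] : itg `]b, c] f 
    by apply: itgS f2 => //; apply: subset_itvr; rewrite bnd_simp.
  by [].
Qed.

Lemma int_cat a b c f : a <= b -> b <= c -> itg `[a, c] f ->
  \int[mu]_(x in `[a, c]) f x =
  \int[mu]_(x in `[a, b]) f x + \int[mu]_(x in `[b, c]) f x.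
Proof.
move=> ab bc itf.
have := @Rintegral_itvB _ f (BLeft a) (BRight c) b itf.
rewrite !bnd_simp => /(_ ab bc).
rewrite Rintegral_itv_obnd_cbnd; first by move<-; rewrite addrC subrK.
by apply: itgS itf => //; apply: subset_itv; rewrite bnd_simp.
Qed.

Lemma int_cst a b k : a <= b -> \int[mu]_(x in `[a, b]) k = k * (b - a).
Proof.
move=> ab; rewrite Rintegral_cst//; congr (_ * _).
have muab : mu `[a, b] = (b - a)%:E.
  rewrite lebesgue_measure_itv/= lte_fin; case: ltgtP ab => // -> _.
  by rewrite subrr.
exact: (congr1 fine muab).
Qed.

Lemma int_point a f : \int[mu]_(x in `[a, a]) f x = 0.
Proof. by rewrite set_itv1 Rintegral_set1. Qed.

Lemma int_empty a b f : b < a -> \int[mu]_(x in `[a, b]) f x = 0.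
Proof. by move=> ba; rewrite set_itv_ge ?bnd_simp -?ltNge// Rintegral_set0. Qed.

Lemma int_bounded a b k f : a <= b -> measurable_fun `[a, b] f ->
  (forall x, x \in `[a, b] -> `|f x| <= k) ->
  `|\int[mu]_(x in `[a, b]) f x| <= k * (b - a).
Proof.
move=> ab mf fk; rewrite -int_cst//.
have itf := itg_bounded mf fk.
rewrite (le_trans (int_norm _ itf))// int_le//; first exact: itg_norm.
exact: itg_cst.
Qed.

Lemma continuous_within D f : continuous f -> {within D, continuous f}.
Proof. exact: continuous_subspaceT. Qed.

Lemma itg_continuous a b f : continuous f -> itg `[a, b] f.
Proof. by move=> cf; apply/itg_cont/continuous_within. Qed.

Lemma FTC2 f F a b : a <= b -> (forall x, x \in `[a, b] -> is_derive x 1 F (f x)) ->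
  {within `[a, b], continuous f} ->
  \int[mu]_(x in `[a, b]) f x = F b - F a.
Proof.
rewrite le_eqVlt => /predU1P[<- _ _|ab dF cf]; first by rewrite int_point subrr.
have cF x : x \in `[a, b] -> {for x, continuous F}.
  by move=> /dF ?; apply/differentiable_continuous/derivable1_diffP.
rewrite /Rintegral (@continuous_FTC2 _ f F)//.
- split.
  + by move=> x xab; have /dF[] : x \in `[a, b] by apply: subset_itv_oo_cc.
  + by apply: cvg_at_right_filter; apply: cF; rewrite in_itv/= lexx ltW.
  + by apply: cvg_at_left_filter; apply: cF; rewrite in_itv/= lexx ltW.
- move=> x xab; have /dF[_] : x \in `[a, b] by apply: subset_itv_oo_cc.
  by rewrite derive1E.
Qed.

End Integrable.

(** * Limits, continuity and derivatives in epsilon-delta form *)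

Section EpsilonDelta.
Context (R : realType).
Implicit Types (f g : R -> R) (x y t : R).

Lemma cvgP_eps (T : Type) (F : set_system T) {FF : Filter F} (f : T -> R) l :
  (f x @[x --> F] --> l) <-> forall e, 0 < e -> \forall x \near F, `|f x - l| < e.
Proof.
split=> [/cvgrPdist_lt fl e e0|fl].
  by near=> x; rewrite distrC; near: x; exact: fl.
by apply/cvgrPdist_lt => e e0; near=> x; rewrite distrC; near: x; exact: fl.
Unshelve. all: by end_near. Qed.

Lemma near_within_eps (A : set R) (P : R -> Prop) t :
  (\forall s \near within A (nbhs t), P s) <->
  exists2 d, 0 < d & forall s, A s -> `|s - t| < d -> P s.
Proof.
split.
- move=> /nbhs_ballP[d /= d0 dP]; exists d => // s As st.
  by apply: dP => //; rewrite /ball/= distrC.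
- move=> [d d0 dP]; apply/nbhs_ballP; exists d => // s; rewrite /ball/= distrC.
  by move=> st As; exact: dP.
Qed.

Lemma near_dnbhs_eps (P : R -> Prop) t :
  (\forall s \near t^', P s) <->
  exists2 d, 0 < d & forall s, s != t -> `|s - t| < d -> P s.
Proof. exact: near_within_eps. Qed.

Lemma continuous_eps f x : {for x, continuous f} <->
  forall e, 0 < e -> exists2 d, 0 < d & forall y, `|y - x| < d -> `|f y - f x| < e.
Proof.
split=> [/cvgP_eps fx e /fx|fx].
  move=> /nbhs_ballP[d /= d0 dP]; exists d => // s st.
  by apply: dP => //; rewrite /ball/= distrC.
apply/cvgP_eps => e /fx[d d0 dP]; apply/nbhs_ballP; exists d => // s.
by rewrite /ball/= distrC => /dP.
Qed.

Lemma is_derive_eps f x l : is_derive x 1 f l <->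
  forall e, 0 < e -> exists2 d, 0 < d &
    forall h, `|h| < d -> `|f (x + h) - f x - h * l| <= e * `|h|.
Proof.
have E h : h != 0 -> forall e, (`|h^-1 * (f (h + x) - f x) - l| <= e) =
    (`|f (x + h) - f x - h * l| <= e * `|h|).
  move=> h0 e; rewrite -ler_pdivrMr ?normr_gt0// -normfV -normrM; congr (`|_| <= _).
  by rewrite [x + h]addrC; field.
split=> [[df fl] e e0|H].
- have /cvgP_eps : (h^-1 *: (f (h *: 1 + x) - f x)) @[h --> 0^'] --> l.
    by rewrite -fl; exact: df.
  move=> /(_ _ e0)/near_dnbhs_eps[d d0 dP]; exists d => // h hd.
  have [->|h0] := eqVneq h 0; first by rewrite addr0 mul0r !subrr normr0 mulr0.
  rewrite -E// ltW//; have := dP h h0; rewrite subr0 => /(_ hd).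
  by rewrite /GRing.scale/= mulr1.
- have H' : (h^-1 *: (f (h *: 1 + x) - f x)) @[h --> 0^'] --> l.
    apply/cvgP_eps => e e0; have e20 : 0 < e / 2 by rewrite divr_gt0.
    apply/near_dnbhs_eps; have [d d0 dP] := H _ e20; exists d => // h h0.
    rewrite subr0 => /dP; rewrite -E// /GRing.scale/= mulr1 => /le_lt_trans; apply.
    by rewrite ltr_pdivrMr// ltr_pMr// ltr1n.
  by split; [apply: cvgP H'|exact: cvg_lim H'].
Qed.

Lemma is_derive_continuous f x l : is_derive x 1 f l -> {for x, continuous f}.
Proof. by move=> ?; apply/differentiable_continuous/derivable1_diffP. Qed.

Lemma is_derive_near f g x l d : 0 < d -> (forall y, `|y - x| < d -> f y = g y) ->
  is_derive x 1 f l -> is_derive x 1 g l.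
Proof.
move=> d0 fg /is_derive_eps H; apply/is_derive_eps => e /H[d' d'0 H'].
exists (Num.min d d'); first by rewrite lt_min d0.
move=> h; rewrite lt_min => /andP[hd hd'].
by rewrite -!fg ?subrr ?normr0// ?H'// addrC addKr.
Qed.

Lemma lipschitz_continuous k f : (forall x y, `|f x - f y| <= k * `|x - y|) ->
  continuous f.
Proof.
move=> fk x; apply/continuous_eps => e e0.
have k0 : 0 < `|k| + 1 by rewrite ltr_wpDl.
exists (e / (`|k| + 1)); first by rewrite divr_gt0.
move=> y; rewrite ltr_pdivlMr// => yx; rewrite (le_lt_trans (fk _ _))//.
rewrite (le_lt_trans _ yx)// mulrC ler_wpM2l//.
by rewrite (le_trans (ler_norm _))// lerDl.
Qed.

Lemma within_continuousP (A : set R) f : {within A, continuous f} <->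
  forall x, A x -> forall e, 0 < e -> exists2 d, 0 < d &
    forall y, A y -> `|y - x| < d -> `|f y - f x| < e.
Proof.
split=> [/subspace_continuousP cf x Ax e e0|H].
  by have /cvgP_eps/(_ _ e0)/near_within_eps := cf x Ax.
apply/subspace_continuousP => x Ax; apply/cvgP_eps => e e0.
by apply/near_within_eps; exact: H.
Qed.

(** A Lebesgue number argument: finitely many balls of half the admissible radius cover the segment,
    and [d] is at most each of these half radii, so that two points at distance less than [d] lie in
    one ball of full radius. *)
Lemma uniform_continuity f (a b e : R) : continuous f -> 0 < e ->
  exists2 d, 0 < d & forall x y, x \in `[a, b] -> y \in `[a, b] ->
    `|x - y| < d -> `|f x - f y| < e.
Proof.
move=> cf e0; apply: contrapT => H.
have K := @segment_compact R a b.
pose P (x d : R) := forall y z : R, `|y - x| < d -> `|z - x| < d -> `|f y - f z| < e.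
have Pd (x : R) : exists2 d : R, 0 < d & P x d.
  have e2 : 0 < e / 2 by rewrite divr_gt0.
  have /continuous_eps/(_ _ e2)[d d0 dP] := cf x.
  exists d => // y z yx zx.
  rewrite -(subrKA (f x)) (le_lt_trans (ler_normD _ _))// [ltRHS]splitr.
  by rewrite ltrD ?dP// distrC dP.
pose D (x : R) : R := projT1 (cid2 (Pd x)).
have D0 x : 0 < D x by rewrite /D; case: cid2.
have DP x : P x (D x) by rewrite /D; case: cid2.
move: K; rewrite compact_cover => /(_ R `[a, b]%classic (fun x => ball x (D x / 2 : R))).
case.
- by move=> x _; exact: ball_open.
- move=> x xab; exists x => //; rewrite /= /ball/= subrr normr0 divr_gt0//.
move=> F Fab cov; apply: H.
have : exists2 d : R, 0 < d & forall x, x \in finmap.enum_fset F -> d <= D x / 2.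
  exists (\big[Num.min/1]_(x <- finmap.enum_fset F) (D x / 2)).
    by elim/big_ind : _ => // [x y x0 y0|x _]; rewrite ?lt_min ?x0// divr_gt0.
  by move=> x xF; apply: ge_bigmin_seq => //.
move=> [d d0 dD]; exists d => // x y xab yab xy.
have [z /= zF xz] := cov x xab.
have zx : `|x - z| < D z / 2 by rewrite distrC; exact: xz.
apply: (DP z).
  by rewrite (lt_le_trans zx)// ler_pdivrMr// ler_pMr// ler1n.
rewrite -(subrKA x) (le_lt_trans (ler_normD _ _))// [ltRHS]splitr ltrD//.
by rewrite distrC (lt_le_trans xy)// dD.
Qed.

End EpsilonDelta.

(** * Absolutely continuous functions and the product rule *)

Section AbsolutelyContinuous.
Context (R : realType).
Local Notation mu := (@lebesgue_measure R).
Implicit Types (u v w f g F : R -> R) (a b c x y z : R).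

Definition clamp a b x : R := Num.max a (Num.min x b).

Lemma clamp_itv a b x : a <= b -> a <= clamp a b x <= b.
Proof. by move=> ab; rewrite /clamp le_max lexx ge_max ab ge_min lexx orbT. Qed.

Lemma clamp_id a b x : a <= x <= b -> clamp a b x = x.
Proof. by move=> /andP[ax xb]; rewrite /clamp (min_idPl xb) (max_idPr ax). Qed.

Lemma clamp_lip a b x y : `|clamp a b x - clamp a b y| <= `|x - y|.
Proof.
wlog xy : x y / x <= y => [H|].
  by have [/H//|/ltW/H] := leP x y; rewrite distrC [X in _ <= X]distrC.
rewrite !ler0_norm ?subr_le0//; rewrite /clamp !maxElt !minElt.
  by case: (ltP x b) => ?; case: (ltP y b) => ?; case: ltP => ?; case: ltP => ?; lra.
by case: (ltP x b) => ?; case: (ltP y b) => ?; case: ltP => ?; case: ltP => ?; lra.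
Qed.

Lemma clamp_continuous a b : continuous (clamp a b).
Proof. by apply: (@lipschitz_continuous _ 1) => x y; rewrite mul1r clamp_lip. Qed.

Lemma continuous_clamp a b f : a <= b -> {within `[a, b], continuous f} ->
  continuous (f \o clamp a b).
Proof.
move=> ab /within_continuousP cf x; apply/continuous_eps => e e0.
have [|d d0 dP] := cf (clamp a b x) _ _ e0; first by rewrite /= in_itv/= clamp_itv.
exists d => // y yx; apply: dP; first by rewrite /= in_itv/= clamp_itv.
exact: le_lt_trans (clamp_lip _ _ _ _) yx.
Qed.

Lemma within_uniform_continuity f a b (e : R) : {within `[a, b], continuous f} ->
  0 < e -> exists2 d, 0 < d & forall x y, a <= x <= b -> a <= y <= b ->
    `|x - y| < d -> `|f x - f y| < e.
Proof.
have [ab|ba] := leP a b; last first.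
  move=> _ _; exists 1 => // x y /andP[ax xb].
  by have := le_trans ax xb; rewrite leNgt ba.
move=> /(continuous_clamp ab)/(uniform_continuity a b) H /H[d d0 dP].
exists d => // x y xab yab xy.
by have := dP x y; rewrite !in_itv/= !clamp_id// => ->.
Qed.

(** Absolute continuity is expressed by the integral formula with a named derivative [v], which is
    determined only almost everywhere. Pointwise differentiation of integrals of L^1 functions is
    thereby avoided. *)
Definition ac a b u v := itg `[a, b] v /\
  forall x y, a <= x -> x <= y -> y <= b -> u y - u x = \int[mu]_(s in `[x, y]) v s.

Lemma ac_sub a b c d u v : a <= c -> d <= b -> ac a b u v -> ac c d u v.
Proof.
move=> ac db [iv uv]; split; first exact: itg_sub iv.
by move=> x y cx xy yd; apply: uv => //; [exact: le_trans cx|exact: le_trans yd db].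
Qed.

Lemma ac_int a b u v x : ac a b u v -> a <= x -> x <= b ->
  u x = u a + \int[mu]_(s in `[a, x]) v s.
Proof. by move=> [iv uv] ax xb; rewrite -uv// addrC subrK. Qed.

Lemma ac_primitive a b u v : itg `[a, b] v ->
  (forall x, a <= x <= b -> u x = u a + \int[mu]_(s in `[a, x]) v s) -> ac a b u v.
Proof.
move=> iv uv; split=> // x y ax xy yb.
rewrite [u y]uv; last by rewrite yb (le_trans ax).
rewrite [u x]uv; last by rewrite ax (le_trans xy).
rewrite (int_cat ax xy); last exact: itg_sub iv.
by ring.
Qed.

Lemma ac_continuous a b u v : ac a b u v -> {within `[a, b], continuous u}.
Proof.
have [ab|ba] := leP a b; last by move=> _; rewrite set_itv_ge ?bnd_simp -?ltNge//; exact: continuous_subspace0.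
move=> H; have [iv uv] := H; have := parameterized_integral_continuous ab iv.
move=> /within_continuousP C; apply/within_continuousP => x xab e e0.
have [d d0 dP] := C x xab e e0; exists d => // y yab yx.
move: xab yab; rewrite /= !in_itv/= => /andP[ax xb] /andP[ay yb].
rewrite (ac_int H ax xb) (ac_int H ay yb) opprD addrACA subrr add0r.
by apply: dP => //; rewrite /= in_itv/= ay.
Qed.

Lemma ac_measurable a b u v : ac a b u v -> measurable_fun `[a, b] u.
Proof.
by move=> /ac_continuous; apply: subspace_continuous_measurable_fun.
Qed.

Lemma within_continuous_bounded a b u : {within `[a, b], continuous u} ->
  exists2 k, 0 < k & forall x, a <= x <= b -> `|u x| <= k.
Proof.
have [ab|ba] := leP a b; last first.
  move=> _; exists 1 => // x /andP[ax xb].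
  by have := le_trans ax xb; rewrite leNgt ba.
move=> cu; have cau : {within `[a, b], continuous (fun x => `|u x|)}.
  by move=> x; apply: continuous_comp (cu x) _; exact: norm_continuous.
have [c _ cP] := EVT_max ab cau; exists (`|u c| + 1); first by rewrite ltr_wpDl.
by move=> x xab; rewrite (le_trans (cP _ _))// ?lerDl// in_itv.
Qed.

Lemma ac_bounded a b u v : ac a b u v ->
  exists2 k, 0 < k & forall x, a <= x <= b -> `|u x| <= k.
Proof. by move=> /ac_continuous/within_continuous_bounded. Qed.

Lemma eq_ac a b u v u' v' : (forall x, a <= x <= b -> u x = u' x) ->
  (forall x, a <= x <= b -> v x = v' x) -> ac a b u v -> ac a b u' v'.
Proof.
move=> uu vv [iv uv]; split.
  by apply: eq_itg iv => // x /=; rewrite in_itv/= => /vv.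
move=> x y ax xy yb; rewrite -(uu y); last by rewrite yb (le_trans ax).
rewrite -(uu x); last by rewrite ax (le_trans xy).
rewrite uv//; apply: int_eq => // s /=; rewrite in_itv/= => /andP[xs sy]; apply: vv.
by rewrite (le_trans ax)//= (le_trans sy).
Qed.

Lemma ac_cst a b k : ac a b (fun=> k) (fun=> 0).
Proof.
split; first exact: itg_cst.
by move=> x y ax xy yb; rewrite int_cst// mul0r subrr.
Qed.

Lemma acD a b u1 v1 u2 v2 : ac a b u1 v1 -> ac a b u2 v2 ->
  ac a b (fun x => u1 x + u2 x) (fun x => v1 x + v2 x).
Proof.
move=> [iv1 uv1] [iv2 uv2]; split; first exact: itgD.
move=> x y ax xy yb.
rewrite RintegralD//; [|exact: itg_sub iv1|exact: itg_sub iv2].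
by rewrite -uv1// -uv2//; ring.
Qed.

Lemma acZ a b k u v : ac a b u v -> ac a b (fun x => k * u x) (fun x => k * v x).
Proof.
move=> [iv uv]; split; first exact: itgZ.
move=> x y ax xy yb; rewrite RintegralZl//; last exact: itg_sub iv.
by rewrite -uv// mulrBr.
Qed.

Lemma derive_ac a b F f : (forall x, x \in `[a, b] -> is_derive x 1 F (f x)) ->
  {within `[a, b], continuous f} -> ac a b F f.
Proof.
move=> dF cf; split; first exact: itg_cont.
move=> x y ax xy yb.
have dF' z : z \in `[x, y] -> is_derive z 1 F (f z).
  rewrite in_itv/= => /andP[xz zy]; apply: dF.
  by rewrite in_itv/= (le_trans ax)//= (le_trans zy).
have cf' : {within `[x, y], continuous f}.
  by apply: continuous_subspaceW cf; apply: subset_itv; rewrite bnd_simp.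
by rewrite (FTC2 xy dF' cf').
Qed.

(** Along a partition of mesh less than [d] the bounds add up to [e] times the integral of [|v|],
    and [e] is arbitrary. Dividing by [V + 1] instead of [V] covers the case [V = 0]. *)
Lemma small_increments_const F v a b : a <= b -> itg `[a, b] v ->
  (forall e, 0 < e -> exists2 d, 0 < d & forall x y, a <= x -> x <= y -> y <= b ->
     y - x < d -> `|F y - F x| <= e * \int[mu]_(s in `[x, y]) `|v s|) ->
  F b = F a.
Proof.
move=> ab iv H; apply/eqP; rewrite -subr_eq0 -normr_le0; apply/ler_addgt0Pr => e e0.
set V := \int[mu]_(s in `[a, b]) `|v s|.
have V0 : 0 <= V by apply: Rintegral_ge0.
have V1 : 0 < V + 1 by rewrite ltr_wpDl.
have [|d d0 dP] := H (e / (V + 1)); first by rewrite divr_gt0.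
pose n := (Num.truncn ((b - a) / d)).+1.
have n0 : 0 < n%:R :> R by rewrite ltr0n.
have nd : (b - a) / n%:R < d.
  by rewrite ltr_pdivrMr// mulrC -ltr_pdivrMr// truncnS_gt.
pose h := (b - a) / n%:R.
have h0 : 0 <= h by rewrite divr_ge0 ?subr_ge0// ltW.
have hn : a + n%:R * h = b by rewrite /h; field; rewrite gt_eqF.
have Hk k : (k <= n)%N -> `|F (a + k%:R * h) - F a| <=
    e / (V + 1) * \int[mu]_(s in `[a, a + k%:R * h]) `|v s|.
  elim: k => [|k IH kn]; first by rewrite mul0r addr0 subrr normr0 int_point mulr0.
  have ak : a <= a + k%:R * h by rewrite lerDl mulr_ge0.
  have kk : a + k%:R * h <= a + k.+1%:R * h by rewrite lerD2l ler_wpM2r// ler_nat.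
  have kb : a + k.+1%:R * h <= b by rewrite -hn lerD2l ler_wpM2r// ler_nat.
  rewrite (int_cat ak kk); last by apply/itg_norm; apply: itg_sub iv.
  rewrite mulrDr -(subrKA (F (a + k%:R * h))) addrC.
  rewrite (le_trans (ler_normD _ _))// addrC addrC lerD ?IH ?(ltnW kn)//.
  apply: dP => //; rewrite opprD addrACA subrr add0r -mulrBl -natrB// subSnn mul1r.
  exact: nd.
have := Hk n (leqnn n); rewrite hn => /le_trans; apply.
rewrite add0r -/V mulrAC ler_pdivrMr// ler_wpM2l ?lerDl// ltW//.
Qed.

(** The rules for products and inverses reduce to this criterion: [u] minus the integral of [w] is
    constant as soon as its increments are negligible with respect to those of the integral of
    [|v|]. *)
Lemma ac_small_increments u v w a b : itg `[a, b] v -> itg `[a, b] w ->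
  (forall e, 0 < e -> exists2 d, 0 < d & forall x y, a <= x -> x <= y -> y <= b ->
     y - x < d -> `|u y - u x - \int[mu]_(s in `[x, y]) w s| <=
                  e * \int[mu]_(s in `[x, y]) `|v s|) ->
  ac a b u w.
Proof.
move=> iv iw H; apply: ac_primitive => // z /andP[az zb].
have iwz x y : a <= x -> y <= b -> itg `[x, y] w by move=> *; exact: itg_sub iw.
suff : u z - \int[mu]_(s in `[a, z]) w s = u a - \int[mu]_(s in `[a, a]) w s.
  by rewrite int_point subr0 => <-; rewrite subrK.
apply: (@small_increments_const (fun z => u z - \int[mu]_(s in `[a, z]) w s) v) => //.
  exact: itg_sub iv.
move=> e /H[d d0 dP]; exists d => // x y ax xy yz yxd.
rewrite (int_cat ax xy); last exact/iwz/(le_trans yz).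
have := dP x y ax xy (le_trans yz zb) yxd; congr (`|_| <= _); ring.
Qed.

Lemma acM a b u1 v1 u2 v2 : ac a b u1 v1 -> ac a b u2 v2 ->
  ac a b (fun x => u1 x * u2 x) (fun x => v1 x * u2 x + u1 x * v2 x).
Proof.
move=> A1 A2; have [iv1 uv1] := A1; have [iv2 uv2] := A2.
have [k1 _ u1k] := ac_bounded A1; have [k2 _ u2k] := ac_bounded A2.
have m1 := ac_measurable A1; have m2 := ac_measurable A2.
have i12 : itg `[a, b] (fun x => v1 x * u2 x).
  apply: eq_itg (itgM_bounded _ m2 _ iv1) => //; first by move=> x _; rewrite mulrC.
  by move=> x /=; rewrite in_itv/=; exact: u2k.
have i21 : itg `[a, b] (fun x => u1 x * v2 x).
  apply: (itgM_bounded _ m1 _ iv2) => //.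
  by move=> x /=; rewrite in_itv/=; exact: u1k.
apply: (@ac_small_increments _ (fun x => `|v1 x| + `|v2 x|)).
- by apply: itgD => //; exact: itg_norm.
- exact: itgD.
move=> e e0.
have [d1 d10 d1P] := within_uniform_continuity (ac_continuous A1) e0.
have [d2 d20 d2P] := within_uniform_continuity (ac_continuous A2) e0.
exists (Num.min d1 d2); first by rewrite lt_min d10.
move=> x y ax xy yb; rewrite lt_min => /andP[yx1 yx2].
have sub f : itg `[a, b] f -> itg `[x, y] f by apply: itg_sub.
(* An exact formula with the continuous factors frozen at the ends of [[x, y]]; replacing them by
   their values at [s] costs only their moduli of continuity. *)
have E : u1 y * u2 y - u1 x * u2 x = \int[mu]_(s in `[x, y]) (u2 y * v1 s + u1 x * v2 s).
  rewrite RintegralD//; try exact/itgZ/sub.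
  rewrite !RintegralZl//; try exact/sub.
  by rewrite -uv1// -uv2//; ring.
rewrite E -RintegralB//; first last.
- exact/sub/itgD.
- by apply: itgD => //; exact/itgZ/sub.
rewrite -RintegralZl//; last by apply: sub; apply/itg_norm/itgD => //; exact/itg_norm.
have iI : itg `[x, y] (fun s => u2 y * v1 s + u1 x * v2 s - (v1 s * u2 s + u1 s * v2 s)).
  by apply: itgB => //; [apply: itgD => //; exact/itgZ/sub|exact/sub/itgD].
rewrite (le_trans (int_norm _ iI))//; apply: int_le => //; first exact: itg_norm.
  by apply/itgZ/itg_norm/itgD => //; exact/itg_norm/sub.
move=> s /=; rewrite in_itv/= => /andP[xs sy].
have sab : a <= s <= b by rewrite (le_trans ax)//= (le_trans sy).
have -> : u2 y * v1 s + u1 x * v2 s - (v1 s * u2 s + u1 s * v2 s) =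
  (u2 y - u2 s) * v1 s + (u1 x - u1 s) * v2 s by ring.
rewrite (le_trans (ler_normD _ _))// !normrM [X in _ <= e * X]ger0_norm ?addr_ge0// mulrDr lerD//.
  rewrite ler_wpM2r// ltW// d2P//; first by rewrite yb (le_trans ax).
  by rewrite ger0_norm ?subr_ge0// (le_lt_trans _ yx2)// lerD2l lerN2.
rewrite ler_wpM2r// ltW// d1P//; first by rewrite ax (le_trans xy).
by rewrite distrC ger0_norm ?subr_ge0// (le_lt_trans _ yx1)// lerD2r.
Qed.

End AbsolutelyContinuous.

(** * Inverses of absolutely continuous functions and primitives on the line *)

Section Primitive.
Context (R : realType).
Local Notation mu := (@lebesgue_measure R).
Implicit Types (u v w f g F : R -> R) (a b c d x y z : R).

Lemma within_continuousV D u d : 0 < d -> (forall x, D x -> d <= u x) ->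
  {within D, continuous u} -> {within D, continuous (fun x => (u x)^-1)}.
Proof.
move=> d0 du /within_continuousP cu; apply/within_continuousP => x Dx e e0.
have [|d' d'0 H] := cu x Dx (e * d ^+ 2); first by rewrite mulr_gt0// exprn_gt0.
exists d' => // y Dy yx.
have uy : 0 < u y by rewrite (lt_le_trans d0) ?du.
have ux : 0 < u x by rewrite (lt_le_trans d0) ?du.
have -> : (u y)^-1 - (u x)^-1 = (u x - u y) / (u x * u y) by field; rewrite !gt_eqF.
rewrite normrM normfV (ger0_norm (mulr_ge0 (ltW ux) (ltW uy))).
rewrite ltr_pdivrMr ?mulr_gt0// distrC (lt_le_trans (H _ Dy yx))//.
by rewrite ler_wpM2l ?(ltW e0)// expr2 ler_pM ?(ltW d0) ?du.
Qed.

Lemma acV a b u v d : 0 < d -> (forall x, a <= x <= b -> d <= u x) ->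
  ac a b u v -> ac a b (fun x => (u x)^-1) (fun x => - v x * (u x)^-1 ^+ 2).
Proof.
move=> d0 du A; have [iv uv] := A.
have du' x : `[a, b]%classic x -> d <= u x by rewrite /= in_itv/=; exact: du.
have cg := within_continuousV d0 du' (ac_continuous A).
have mg : measurable_fun `[a, b] (fun x => (u x)^-1).
  by apply: subspace_continuous_measurable_fun cg.
have gd x : a <= x <= b -> 0 <= (u x)^-1 <= d^-1.
  move=> xab; have ux : 0 < u x by rewrite (lt_le_trans d0) ?du.
  by rewrite invr_ge0 ltW//= lef_pV2 ?du.
have iw : itg `[a, b] (fun x => - v x * (u x)^-1 ^+ 2).
  apply: eq_itg (itgM_bounded (k := d^-1 ^+ 2) _ (measurable_funX 2 mg) _ (itgN _ iv)) => //.
    by move=> x _; rewrite mulrC.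
  move=> x /=; rewrite in_itv/= => /gd/andP[g0 gd2].
  by rewrite normrX ger0_norm// lerXn2r// nnegrE// invr_ge0 ltW.
apply: (ac_small_increments iv iw) => e e0.
(* Two differences of [u^-1] occur below, each multiplied by a value of [u^-1], that is by at most
   [d^-1]; with this modulus each product is at most [e / 2]. *)
have e' : 0 < e * d / 2 by rewrite divr_gt0// mulr_gt0.
have [d1 d10 d1P] := within_uniform_continuity cg e'.
exists d1 => // x y ax xy yb xyd.
have xab : a <= x <= b by rewrite ax (le_trans xy).
have yab : a <= y <= b by rewrite yb (le_trans ax).
have sub f : itg `[a, b] f -> itg `[x, y] f by apply: itg_sub.
have uy : 0 < u y by rewrite (lt_le_trans d0) ?du.
have ux : 0 < u x by rewrite (lt_le_trans d0) ?du.
have -> : (u y)^-1 - (u x)^-1 = - ((u x)^-1 * (u y)^-1) * (u y - u x).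
  by field; rewrite !gt_eqF.
rewrite uv// -RintegralZl//; last exact: sub.
rewrite -RintegralB//; [|exact/itgZ/sub|exact: sub].
have iI : itg `[x, y] (fun s => - ((u x)^-1 * (u y)^-1) * v s - - v s * (u s)^-1 ^+ 2).
  by apply: itgB => //; [exact/itgZ/sub|exact: sub].
rewrite (le_trans (int_norm _ iI))// -RintegralZl//; last exact/itg_norm/sub.
apply: int_le => //; [exact: itg_norm|exact/itgZ/itg_norm/sub|].
move=> s /=; rewrite in_itv/= => /andP[xs sy].
have sab : a <= s <= b by rewrite (le_trans ax)//= (le_trans sy).
have -> : - ((u x)^-1 * (u y)^-1) * v s - - v s * (u s)^-1 ^+ 2 =
  ((u s)^-1 * ((u s)^-1 - (u x)^-1) + (u x)^-1 * ((u s)^-1 - (u y)^-1)) * v s by ring.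
rewrite normrM ler_wpM2r//.
have H z : a <= z <= b -> `|s - z| < d1 -> forall t, a <= t <= b ->
   `|(u t)^-1 * ((u s)^-1 - (u z)^-1)| <= e / 2.
  move=> zab sz t /gd/andP[t0 td]; rewrite normrM (ger0_norm t0).
  have -> : e / 2 = d^-1 * (e * d / 2) by field; rewrite gt_eqF.
  by rewrite ler_pM// ltW// d1P.
rewrite (le_trans (ler_normD _ _))// [leRHS]splitr lerD// H//.
  by rewrite ger0_norm ?subr_ge0// (le_lt_trans _ xyd)// lerD2r.
by rewrite distrC ger0_norm ?subr_ge0// (le_lt_trans _ xyd)// lerD2l lerN2.
Qed.

(** The oriented integral from 0 to [x]: an interval with reversed bounds is empty, so that at most
    one of the two terms is nonzero, according to the sign of [x]. *)
Definition prim v x := \int[mu]_(s in `[0, x]) v s - \int[mu]_(s in `[x, 0]) v s.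

Lemma prim_pos v x : 0 <= x -> prim v x = \int[mu]_(s in `[0, x]) v s.
Proof.
rewrite /prim le_eqVlt => /predU1P[<-|x0]; first by rewrite int_point subr0.
by rewrite (int_empty _ x0) subr0.
Qed.

Lemma prim0 v : prim v 0 = 0.
Proof. by rewrite prim_pos// int_point. Qed.

Lemma primB v x y : x <= y -> (forall a b, itg `[a, b] v) ->
  prim v y - prim v x = \int[mu]_(s in `[x, y]) v s.
Proof.
move=> xy iv; have [x0|x0] := leP 0 x.
  rewrite !prim_pos ?(le_trans x0)// (int_cat x0 xy)//.
  by rewrite addrC addrA addNr add0r.
have [y0|y0] := leP 0 y.
  rewrite prim_pos// /prim (int_empty _ x0) sub0r opprK addrC.
  by rewrite -int_cat// ltW.
rewrite /prim (int_empty _ x0) (int_empty _ y0) (int_cat xy (ltW y0))//; ring.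
Qed.

Lemma prim_ac v a b : (forall a b, itg `[a, b] v) -> ac a b (prim v) v.
Proof. by move=> iv; split=> // x y _ xy _; rewrite primB. Qed.

Lemma int_derive v a x : a < x -> (forall b, itg `[a, b] v) ->
  {for x, continuous v} ->
  is_derive x 1 (fun y => \int[mu]_(s in `[a, y]) v s) (v x).
Proof.
move=> ax iv cv.
have [] := @continuous_FTC1_closed _ v a x (x + 1) _ (iv _) ax cv; first by rewrite ltrDl.
by rewrite derive1E => ? <-; exact: DeriveDef.
Qed.

Lemma prim_derive v x : (forall a b, itg `[a, b] v) -> {for x, continuous v} ->
  is_derive x 1 (prim v) (v x).
Proof.
move=> iv cv.
have H : is_derive x 1 (fun y => \int[mu]_(s in `[x - 1, y]) v s) (v x).
  by apply: int_derive => //; rewrite ltrBlDr ltrDl.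
have H' : is_derive x 1 (cst (prim v (x - 1)) \+
    (fun y => \int[mu]_(s in `[x - 1, y]) v s)) (v x).
  by apply: is_derive_eq; rewrite add0r.
apply: is_derive_near H' => //= y yx.
rewrite /= -primB ?iv//; first by rewrite addrC subrK.
by move: yx; rewrite ltr_norml => /andP[? _]; lra.
Qed.

Lemma prim_continuous v : (forall a b, itg `[a, b] v) -> continuous (prim v).
Proof.
move=> iv x; have /ac_continuous := @prim_ac v (x - 1) (x + 1) iv.
move=> /continuous_within_itvP[]; first by lra.
by move=> /(_ x) C _ _; apply: C; rewrite in_itv/=; apply/andP; split; lra.
Qed.

End Primitive.

(** * Square-integrable functions on a segment *)

Section SquareIntegrable.
Context (R : realType).
Local Notation mu := (@lebesgue_measure R).
Implicit Types (u v w f g F : R -> R) (a b c d x y z : R).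

(** Measurability of [v] has to be required, as it does not follow from the integrability of its
    square. The proof works with the squared norm [nsq], which is an integral and additive over
    adjacent segments. *)
Definition sqi a b v := measurable_fun `[a, b] v /\ itg `[a, b] (fun x => v x ^+ 2).
Definition nsq a b v : R := \int[mu]_(x in `[a, b]) (v x ^+ 2).

Lemma sqi_sub a b c d v : a <= c -> d <= b -> sqi a b v -> sqi c d v.
Proof.
move=> ac db [mv iv]; split; last exact: itg_sub iv.
by apply: measurable_funS mv => //; apply: subset_itv; rewrite bnd_simp.
Qed.

Lemma eq_sqi a b u v : (forall x, a <= x <= b -> u x = v x) -> sqi a b u -> sqi a b v.
Proof.
move=> uv [mu_ iu]; split.
  by apply: eq_measurable_fun mu_ => x /set_mem /=; rewrite in_itv/= => /uv.
by apply: eq_itg iu => // x /=; rewrite in_itv/= => /uv ->.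
Qed.

Lemma eq_nsq a b u v : (forall x, a <= x <= b -> u x = v x) -> nsq a b u = nsq a b v.
Proof. by move=> uv; apply: int_eq => x /=; rewrite in_itv/= => /uv ->. Qed.

Lemma sqi_mul a b u v : sqi a b u -> sqi a b v -> itg `[a, b] (fun x => u x * v x).
Proof.
move=> [mu_ iu] [mv iv].
apply: (@itg_le _ _ _ _ (fun x => u x ^+ 2 + v x ^+ 2)) => //.
- exact: measurable_funM.
- exact: itgD.
- move=> x _; rewrite ler_norml; have := sqr_ge0 (u x - v x).
  have := sqr_ge0 (u x + v x); have := sqr_ge0 (u x); have := sqr_ge0 (v x).
  by rewrite sqrrB sqrrD => *; apply/andP; split; lra.
Qed.

Lemma sqi_bounded a b k u : measurable_fun `[a, b] u ->
  (forall x, a <= x <= b -> `|u x| <= k) -> sqi a b u.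
Proof.
move=> mu_ uk; split=> //; apply: (@itg_bounded _ _ _ (k ^+ 2)).
  exact: measurable_funX.
move=> x; rewrite in_itv/= => /uk ukx.
by rewrite normrX lerXn2r ?nnegrE// (le_trans _ ukx).
Qed.

Lemma sqi_within a b u : {within `[a, b], continuous u} -> sqi a b u.
Proof.
move=> cu; have [k _ uk] := within_continuous_bounded cu; apply: sqi_bounded uk.
by apply: subspace_continuous_measurable_fun cu.
Qed.

Lemma sqi_continuous a b u : continuous u -> sqi a b u.
Proof. by move=> cu; apply/sqi_within/continuous_subspaceT. Qed.

Lemma sqi_cst a b k : sqi a b (fun=> k).
Proof. by apply: sqi_continuous => x; exact: cvg_cst. Qed.

Lemma sqi_itg a b u : sqi a b u -> itg `[a, b] u.
Proof.
by move=> /sqi_mul/(_ (sqi_cst _ _ 1)); apply: eq_itg => // x; rewrite mulr1.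
Qed.

Lemma sqiD a b u v : sqi a b u -> sqi a b v -> sqi a b (fun x => u x + v x).
Proof.
move=> su sv; split; first by apply: measurable_funD; [case: su|case: sv].
apply: (@eq_itg _ _ _ (fun x => u x ^+ 2 + v x ^+ 2 + 2 * (u x * v x))) => //.
  by move=> x _; ring.
apply: itgD => //; last exact/itgZ/sqi_mul.
by apply: itgD => //; [case: su|case: sv].
Qed.

Lemma sqiM_bounded a b k u v : measurable_fun `[a, b] u ->
  (forall x, a <= x <= b -> `|u x| <= k) -> sqi a b v -> sqi a b (fun x => u x * v x).
Proof.
move=> mu_ uk [mv iv]; split; first exact: measurable_funM.
apply: (@eq_itg _ _ _ (fun x => u x ^+ 2 * v x ^+ 2)) => //.
  by move=> x _; rewrite exprMn.
apply: (@itgM_bounded _ _ _ (k ^+ 2)) => //; first exact: measurable_funX.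
move=> x /=; rewrite in_itv/= => /uk ukx.
by rewrite normrX lerXn2r ?nnegrE// (le_trans _ ukx).
Qed.

Lemma sqiM_continuous a b u v : {within `[a, b], continuous u} -> sqi a b v ->
  sqi a b (fun x => u x * v x).
Proof.
move=> cu; have [k _ uk] := within_continuous_bounded cu; apply: sqiM_bounded uk.
by apply: subspace_continuous_measurable_fun cu.
Qed.

Lemma sqiZ a b k v : sqi a b v -> sqi a b (fun x => k * v x).
Proof.
by apply: sqiM_continuous; apply: continuous_subspaceT => x; exact: cvg_cst.
Qed.

Lemma sqiN a b v : sqi a b v -> sqi a b (fun x => - v x).
Proof. by move=> /(sqiZ (-1)); apply: eq_sqi => x _; rewrite mulN1r. Qed.

Lemma sqiB a b u v : sqi a b u -> sqi a b v -> sqi a b (fun x => u x - v x).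
Proof. by move=> su /sqiN; exact: sqiD. Qed.

Lemma nsq_ge0 a b u : 0 <= nsq a b u.
Proof. by apply: Rintegral_ge0 => x _; exact: sqr_ge0. Qed.

Lemma nsq_le a b u v : sqi a b u -> sqi a b v ->
  (forall x, a <= x <= b -> `|u x| <= `|v x|) -> nsq a b u <= nsq a b v.
Proof.
move=> [_ iu] [_ iv] uv; apply: int_le => // x /=; rewrite in_itv/= => /uv uvx.
by rewrite -(real_normK (num_real (u x))) -(real_normK (num_real (v x))) lerXn2r ?nnegrE.
Qed.

Lemma nsqZ a b k u : sqi a b u -> nsq a b (fun x => k * u x) = k ^+ 2 * nsq a b u.
Proof.
move=> [_ iu]; rewrite /nsq -RintegralZl//.
by apply: int_eq => x _; rewrite exprMn.
Qed.

Lemma nsqN a b u : nsq a b (fun x => - u x) = nsq a b u.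
Proof. by apply: int_eq => x _; rewrite sqrrN. Qed.

Lemma nsqD a b u v : sqi a b u -> sqi a b v ->
  nsq a b (fun x => u x + v x) <= 2 * nsq a b u + 2 * nsq a b v.
Proof.
move=> su sv; have [_ iu] := su; have [_ iv] := sv; have [_ iuv] := sqiD su sv.
rewrite /nsq -!RintegralZl// -RintegralD//; try exact: itgZ.
apply: int_le => //; first by apply: itgD => //; exact: itgZ.
by move=> x _; have := sqr_ge0 (u x - v x); rewrite sqrrB sqrrD; lra.
Qed.

Lemma nsqB a b u v : sqi a b u -> sqi a b v ->
  nsq a b (fun x => u x - v x) <= 2 * nsq a b u + 2 * nsq a b v.
Proof. by move=> su sv; rewrite -[nsq a b v]nsqN; apply: nsqD => //; exact: sqiN. Qed.

Lemma nsqM_bounded a b k u v : measurable_fun `[a, b] u ->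
  (forall x, a <= x <= b -> `|u x| <= k) -> sqi a b v ->
  nsq a b (fun x => u x * v x) <= k ^+ 2 * nsq a b v.
Proof.
move=> mu_ uk sv; rewrite -nsqZ//; apply: nsq_le.
- exact: sqiM_bounded uk sv.
- exact: sqiZ.
- move=> x /uk ukx; rewrite !normrM ler_wpM2r//.
  by rewrite (le_trans ukx)// ler_norm.
Qed.

Lemma nsq_bounded a b k u : a <= b -> measurable_fun `[a, b] u ->
  (forall x, a <= x <= b -> `|u x| <= k) -> nsq a b u <= k ^+ 2 * (b - a).
Proof.
move=> ab mu_ uk; have := nsqM_bounded mu_ uk (sqi_cst a b 1).
rewrite /nsq int_cst// expr1n mul1r.
by rewrite (@int_eq _ _ _ (fun x => u x ^+ 2))// => x _; rewrite mulr1.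
Qed.

(** The squared norm of [k u + l v] is a nonnegative quadratic form in [k] and [l]; it is evaluated
    at [k = nsq a b v] and [l = - P]. *)
Lemma cauchy_schwarz a b u v : sqi a b u -> sqi a b v ->
  (\int[mu]_(x in `[a, b]) (u x * v x)) ^+ 2 <= nsq a b u * nsq a b v.
Proof.
move=> su sv; set P := \int[mu]_(x in _) _.
have Q k l : 0 <= k ^+ 2 * nsq a b u + 2 * (k * l) * P + l ^+ 2 * nsq a b v.
  have := nsq_ge0 a b (fun x => k * u x + l * v x).
  have -> : nsq a b (fun x => k * u x + l * v x) = \int[mu]_(x in `[a, b])
      (k ^+ 2 * u x ^+ 2 + 2 * (k * l) * (u x * v x) + l ^+ 2 * v x ^+ 2).
    by apply: int_eq => x _; ring.
  have [_ iu] := su; have [_ iv] := sv; have iuv := sqi_mul su sv.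
  rewrite RintegralD ?RintegralD ?RintegralZl//; try exact: itgZ.
  by apply: itgD => //; exact: itgZ.
have := nsq_ge0 a b v; rewrite le_eqVlt => /predU1P[v0|v0].
  rewrite -v0 mulr0; have [->|P0] := eqVneq P 0; first by rewrite expr0n.
  (* If [nsq a b v = 0] the form is affine in [l]; this choice of [l] would give it the negative
     value [- nsq a b u - 2]. *)
  have := Q 1 (- (nsq a b u + 1) / P); rewrite -v0 mulr0 addr0 expr1n !mul1r.
  rewrite -[2 * _ * _]mulrA divfK//.
  by have := nsq_ge0 a b u; lra.
have := Q (nsq a b v) (- P).
have -> : nsq a b v ^+ 2 * nsq a b u + 2 * (nsq a b v * - P) * P + (- P) ^+ 2 * nsq a b v =
   nsq a b v * (nsq a b u * nsq a b v - P ^+ 2) by ring.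
by rewrite pmulr_rge0// subr_ge0.
Qed.

Lemma int_sqr_le a b u : a <= b -> sqi a b u ->
  (\int[mu]_(x in `[a, b]) u x) ^+ 2 <= (b - a) * nsq a b u.
Proof.
move=> ab su; have := cauchy_schwarz (sqi_cst a b 1) su.
rewrite /nsq int_cst// expr1n mul1r; congr (_ ^+ 2 <= _).
by apply: int_eq => x _; rewrite mul1r.
Qed.

Lemma nsq_cat a b c u : a <= b -> b <= c -> sqi a c u ->
  nsq a c u = nsq a b u + nsq b c u.
Proof. by move=> ab bc [_ iu]; exact: int_cat. Qed.

Lemma nsq_sub a b c d u : a <= c -> c <= d -> d <= b -> sqi a b u ->
  nsq c d u <= nsq a b u.
Proof.
move=> ac cd db su; have sc : sqi c b u by apply: sqi_sub su.
rewrite (nsq_cat ac _ su) ?(le_trans cd)// (nsq_cat cd db sc).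
have := nsq_ge0 a c u; have := nsq_ge0 d b u; lra.
Qed.

(** The inclusion of H^1 in the Hoelder class of exponent 1/2, by the Cauchy-Schwarz inequality
    against the constant 1. *)
Lemma ac_hoelder a b u v x y : ac a b u v -> sqi a b v ->
  a <= x <= b -> a <= y <= b -> (u x - u y) ^+ 2 <= `|x - y| * nsq a b v.
Proof.
move=> [_ uv] sv; wlog xy : x y / x <= y => [H|] xab yab.
  have [|/ltW] := leP x y => /H; first exact.
  by rewrite -opprB sqrrN distrC; apply.
move: xab yab => /andP[ax xb] /andP[ay yb].
rewrite -sqrrN opprB uv// distrC ger0_norm ?subr_ge0//.
rewrite (le_trans (int_sqr_le xy (sqi_sub ax yb sv)))//.
by rewrite ler_wpM2l ?subr_ge0// nsq_sub.
Qed.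

End SquareIntegrable.

(** * Change of variables *)

Section ChangeOfVariables.
Context (R : realType).
Local Notation mu := (@lebesgue_measure R).
Variables (X Y xi : R -> R).
Hypotheses (dX : forall y : R, is_derive y 1 X (xi y)) (cxi : continuous xi).
Hypotheses (xi0 : forall y, 0 < xi y) (YK : cancel Y X).
Implicit Types (f g h : R -> R) (a b x y : R) (E : set R).

Lemma cov_continuous : continuous X.
Proof. by move=> y; apply: is_derive_continuous (dX y). Qed.

Lemma cov_lt a b : a < b -> X a < X b.
Proof.
move=> ab; have [c _ Xc] := MVT ab (fun x _ => dX x) (continuous_within cov_continuous).
by rewrite -subr_gt0 Xc mulr_gt0// subr_gt0.
Qed.

Lemma cov_le a b : (X a <= X b) = (a <= b).
Proof.
have [ab|ba] := leP a b; last by apply/negbTE; rewrite -ltNge cov_lt.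
by move: ab; rewrite le_eqVlt => /predU1P[->|/cov_lt/ltW]; rewrite ?lexx.
Qed.

Lemma cov_ltE a b : (X a < X b) = (a < b).
Proof. by rewrite !ltNge cov_le. Qed.

Lemma cov_measurable E : measurable E -> measurable (X @^-1` E).
Proof.
move=> mE; have /(_ measurableT E mE) := continuous_measurable_fun cov_continuous.
by rewrite setTI.
Qed.

Local Open Scope ereal_scope.

Let nu (E : set (measurableTypeR R)) : \bar R := \int[mu]_(y in X @^-1` E) (xi y)%:E.

Let nu0 : nu set0 = 0. Proof. by rewrite /nu preimage_set0 integral_set0. Qed.

Let mxi E : measurable_fun E (fun y => (xi y)%:E).
Proof.
by apply/measurable_EFinP; exact: (measurable_funTS (continuous_measurable_fun cxi)).
Qed.

Let nu_ge0 E : 0 <= nu E.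
Proof. by apply: integral_ge0 => y _; rewrite lee_fin ltW. Qed.

Let nu_additive : semi_sigma_additive nu.
Proof.
move=> F mF tF mUF; rewrite /nu; apply: cvg_toP.
  apply: ereal_nondecreasing_is_cvgn => m n mn.
  by apply: lee_sum_nneg_natr => // k _ _; exact: nu_ge0.
rewrite preimage_bigcup ge0_integral_bigcup//=.
- by move=> k; exact: (cov_measurable (mF k)).
- exact: mxi.
- by move=> y _; rewrite lee_fin ltW.
- move=> i j _ _ [y [/= Fi Fj]]; apply: (tF i j) => //; by exists (X y).
Qed.

(** The right-hand side is a measure in [E]. On []a, b]] it is the integral of [xi] from [Y a] to
    [Y b], that is [b - a], and a measure with these values is the Lebesgue measure. *)
Lemma cov_measure E : measurable E -> mu E = \int[mu]_(y in X @^-1` E) (xi y)%:E.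
Proof.
pose m := isMeasure.Build _ _ _ nu nu0 nu_ge0 nu_additive.
pose M : {measure set (measurableTypeR R) -> \bar R} := HB.pack nu m.
move=> mE; rewrite -[RHS]/(M E); apply: lebesgue_measure_unique => //.
move=> _ [[a b] _ <-] /=; rewrite -[RHS]/(nu _) /nu.
have -> : X @^-1` `]a, b] = `]Y a, Y b]%classic.
  apply/seteqP; split=> y /=; rewrite !in_itv/=.
    by rewrite -{1}(YK a) -{1}(YK b) cov_ltE cov_le.
  by rewrite -{2}(YK a) -{2}(YK b) cov_ltE cov_le.
rewrite lebesgue_measure_itv/= lte_fin; case: ifPn => [ab|].
  have Yab : (Y a <= Y b)%R by rewrite -cov_le !YK ltW.
  rewrite integral_itv_obnd_cbnd//.
  have ixi : itg `[Y a, Y b] xi by exact: itg_continuous.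
  rewrite -[RHS]fineK; last by exact: integrable_fin_num ixi.
  rewrite -[fine _]/(Rintegral _ _ _) (FTC2 Yab (fun x _ => dX x)).
    by rewrite !YK EFinB.
  exact: continuous_within.
rewrite -leNgt => ba; rewrite set_itv_ge ?integral_set0// bnd_simp -leNgt.
by rewrite -cov_le !YK.
Qed.

Import HBNNSimple.

(** For an indicator function this is [cov_measure]; simple functions follow by linearity, and
    nonnegative functions by monotone convergence on both sides. *)
Lemma cov_ge0 h : measurable_fun setT h -> (forall x, 0 <= h x)%R ->
  \int[mu]_x (h x)%:E = \int[mu]_y (h (X y) * xi y)%:E.
Proof.
move=> mh h0; have mEh : measurable_fun (setT : set (measurableTypeR R)) (EFin \o h).
  exact/measurable_EFinP.
have mX : measurable_fun (setT : set (measurableTypeR R)) (X : _ -> measurableTypeR R) by exact: (continuous_measurable_fun cov_continuous).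
pose h_ := nnsfun_approx measurableT mEh.
have hcvg x : (EFin \o h_ ^~ x) @ \oo --> (h x)%:E.
  by apply: cvg_nnsfun_approx => // t _; rewrite lee_fin.
have -> : \int[mu]_x (h x)%:E = limn (fun n => \int[mu]_x (h_ n x)%:E).
  rewrite -monotone_convergence//=.
  - by apply: eq_integral => x _; apply/esym/cvg_lim => //; exact: hcvg.
  - move=> n; apply/measurable_EFinP; exact: measurable_funP.
  - by move=> n x _; rewrite lee_fin.
  - by move=> x _ m n mn; rewrite lee_fin; exact/lefP/nd_nnsfun_approx.
have -> : \int[mu]_y (h (X y) * xi y)%:E =
    limn (fun n => \int[mu]_y (h_ n (X y) * xi y)%:E).
  rewrite -monotone_convergence//=.
  - apply: eq_integral => y _; apply/esym/cvg_lim => //.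
    under eq_fun do rewrite EFinM; rewrite EFinM.
    by apply: cvgeZr => //; exact: hcvg.
  - move=> n; apply/measurable_EFinP/measurable_funM.
      exact: (measurableT_comp (measurable_funP (h_ n)) mX).
    exact: (continuous_measurable_fun cxi).
  - by move=> n y _; rewrite lee_fin mulr_ge0// ltW.
  - move=> y _ m n mn; rewrite lee_fin ler_wpM2r ?(ltW (xi0 _))//.
    by have /lefP := nd_nnsfun_approx measurableT mEh mn; apply.
congr (limn _); apply/funext => n.
under eq_integral do rewrite fimfunE -fsumEFin//.
rewrite ge0_integral_fsum//; last 2 first.
- by move=> r; apply/measurable_EFinP/measurable_funM.
- by move=> r x _; rewrite nnfun_muleindic_ge0.
under [RHS]eq_integral.
  move=> y _; rewrite fimfunE EFinM -fsumEFin// ge0_mule_fsuml; last first.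
    by move=> r; rewrite nnfun_muleindic_ge0.
  over.
rewrite ge0_integral_fsum//; last 2 first.
- move=> r; apply: emeasurable_funM; last exact: mxi.
  apply/measurable_EFinP/measurable_funM => //.
  by apply: (measurableT_comp (measurable_indic _)).
- by move=> r y _; rewrite mule_ge0 ?nnfun_muleindic_ge0// lee_fin ltW.
apply: eq_fsbigr => r rh.
rewrite integralZl_indic_nnsfun// integral_indic// setIT.
rewrite [X in _ * X = _](_ : _ =
  \int[mu]_(y in X @^-1` (h_ n @^-1` [set r])) (xi y)%:E); last first.
  by apply: cov_measure; exact: (measurable_funPTI (h_ n)).
under [RHS]eq_integral do rewrite EFinM -muleA.
have r0 : (0 <= r)%R by move: rh; rewrite inE => -[z _ <-].
rewrite ge0_integralZl//; last 2 first.
- apply: emeasurable_funM; last exact: mxi.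
  apply/measurable_EFinP; exact: (measurableT_comp (measurable_indic _)).
- by move=> y _; rewrite mule_ge0// lee_fin ?ltW// indicE.
congr (_ * _); rewrite [LHS]integral_mkcond; apply: eq_integral => y _.
rewrite patchE indicE; have [yE|yE] := boolP (y \in X @^-1` (h_ n @^-1` [set r])).
  by rewrite mem_set ?mul1e//; rewrite inE in yE.
rewrite memNset ?mul0e//; by move=> /mem_set yE'; move: yE; rewrite inE in yE'; rewrite mem_set.
Qed.

Local Close Scope ereal_scope.

Lemma cov_itv f a b : a <= b -> measurable_fun `[X a, X b] f -> (forall x, 0 <= f x) ->
  (\int[mu]_(x in `[X a, X b]) (f x)%:E = \int[mu]_(y in `[a, b]) (f (X y) * xi y)%:E)%E.
Proof.
move=> ab mf f0.
rewrite integral_mkcond.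
have -> : (fun x => (f x)%:E) \_ `[X a, X b] = EFin \o (f \_ `[X a, X b]).
  by rewrite -restrict_EFin.
rewrite (@cov_ge0 (f \_ `[X a, X b])).
- rewrite [RHS]integral_mkcond; apply: eq_integral => y _.
  rewrite !patchE; have [yab|yab] := boolP (y \in `[a, b]%classic).
    rewrite mem_set//=; move: yab; rewrite inE/= !in_itv/= => /andP[ay yb].
    by rewrite !cov_le ay yb.
  rewrite memNset ?mul0r//= in_itv/= !cov_le.
  by move=> yab'; move: yab; rewrite mem_set//= in_itv.
- exact/(measurable_restrictT _ _).1.
- by move=> x; rewrite patchE; case: ifP.
Qed.

Lemma cov_itg f a b : a <= b -> itg `[X a, X b] f ->
  itg `[a, b] (fun y => f (X y) * xi y).
Proof.
move=> ab /integrableP[/measurable_EFinP mf fi]; apply/integrableP; split.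
  apply/measurable_EFinP/measurable_funM; last first.
    exact: (measurable_funTS (continuous_measurable_fun cxi)).
  apply: measurable_comp mf _ => //.
    move=> _ [y /= yab <-] /=; move: yab; rewrite !in_itv/= => /andP[ay yb].
    by rewrite !cov_le ay yb.
  exact: (measurable_funTS (continuous_measurable_fun cov_continuous)).
apply: le_lt_trans fi; rewrite le_eqVlt; apply/orP; left; apply/eqP.
transitivity (\int[mu]_(x in `[X a, X b]) (`|f x|)%:E)%E => //.
rewrite (@cov_itv (fun x => `|f x|))//; last exact: measurableT_comp.
by apply: eq_integral => y _ /=; rewrite normrM (gtr0_norm (xi0 y)).
Qed.

Lemma cov_Rintegral_ge0 f a b : a <= b -> measurable_fun `[X a, X b] f ->
  (forall x, 0 <= f x) ->
  \int[mu]_(x in `[X a, X b]) f x = \int[mu]_(y in `[a, b]) (f (X y) * xi y).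
Proof. by move=> ab mf f0; congr (fine _); exact: cov_itv. Qed.

Lemma cov_Rintegral f a b : a <= b -> itg `[X a, X b] f ->
  \int[mu]_(x in `[X a, X b]) f x = \int[mu]_(y in `[a, b]) (f (X y) * xi y).
Proof.
move=> ab fi; have mf := itg_measurable fi.
have fE x : f x = f^\+ x - f^\- x by rewrite -[in LHS](funrposBneg f).
have ip : itg `[X a, X b] f^\+ by apply: (integrable_funrpos _ fi).
have im : itg `[X a, X b] f^\- by apply: (integrable_funrneg _ fi).
rewrite (@int_eq _ _ f (fun x => f^\+ x - f^\- x))//.
rewrite RintegralB//.
rewrite (cov_Rintegral_ge0 ab (itg_measurable ip) (funrpos_ge0 _)).
rewrite (cov_Rintegral_ge0 ab (itg_measurable im) (funrneg_ge0 _)).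
rewrite -RintegralB//; [|exact: cov_itg|exact: cov_itg].
by apply: int_eq => y _; rewrite -mulrBl -fE.
Qed.

End ChangeOfVariables.

(** * The Sobolev space H^1 *)

Section Density.
Context (R : realType).
Local Notation mu := (@lebesgue_measure R).
Implicit Types (u v w f g : R -> R) (a b x y : R).

Lemma measurable_continuous_comp D u v : continuous u -> measurable_fun D v ->
  measurable_fun D (fun x => u (v x)).
Proof. by move=> /continuous_measurable_fun mu_ mv; exact: (measurableT_comp mu_ mv). Qed.

Lemma clamp_sym_le (k : R) x : 0 <= k -> `|clamp (- k) k x| <= k.
Proof.
by move=> k0; rewrite ler_norml; apply: clamp_itv; rewrite (le_trans _ k0)// oppr_le0.
Qed.

(** Dominated convergence along the integer levels, with majorant [v^2]: at each point the
    truncation is inactive from some level on. *)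
Lemma truncation_sqi a b v e : sqi a b v -> 0 < e ->
  exists2 k, 0 < k & nsq a b (fun x => v x - clamp (- k) k (v x)) < e.
Proof.
move=> [mv iv] e0.
have mc k : measurable_fun `[a, b] (fun x => clamp (- k) k (v x)).
  by apply: measurable_continuous_comp mv; exact: clamp_continuous.
have vk k x : 0 <= k -> `|v x - clamp (- k) k (v x)| <= `|v x|.
  move=> k0; rewrite /clamp maxElt minElt.
  case: (ltP (v x) k) => h1; case: ltP => h2; case: (leP 0 (v x)) => h3;
    rewrite ?(ger0_norm h3) ?(ltr0_norm h3) ler_norml; lra.
have H : (\int[mu]_(x in `[a, b]) ((v x - clamp (- n.+1%:R) n.+1%:R (v x)) ^+ 2)%:E
    @[n --> \oo] --> \int[mu]_(x in `[a, b]) cst 0%E x)%E.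
  apply: (@dominated_cvg _ _ _ mu `[a, b]%classic _ _ _ (fun x => (v x ^+ 2)%:E)) => //.
  - by move=> n; apply/measurable_EFinP; exact: (measurable_funX 2 (measurable_funB mv (mc _))).
  - move=> x xab; apply: cvg_near_cst; exists (Num.truncn `|v x|).+1 => // n /= nv.
    rewrite clamp_id ?subrr ?expr0n// -ler_norml.
    by rewrite (le_trans (ltW (truncnS_gt _)))// ler_nat ltnW.
  - move=> n x xab /=; rewrite lee_fin normrX -(real_normK (num_real (v x))).
    by rewrite lerXn2r ?nnegrE// vk.
have {H} : (fun n => nsq a b (fun x => v x - clamp (- n.+1%:R) n.+1%:R (v x))) @ \oo --> 0.
  by move: H; rewrite integral0 => /fine_cvg.
move=> /cvgP_eps/(_ _ e0)[n _ /(_ n (leqnn n))/=]; rewrite subr0 => Hn.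
by exists n.+1%:R => //; apply: le_lt_trans Hn; rewrite ler_norm.
Qed.

(** Continuous functions are dense in L^1. Once [v] is truncated at level [k], the square of the
    error is at most [2 k] times its absolute value, so that an approximation in L^1 is one in L^2;
    clamping the approximant at the same level does not increase the error. *)
Lemma continuous_density a b v e : sqi a b v -> 0 < e ->
  exists2 g, continuous g & nsq a b (fun x => v x - g x) < e.
Proof.
move=> sv e0; have [ab|ba] := leP a b; last first.
  by exists (fun=> 0); [move=> x; exact: cvg_cst|rewrite /nsq int_empty].
have e4 : 0 < e / 4 by rewrite divr_gt0.
have [k k0 vk] := truncation_sqi sv e4; set vt := fun x => clamp (- k) k (v x).
have mvt : measurable_fun `[a, b] vt.
  by apply: measurable_continuous_comp sv.1; exact: clamp_continuous.
have ivt : itg `[a, b] vt.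
  by apply: (@itg_bounded _ _ _ k) => // x _; apply: clamp_sym_le; rewrite ltW.
have [g_ [cg_ ig_ /fine_cvgP[_]]] :=
  @approximation_continuous_integrable _ `[a, b]%classic _ ltac:(by []) (itv_lty a b) ivt.
(* An L^1 error of [e / (8 k)] gives a squared L^2 error of [e / 4]. With the truncation error below
   [e / 4], the factors 2 of [nsqD] lead to [e]. *)
have e8 : 0 < e / (8 * k) by rewrite divr_gt0// mulr_gt0.
move=> /cvgP_eps/(_ _ e8)[n _ /(_ n (leqnn n))/=]; rewrite subr0 => Hn.
pose g := clamp (- k) k \o g_ n.
have cg : continuous g.
  by move=> x; apply: continuous_comp; [exact: cg_|exact: clamp_continuous].
have svt : sqi a b vt by apply: sqi_bounded mvt _ => x _; apply: clamp_sym_le; rewrite ltW.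
have sg : sqi a b g by exact: sqi_continuous.
exists g => //.
rewrite (@eq_nsq _ _ _ _ (fun x => (v x - vt x) + (vt x - g x))); last by move=> x _; ring.
rewrite (le_lt_trans (nsqD (sqiB sv svt) (sqiB svt sg)))//.
suff gH : nsq a b (fun x => vt x - g x) <= 2 * k * (e / (8 * k)).
  have : 2 * k * (e / (8 * k)) = e / 4 by field; rewrite gt_eqF.
  by move=> ek; move: vk gH; rewrite ek; lra.
apply: (@le_trans _ _ (2 * k * \int[mu]_(x in `[a, b]) `|vt x - g_ n x|)); last first.
  rewrite ler_wpM2l ?mulr_ge0 ?(ltW k0)// ltW//.
  by apply: le_lt_trans Hn; rewrite ler_norm.
have id_ : itg `[a, b] (fun x => `|vt x - g_ n x|).
  by apply: itg_norm; apply: itgB => //; exact: ig_.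
rewrite -RintegralZl//; apply: int_le => //.
- by have [] := sqiB svt sg.
- exact: itgZ.
move=> x _; rewrite -(real_normK (num_real _)) expr2 ler_pM//.
- rewrite (le_trans (ler_normB _ _))// mulrDl mul1r lerD//; apply: clamp_sym_le; exact: ltW.
- have vtE : vt x = clamp (- k) k (vt x).
    by rewrite clamp_id// -ler_norml clamp_sym_le// ltW.
  by rewrite [X in `|X - _|]vtE; exact: clamp_lip.
Qed.

End Density.

(** * Weak derivatives on [0,1] and absolute continuity *)

Section SobolevH1.
Context (R : realType).
Local Notation mu := (@lebesgue_measure R).
Local Notation I01 := (@I01 R).
Implicit Types (u v w f g h : R -> R) (a b x y : R).

Lemma L2P u : L2 u <-> sqi 0 1 u.
Proof.
split=> [Lu|[mu_ iu]].
- have := Lu; rewrite /L2 inE => /andP[+ _]; rewrite inE /= => mu_; split.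
    exact/(measurable_restrictT _ _).2.
  have H : itg setT (fun x => (u \_ I01) x ^+ 2) by exact: Lfun2_integrable_sqr Lu.
  have := itgS (measurable_itv `[0%R, 1%R]) measurableT (@subsetT _ _) H.
  by apply: eq_itg => // x x01; rewrite patchE mem_set.
- have mu' : measurable_fun setT (u \_ I01).
    have [+ _] := @measurable_restrictT _ _ R R `[0, 1]%classic u (measurable_itv _).
    exact.
  rewrite /L2 inE; apply/andP; split; rewrite inE /=; first exact: mu'.
  rewrite /finite_norm unlock poweR_lty//.
  have /integrableP[_] := iu; apply: le_lt_trans.
  rewrite [leRHS]integral_mkcond le_eqVlt; apply/orP; left; apply/eqP.
  apply: eq_integral => x _ /=; rewrite !patchE; case: ifP => _ /=.
    by rewrite powR_mulrn// normrX.
  by rewrite normr0 powR0.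
Qed.

Lemma L2_normE u : sqi 0 1 u -> L2_norm u = Num.sqrt (nsq 0 1 u).
Proof.
move=> su; rewrite /L2_norm unlock.
have -> : (\int[mu]_x (`|(EFin \o u \_ I01) x| `^ 2%R) = (nsq 0 1 u)%:E)%E.
  rewrite /nsq /Rintegral fineK; last exact: integrable_fin_num su.2.
  rewrite [RHS]integral_mkcond; apply: eq_integral => x _ /=.
  rewrite !patchE; case: ifP => _ /=; last by rewrite normr0 powR0.
  by rewrite powR_mulrn// -normrX ger0_norm// sqr_ge0.
by rewrite /= powR12_sqrt// nsq_ge0.
Qed.

Lemma L2_norm_sqr u : sqi 0 1 u -> L2_norm u ^+ 2 = nsq 0 1 u.
Proof. by move=> su; rewrite L2_normE// sqr_sqrtr// nsq_ge0. Qed.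

Lemma test_function_bounds (phi : R -> R) : test_function phi ->
  [/\ phi 0 = 0, phi 1 = 0 & ac 0 1 phi (derive1 phi)].
Proof.
move=> [dphi cphi [a [b [a0 b1 sphi]]]]; split.
- by apply: sphi; rewrite in_itv/= leNgt a0.
- by apply: sphi; rewrite in_itv/= andbC leNgt b1.
- apply: derive_ac; last exact: continuous_within.
  by move=> x _; rewrite derive1E; exact: DeriveDef.
Qed.

(** The product rule [acM] integrated over [0,1]; the boundary terms vanish with the test
    function. *)
Lemma ac_weak_derivative u v : ac 0 1 u v -> weak_derivative u v.
Proof.
move=> A phi /test_function_bounds[phi0 phi1 aphi].
have [_ /(_ 0 1)] := acM A aphi; rewrite phi0 phi1 !mulr0 subrr => /(_ _ _ _)/esym.
move=> /(_ (lexx _) ler01 (lexx _)).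
have [kp _ pk] := ac_bounded aphi; have [ku _ uk] := ac_bounded A.
rewrite RintegralD//; last 2 first.
- apply: (@eq_itg _ _ _ (fun x => phi x * v x)) => //; first by move=> x _; rewrite mulrC.
  apply: (itgM_bounded _ (ac_measurable aphi) _ A.1) => //.
  by move=> x /=; rewrite in_itv/=; exact: pk.
- apply: (itgM_bounded _ (ac_measurable A) _ aphi.1) => //.
  by move=> x /=; rewrite in_itv/=; exact: uk.
by move=> /eqP; rewrite addrC addr_eq0 => /eqP.
Qed.

(** The primitive of a nonnegative function with zero integral is constant, and its derivative at an
    interior point is the value of the function there. *)
Lemma int_continuous_eq0 h a b x : continuous h -> (forall y, 0 <= h y) ->
  \int[mu]_(y in `[a, b]) h y = 0 -> a < x < b -> h x = 0.
Proof.
move=> ch h0 H /andP[ax xb].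
have ih c d : itg `[c, d] h by exact: itg_continuous.
have D := prim_derive ih (ch x).
have const y : a <= y <= b -> prim h y = prim h a.
  move=> /andP[ay yb]; apply/eqP; rewrite -subr_eq0 primB// eq_le.
  rewrite Rintegral_ge0// andbT; move: H; rewrite (int_cat ay yb)// => H.
  by rewrite -H lerDl Rintegral_ge0.
have D0 : is_derive x 1 (cst (prim h a)) (h x).
  apply: (is_derive_near (d := Num.min (x - a) (b - x))) D.
    by rewrite lt_min !subr_gt0 ax.
  move=> y; rewrite lt_min !ltr_norml => /andP[/andP[y1 y2] /andP[y3 y4]].
  by rewrite const//; apply/andP; split; lra.
by have [_] := D0; rewrite derive_cst.
Qed.

(* The bump function [tent d] weights [g - c], with [c] the weighted mean of [g]; the
   primitive of the resulting function is a test function. *)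
Lemma du_bois_reymond g : {within `[0, 1], continuous g} ->
  (forall phi, test_function phi -> \int[mu]_(x in `[0, 1]) (g x * derive1 phi x) = 0) ->
  forall x, 0 <= x <= 1 -> g x = g 2^-1.
Proof.
move=> cg Hg; pose G := g \o clamp 0 1.
have cG : continuous G by exact: continuous_clamp.
have gG x : 0 <= x <= 1 -> g x = G x by move=> x01; rewrite /G /= clamp_id.
(* Positive exactly on []d, 1 - d[]: each factor vanishes on one side of it. *)
pose tent d x : R := clamp 0 1 (x - d) * clamp 0 1 (1 - d - x).
have ctent d : continuous (tent d).
  have cc (h : R -> R) : continuous h -> continuous (fun x => clamp 0 1 (h x)).
    by move=> ch x; apply: continuous_comp; [exact: ch|exact: clamp_continuous].
  move=> x; apply: (@continuousM _ _ (fun x => clamp 0 1 (x - d))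
    (fun x => clamp 0 1 (1 - d - x))); apply: cc => y; apply: cvgB;
    by [exact: cvg_id|exact: cvg_cst].
have tent0 d x : 0 <= tent d x by rewrite mulr_ge0// le_max lexx.
have clampz x : x <= 0 -> clamp 0 1 x = 0 :> R.
  by move=> x0; rewrite /clamp min_l ?max_l// (le_trans x0).
have clampp x : 0 < x -> 0 < clamp 0 1 x :> R.
  by move=> x0; rewrite /clamp lt_max lt_min x0 ltr01 orbT.
have tentz d x : x <= d \/ 1 - d <= x -> tent d x = 0.
  by move=> [xd|xd]; rewrite /tent; [rewrite clampz ?mul0r//|rewrite [X in _ * X]clampz ?mulr0//]; lra.
have tentp d x : d < x < 1 - d -> 0 < tent d x.
  by move=> /andP[? ?]; rewrite mulr_gt0// clampp//; lra.
suff H d : 0 < d < 2^-1 -> exists c, forall x, d < x < 1 - d -> G x = c.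
  have inner x : 0 < x < 1 -> G x = G 2^-1.
    (* With this [d] both [x] and 1/2 belong to []d, 1 - d[], so that the constants for different
       [d] agree. The end points 0 and 1 follow by continuity. *)
    move=> /andP[x0 x1]; have [] := H (Num.min x (1 - x) / 2).
      apply/andP; split; first by rewrite divr_gt0// lt_min; lra.
      by rewrite minElt; case: (ltP x) => h; lra.
    by move=> c Gc; rewrite !Gc//; rewrite minElt; case: (ltP x) => h; apply/andP; split; lra.
  move=> x x01; rewrite !gG//; last by apply/andP; split; lra.
  have [->|x0] := eqVneq x 0.
    apply/eqP; rewrite -subr_eq0 -normr_le0; apply/ler_addgt0Pr => e e0; rewrite add0r.
    have /continuous_eps/(_ _ e0)[d d0 dP] := cG 0.
    pose y := Num.min (d / 2) 2^-1; have y0 : 0 < y by rewrite lt_min; lra.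
    have yd : y <= d / 2 by rewrite ge_min lexx.
    have y2 : y <= 2^-1 by rewrite ge_min lexx orbT.
    rewrite distrC -(inner y) ?ltW ?dP// ?subr0 ?gtr0_norm//; first by lra.
    by apply/andP; split; lra.
  have [->|x1] := eqVneq x 1.
    apply/eqP; rewrite -subr_eq0 -normr_le0; apply/ler_addgt0Pr => e e0; rewrite add0r.
    have /continuous_eps/(_ _ e0)[d d0 dP] := cG 1.
    pose z := Num.min (d / 2) 2^-1; have y0 : 0 < z by rewrite lt_min; lra.
    have yd : z <= d / 2 by rewrite ge_min lexx.
    have y2 : z <= 2^-1 by rewrite ge_min lexx orbT.
    rewrite distrC -(inner (1 - z)) ?ltW ?dP//.
      by rewrite addrAC subrr add0r normrN gtr0_norm//; lra.
    by apply/andP; split; lra.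
  by apply: inner; rewrite !lt_neqAle x1 eq_sym x0.
move=> /andP[d0 d2].
have itent a b : itg `[a, b] (tent d) by exact: itg_continuous.
have cGt : continuous (fun x => G x * tent d x).
  by move=> x; apply: continuousM; [exact: cG|exact: ctent].
pose A := \int[mu]_(x in `[0, 1]) tent d x.
have A0 : A != 0.
  apply/eqP => A0.
  have H : 0 < (2^-1 : R) < 1 by apply/andP; split; lra.
  have := int_continuous_eq0 (ctent d) (tent0 d) A0 H; apply/eqP; rewrite gt_eqF//.
  by apply: tentp; apply/andP; split; lra.
pose c := (\int[mu]_(x in `[0, 1]) (G x * tent d x)) / A.
pose psi x := (G x - c) * tent d x.
have cpsi : continuous psi.
  move=> x; apply: (@continuousM _ _ (fun x => G x - c) (tent d)); last exact: ctent.
  by apply: cvgB; [exact: cG|exact: cvg_cst].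
have ipsi a b : itg `[a, b] psi by exact: itg_continuous.
have psiz x : x <= d \/ 1 - d <= x -> psi x = 0 by move=> /tentz; rewrite /psi => ->; rewrite mulr0.
have int_psi0 a b : (forall x, a <= x <= b -> psi x = 0) -> \int[mu]_(x in `[a, b]) psi x = 0.
  move=> H; rewrite (@int_eq _ _ _ (fun=> 0)); last by move=> x /=; rewrite in_itv/=; exact: H.
  by have [ab|ba] := leP a b; [rewrite int_cst// mul0r|rewrite int_empty].
have psi01 : \int[mu]_(x in `[0, 1]) psi x = 0.
  rewrite (@int_eq _ _ psi (fun x => G x * tent d x - c * tent d x)); last first.
    by move=> x _; rewrite /psi mulrBl.
  rewrite RintegralB//; [|exact: itg_continuous|exact: itgZ].
  rewrite RintegralZl; [|by []|exact: itent]; apply/eqP; rewrite subr_eq0 -[X in _ == c * X]/A /c.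
  by rewrite -mulrA mulVf// mulr1.
have dphi x : is_derive x 1 (prim psi) (psi x) by apply: prim_derive => //; exact: cpsi.
have phiE : derive1 (prim psi) = psi.
  by apply/funext => x; rewrite derive1E; have [_ ->] := dphi x.
have tphi : test_function (prim psi).
  split; [by move=> x; have [] := dphi x|by rewrite phiE|exists d, (1 - d); split => //].
    by lra.
  move=> x; rewrite in_itv/= negb_and -!ltNge => xd.
  have pz y : y <= d -> prim psi y = 0.
    move=> yd; rewrite /prim !int_psi0 ?subrr// => z /andP[? ?]; apply: psiz; left; lra.
  case/orP: xd => [/ltW|] xd; first exact: pz.
  have x0 : 0 <= x by lra.
  have p1 : prim psi 1 = 0 by rewrite prim_pos.
  apply/eqP; rewrite -p1 -subr_eq0; have [x1|/ltW x1] := leP x 1.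
    by rewrite -opprB oppr_eq0 primB// int_psi0// => z /andP[? ?]; apply: psiz; right; lra.
  by rewrite primB// int_psi0// => z /andP[? ?]; apply: psiz; right; lra.
exists c => x xd.
(* The function [psi] has mean zero, hence its primitive is an admissible test function, and testing
   [G] against [psi] is the same as testing [G - c]. This yields the integral of a weighted
   square. *)
have /int_continuous_eq0 : \int[mu]_(x in `[0, 1]) ((G x - c) ^+ 2 * tent d x) = 0.
  rewrite (@int_eq _ _ _ (fun x => G x * psi x - c * psi x)); last first.
    by move=> y _; rewrite /psi; ring.
  rewrite RintegralB//; last 2 first.
  - by apply: itg_continuous => y; apply: continuousM; [exact: cG|exact: cpsi].
  - exact: itgZ.
  rewrite RintegralZl; [|by []|exact: ipsi]; rewrite psi01 mulr0 subr0 -[RHS](Hg _ tphi) phiE.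
  by apply: int_eq => y /=; rewrite in_itv/= => /gG ->.
move=> /(_ x) => H; have /eqP : (G x - c) ^+ 2 * tent d x = 0.
  apply: H.
  - move=> y; apply: (@continuousM _ _ (fun y => (G y - c) ^+ 2) (tent d));
      last exact: ctent.
    by apply: (@continuous_comp _ _ _ (fun y => G y - c) (fun z : R => z ^+ 2));
      [apply: cvgB; [exact: cG|exact: cvg_cst]|exact: exprn_continuous].
  - by move=> y; rewrite mulr_ge0// sqr_ge0.
  - by move: xd => /andP[? ?]; apply/andP; split; lra.
rewrite mulf_eq0 (gt_eqF (tentp _ _ xd)) orbF sqrf_eq0 subr_eq0 => /eqP; exact.
Qed.

(** The passage from the distributional definition to absolutely continuous functions: [u] minus the
    primitive [U] of its weak derivative has weak derivative zero, and [du_bois_reymond] makes it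
    constant at every point because [u] is continuous. *)
Lemma H1P u v : H1 u v <-> ac 0 1 u v /\ sqi 0 1 v.
Proof.
split=> [[cu /L2P su /L2P sv wuv]|[A sv]]; last first.
  split; [exact: ac_continuous A| |exact/L2P|exact: ac_weak_derivative].
  exact/L2P/sqi_within/(ac_continuous A).
split=> //; have iv := sqi_itg sv.
pose U x := \int[mu]_(s in `[0, x]) v s.
have AU : ac 0 1 U v by apply: ac_primitive => // x _; rewrite /U int_point add0r.
have cU := ac_continuous AU.
apply: ac_primitive => // x x01; apply/eqP; rewrite addrC -subr_eq0.
have cg : {within `[0, 1], continuous (fun x => u x - U x)}.
  by move=> y; apply: continuousB; [exact: cu|exact: cU].
have H : forall x, 0 <= x <= 1 -> u x - U x = u 2^-1 - U 2^-1.
  apply: (du_bois_reymond cg) => phi tphi.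
  have [_ _ aphi] := test_function_bounds tphi.
  have sphi : sqi 0 1 (derive1 phi) by apply: sqi_continuous; have [] := tphi.
  under eq_Rintegral do rewrite mulrBl.
  rewrite RintegralB//; [|exact: sqi_mul|exact/sqi_mul/sphi/sqi_within].
  by rewrite wuv// (ac_weak_derivative AU tphi) subrr.
by have := H 0; rewrite -(H x)// lexx ler01 /U int_point subr0 => -> //; apply/eqP; ring.
Qed.

End SobolevH1.

(** * The essential supremum norm *)

Section EssentialSup.
Context (R : realType).
Local Notation mu := (@lebesgue_measure R).
Local Notation I01 := (@I01 R).
Implicit Types (u : R -> R) (k x y : R).

Lemma eLinf_normE u : eLinf_norm u = ess_sup mu (abse \o (EFin \o (u \_ I01))).
Proof.
rewrite /eLinf_norm unlock ifT//.
by apply: (@lt_le_trans _ _ (mu `[0, 1]%classic));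
  [rewrite lebesgue_measure_itv/= lte_fin ltr01 sube0 lte_fin
  |apply: le_measure => //; rewrite inE].
Qed.

Lemma eLinf_norm_ge0 u : (0 <= eLinf_norm u)%E.
Proof. exact: Lnorm_ge0. Qed.

Lemma eLinf_norm_le u k : 0 <= k -> (forall x, 0 <= x <= 1 -> `|u x| <= k) ->
  (eLinf_norm u <= k%:E)%E.
Proof.
move=> k0 uk; rewrite eLinf_normE; apply/ess_supP; apply: nearW => x /=.
rewrite lee_fin patchE; case: ifPn => [|_]; last by rewrite normr0.
by rewrite inE /I01 /= in_itv/=; exact: uk.
Qed.

Lemma Linf_bounded u k : 0 <= k -> measurable_fun (`[0, 1] : set R) u ->
  (forall x, 0 <= x <= 1 -> `|u x| <= k) -> Linf u /\ 0 <= Linf_norm u <= k.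
Proof.
move=> k0 mf uk; have n0 := eLinf_norm_ge0 u; have nk := eLinf_norm_le k0 uk.
have nf : eLinf_norm u \is a fin_num by rewrite ge0_fin_numE// (le_lt_trans nk)// ltry.
split; last by rewrite fine_ge0//= -lee_fin fineK.
have mu' : measurable_fun setT (u \_ I01).
  have [+ _] := @measurable_restrictT _ _ R R `[0, 1]%classic u (measurable_itv _).
  exact.
rewrite /Linf inE; apply/andP; split; rewrite inE /=; first exact: mu'.
by apply: (le_lt_trans nk); rewrite ltry.
Qed.

(** If [|u x|] exceeded the essential supremum, so would [|u|] on a whole segment near [x], cut at
    the ends of [0,1], and this segment has positive measure. *)
Lemma eLinf_norm_ge u x : {within `[0, 1], continuous u} -> 0 <= x <= 1 ->
  (`|u x|%:E <= eLinf_norm u)%E.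
Proof.
move=> /within_continuousP cu x01; rewrite leNgt; apply/negP => ux.
have n0 := eLinf_norm_ge0 u.
have nf : eLinf_norm u \is a fin_num by rewrite ge0_fin_numE// (lt_trans ux)// ltry.
move: ux; rewrite -(fineK nf) lte_fin; set r := fine _ => ux.
have [d d0 dE] := cu x ltac:(by rewrite /= in_itv) (`|u x| - r) ltac:(by rewrite subr_gt0).
have : (eLinf_norm u <= r%:E)%E by rewrite /r fineK.
rewrite eLinf_normE => /ess_supP[N [mN N0 sN]].
pose p := Num.max 0 (x - d / 2); pose q := Num.min 1 (x + d / 2).
case/andP: x01 => x0 x1.
have pq : p < q.
  by rewrite /p /q gt_max !lt_min; apply/andP; split; apply/andP; split; lra.
have sub : `[p, q]%classic `<=` N.
  move=> y; rewrite /= in_itv/= /p /q ge_max le_min => /andP[/andP[y0 yx] /andP[y1 xy]].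
  apply: sN => /=; rewrite lee_fin patchE mem_set; last by rewrite /I01/= in_itv/= y0.
  apply/negP; rewrite -ltNge.
  have yd : `|y - x| < d by rewrite ltr_norml; apply/andP; split; lra.
  have := dE y ltac:(by rewrite /= in_itv/= y0) yd.
  by have := ler_dist_dist (u x) (u y); rewrite distrC ler_norml => /andP[h1 h2] h3; lra.
have : (mu `[p, q]%classic <= mu N)%E by apply: le_measure => //; rewrite inE.
rewrite [leRHS](N0 : _ = 0%E) lebesgue_measure_itv/= lte_fin pq -EFinB lee_fin.
by rewrite subr_le0 leNgt pq.
Qed.

End EssentialSup.

(** * Ordinary differential equations *)

Section Picard.
Context (R : realType).
Local Notation mu := (@lebesgue_measure R).
Implicit Types (t s : R).

(** Completeness by nested intervals: subtracting and adding the tail [2 K / 2 ^+ n] of the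
    geometric series gives a nondecreasing and a nonincreasing sequence. *)
Lemma geometric_limit (x : nat -> R) (K : R) :
  (forall n, `|x n.+1 - x n| <= K / 2 ^+ n) ->
  exists l, forall n, `|x n - l| <= 2 * K / 2 ^+ n.
Proof.
move=> H; pose a n := x n - 2 * K / 2 ^+ n; pose b n := x n + 2 * K / 2 ^+ n.
have K0 : 0 <= K by have := H 0; rewrite expr0 divr1; apply: le_trans.
have half n : K / 2 ^+ n = 2 * K / 2 ^+ n - 2 * K / 2 ^+ n.+1.
  by rewrite exprS; field; rewrite ?expf_neq0.
have aS n m : a n <= a (n + m)%N.
  elim: m => [|m IH]; first by rewrite addn0.
  rewrite (le_trans IH)// addnS /a; have := H (n + m)%N; rewrite half ler_norml.
  by move=> /andP[+ _]; lra.
have bS n m : b (n + m)%N <= b n.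
  elim: m => [|m IH]; first by rewrite addn0.
  rewrite (le_trans _ IH)// addnS /b; have := H (n + m)%N; rewrite half ler_norml.
  by move=> /andP[_ +]; lra.
have ab n m : a n <= b m.
  rewrite (le_trans (aS n m))// (le_trans _ (bS m n))// addnC /a /b lerD2l.
  have : 0 <= 2 * K / 2 ^+ (m + n) by rewrite divr_ge0// ?mulr_ge0// exprn_ge0.
  by move=> ?; rewrite (@le_trans _ _ 0)// oppr_le0.
have an n : range a (a n) by exists n.
have sa : has_sup (range a).
  by split; [exists (a 0%N)|exists (b 0%N) => _ [n _ <-]].
exists (sup (range a)) => n; rewrite ler_norml; apply/andP; split.
  have : sup (range a) <= b n by apply: ge_sup => [|_ [m _ <-]//]; exists (a 0%N).
  by rewrite /b; lra.
have : a n <= sup (range a) by apply: ub_le_sup => //; case: sa.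
by rewrite /a; lra.
Qed.

Lemma le_geometric0 (x K : R) : (forall n, x <= K / 2 ^+ n) -> x <= 0.
Proof.
move=> H; rewrite leNgt; apply/negP => x0.
have K0 : 0 < K by have := H 0; rewrite expr0 divr1; exact: lt_le_trans.
have := H (Num.truncn (K / x)).+1; rewrite leNgt => /negP; apply.
rewrite ltr_pdivrMr ?exprn_gt0// mulrC -ltr_pdivrMr//.
rewrite (lt_le_trans (truncnS_gt _))// -natrX ler_nat ltnW//; exact: ltn_expl.
Qed.

(** Negative times are allowed: the domain of integration is then empty and the integral zero. The
    Picard iterates are therefore Lipschitz on the whole line. *)
Lemma int0_lipschitz (g : R -> R) B s t : continuous g -> (forall x, `|g x| <= B) ->
  `|\int[mu]_(x in `[0, t]) g x - \int[mu]_(x in `[0, s]) g x| <= B * `|t - s|.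
Proof.
move=> cg gB; have B0 : 0 <= B by apply: le_trans (gB 0).
wlog st : s t / s <= t => [H|].
  by have [/H//|/ltW/H] := leP s t; rewrite distrC [X in _ * X]distrC.
rewrite [X in _ * X]ger0_norm ?subr_ge0//.
have ig a b : itg `[a, b] g by exact: itg_continuous.
have bnd a b : a <= b -> `|\int[mu]_(x in `[a, b]) g x| <= B * (b - a).
  by move=> ab; apply: int_bounded => //; exact: itg_measurable.
have [s0|s0] := leP 0 s.
  by rewrite (int_cat s0 st)// addrAC subrr add0r bnd.
rewrite (int_empty _ s0) subr0; have [t0|t0] := leP 0 t.
  by rewrite (le_trans (bnd _ _ t0))// ler_wpM2l// lerD2l lerN2 ltW.
by rewrite int_empty// normr0 mulr_ge0// subr_ge0.
Qed.

Lemma is_derive_expRM (c x : R) :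
  is_derive x 1 (fun s : R => expR (c * s)) (c * expR (c * x)).
Proof.
have d1 : is_derive x 1 (fun s : R => c * s) c.
  apply/is_derive_eps => e e0; exists 1 => // h _.
  have -> : c * (x + h) - c * x - h * c = 0 by ring.
  by rewrite normr0 mulr_ge0// ltW.
have d2 : is_derive x 1 (expR \o (fun s : R => c * s)) (expR (c * x) * c).
  exact: is_derive1_comp.
by apply: is_derive_eq d2 _; rewrite mulrC.
Qed.

Lemma int_expRM (c t : R) : c != 0 -> 0 <= t ->
  \int[mu]_(s in `[0, t]) expR (c * s) = (expR (c * t) - 1) / c.
Proof.
move=> c0 t0.
have de (x : R) : is_derive x 1 (fun s : R => c^-1 * expR (c * s)) (expR (c * x)).
  have d3 := is_deriveZ c^-1 (is_derive_expRM c x).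
  by apply: is_derive_eq d3 _; rewrite /GRing.scale/= mulKf.
have ce : continuous (fun s : R => expR (c * s)).
  by move=> x; apply: is_derive_continuous (is_derive_expRM c x).
rewrite (FTC2 t0 (fun x _ => de x)) ?mulr0 ?expR0; last exact: continuous_within.
by rewrite -mulrBr mulrC.
Qed.

(** A bounded, globally Lipschitz field has global solutions. The index set [J] carries no
    structure: the distance of two states is measured by a common bound [d] for all coordinates. The
    iterates are constant at negative times, which is why the derivative is asserted for [t > 0]. *)
Lemma picard (J : Type) (G : (J -> R) -> J -> R) (L B : R) (y0 : J -> R) : 0 < L ->
  (forall u v d k, (forall j, `|u j - v j| <= d) -> `|G u k - G v k| <= L * d) ->
  (forall u k, `|G u k| <= B) ->
  exists y : R -> J -> R, [/\ forall k, y 0 k = y0 k,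
    forall s t k, `|y t k - y s k| <= B * `|t - s| &
    forall t k, 0 < t -> is_derive t 1 (fun s => y s k) (G (y t) k)].
Proof.
move=> L0 GL GB.
pose Y n := iter n (fun (z : R -> J -> R) t k =>
  y0 k + \int[mu]_(s in `[0, t]) G (z s) k) (fun _ => y0).
have YS n t k : Y n.+1 t k = y0 k + \int[mu]_(s in `[0, t]) G (Y n s) k by [].
have cont_of (z : R -> J -> R) : (forall s t k, `|z t k - z s k| <= B * `|t - s|) ->
    forall k, continuous (fun s => G (z s) k).
  move=> zB k; apply: (@lipschitz_continuous _ (L * B)) => s t.
  by rewrite -mulrA; apply: GL => j; exact: zB.
have YL n s t k : `|Y n t k - Y n s k| <= B * `|t - s|.
  elim: n s t k => [|n IH] s t k.
    by rewrite subrr normr0 mulr_ge0// (le_trans _ (GB y0 k)).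
  rewrite !YS opprD addrACA subrr add0r; apply: int0_lipschitz => //.
  exact: cont_of.
have cGY n k : continuous (fun s => G (Y n s) k) by exact/cont_of/YL.
(* With the weight [expR (2 * L * t)] each iteration halves the distance of successive iterates, on
   the whole half-line at once. The constant [C] is such that [B * t <= C * e2 t], which bounds the
   first step. *)
pose C := B / (2 * L); pose e2 t := expR (2 * L * t).
(* The inequality [0 <= B] comes from the bound on [G] at some coordinate; if there is none, the
   assertions are empty. *)
have [J0|k0] : (J -> False) \/ exists k : J, True.
  by case: (pselect (exists k : J, True)) => [|H]; [right|left => k; apply: H; exists k].
  by exists (fun _ => y0); split=> // s t k; have := J0 k.
have B0 : 0 <= B by case: k0 => k _; apply: le_trans (GB y0 k).
have C0 : 0 <= C by rewrite divr_ge0// mulr_ge0// ltW.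
have ce2 : continuous e2.
  by move=> x; apply: is_derive_continuous (is_derive_expRM _ x).
have L20 : 2 * L != 0 by rewrite gt_eqF// mulr_gt0.
have Yneg n t k : t < 0 -> Y n t k = y0 k.
  by case: n => [//|n] t0; rewrite YS int_empty// addr0.
have YD n t k : `|Y n.+1 t k - Y n t k| <= C * e2 t / 2 ^+ n.
  have [t0|t0] := leP 0 t; last first.
    by rewrite !Yneg// subrr normr0 divr_ge0 ?exprn_ge0// mulr_ge0// expR_ge0.
  elim: n t t0 k => [|n IH] t t0 k.
    rewrite (YS 0%N) /= addrAC subrr add0r expr0 divr1.
    have := @int0_lipschitz _ B 0 t (cGY 0%N k) (fun s => GB _ _).
    rewrite int_point !subr0 => /le_trans; apply.
    rewrite ger0_norm// /C mulrAC ler_pdivlMr ?mulr_gt0// -mulrA ler_wpM2l//.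
    by rewrite mulrC (le_trans _ (expR_ge1Dx _))// lerDr.
  rewrite !YS opprD addrACA subrr add0r.
  have iG m a b : itg `[a, b] (fun s => G (Y m s) k) by exact: itg_continuous.
  rewrite -RintegralB; [|by []|exact: iG|exact: iG].
  rewrite (le_trans (int_norm _ (itgB _ (iG _ _ _) (iG _ _ _))))//.
  apply: (@le_trans _ _ (\int[mu]_(s in `[0, t]) (L * C / 2 ^+ n * e2 s))).
    apply: int_le => //; first exact/itg_norm/itgB.
      by apply: itgZ => //; exact: itg_continuous.
    move=> s /=; rewrite in_itv/= => /andP[s0 st].
    rewrite (le_trans (GL _ _ (C * e2 s / 2 ^+ n) _ _))//.
      by move=> j; exact: IH.
    by rewrite le_eqVlt; apply/orP; left; apply/eqP; ring.
  rewrite RintegralZl//; last exact: itg_continuous.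
  rewrite int_expRM//.
  have -> : L * C / 2 ^+ n * ((expR (2 * L * t) - 1) / (2 * L)) =
      (C * (expR (2 * L * t) - 1)) / 2 ^+ n.+1.
    by rewrite exprS; field; rewrite expf_neq0// gt_eqF.
  by rewrite ler_wpM2r ?invr_ge0 ?exprn_ge0// ler_wpM2l// gerBl.
have ylim t k : {l | forall n, `|Y n t k - l| <= 2 * (C * e2 t) / 2 ^+ n}.
  by apply/cid/geometric_limit => n; exact: YD.
pose y t k := sval (ylim t k).
have yY t k n : `|Y n t k - y t k| <= 2 * (C * e2 t) / 2 ^+ n by exact: svalP (ylim t k) n.
have eqlim (a b K : R) : (forall n, `|a - b| <= K / 2 ^+ n) -> a = b.
  by move=> /le_geometric0; rewrite normr_le0 subr_eq0 => /eqP.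
have yB s t k : `|y t k - y s k| <= B * `|t - s|.
  rewrite -subr_le0.
  apply: (@le_geometric0 _ (2 * (C * e2 t) + 2 * (C * e2 s))) => n.
  have := yY t k n; have := yY s k n; have := YL n s t k.
  set a := Y n t k; set b := Y n s k => H1 H2 H3.
  move: H1 H2 H3; rewrite lerBlDr mulrDl !ler_norml.
  by move=> /andP[? ?] /andP[? ?] /andP[? ?]; apply/andP; split; lra.
have cGy k : continuous (fun s => G (y s) k) by exact: cont_of.
have yE t k : 0 <= t -> y t k = y0 k + \int[mu]_(s in `[0, t]) G (y s) k.
  move=> t0; apply: (eqlim _ _ (2 * (C * e2 t) + t * (L * (2 * (C * e2 t))))) => n.
  have iG m a b : itg `[a, b] (fun s => G (Y m s) k) by exact: itg_continuous.
  have iy a b : itg `[a, b] (fun s => G (y s) k) by exact: itg_continuous.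
  have e0 : 0 <= C * e2 t by rewrite mulr_ge0// expR_ge0.
  have H1 : `|Y n.+1 t k - y t k| <= 2 * (C * e2 t) / 2 ^+ n.
    rewrite (le_trans (yY _ _ _))// exprS invfM mulrCA ler_piMl//.
      by rewrite divr_ge0 ?exprn_ge0// mulr_ge0.
    by rewrite invf_le1// ler1n.
  have H2 : `|\int[mu]_(s in `[0, t]) G (Y n s) k - \int[mu]_(s in `[0, t]) G (y s) k| <=
      L * (2 * (C * e2 t) / 2 ^+ n) * (t - 0).
    rewrite -RintegralB; [|by []|exact: iG|exact: iy]; apply: int_bounded => //.
      by apply: itg_measurable; apply: itgB.
    move=> s; rewrite in_itv/= => /andP[s0 st]; apply: GL => j.
    rewrite (le_trans (yY _ _ _))// ler_wpM2r ?invr_ge0 ?exprn_ge0//.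
    by rewrite !ler_wpM2l// ler_expR ler_wpM2l// mulr_ge0// ltW.
  move: H1; rewrite YS => H1.
  set I1 := \int[mu]_(s in _) _ in H1 H2; set I2 := \int[mu]_(s in _) _ in H2 *.
  have -> : y t k - (y0 k + I2) = - (y0 k + I1 - y t k) + (I1 - I2) by ring.
  rewrite (le_trans (ler_normD _ _))// normrN mulrDl lerD//.
  by rewrite (le_trans H2)// le_eqVlt; apply/orP; left; apply/eqP; ring.
exists y; split=> // [k|t k t0]; first by rewrite yE// int_point addr0.
have d1 : is_derive t 1 (fun s => \int[mu]_(r in `[0, s]) G (y r) k) (G (y t) k).
  by apply: (@int_derive _ _ _ _) => // [b|]; [exact: itg_continuous|exact: cGy].
have d2 : is_derive t 1 (cst (y0 k) \+
    (fun s => \int[mu]_(r in `[0, s]) G (y r) k)) (G (y t) k).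
  by apply: is_derive_eq; rewrite add0r.
apply: is_derive_near t0 _ d2 => s /=; rewrite ltr_norml => /andP[st _].
by rewrite yE//; lra.
Qed.

Lemma gronwall (E E' : R -> R) (C T : R) : {within `[0, T], continuous E} ->
  (forall t, 0 < t < T -> is_derive t 1 E (E' t)) ->
  (forall t, 0 < t < T -> E' t <= C * E t) ->
  forall t, 0 <= t <= T -> E t <= E 0 * expR (C * t).
Proof.
move=> cE dE EC t /andP[t0 tT].
pose h s := E s * expR (- C * s).
have dh s : 0 < s < T -> is_derive s 1 h (expR (- C * s) * (E' s - C * E s)).
  move=> sT; have d1 := dE s sT; have d2 := is_derive_expRM (- C) s.
  by apply: is_derive_eq (is_deriveM d1 d2) _; rewrite /GRing.scale/=; ring.
have ch : {within `[0, T], continuous h}.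
  have cexp : {within `[0, T], continuous (fun s : R => expR (- C * s))}.
    apply: continuous_within => s; exact: is_derive_continuous (is_derive_expRM (- C) s).
  by move=> x; have := continuousM (cE x) (cexp x); apply.
have : h t <= h 0.
  apply: (@ler0_derive1_nincr _ h 0 T) => // s; rewrite in_itv/=.
    by move=> /dh[].
  move=> sT; rewrite derive1E; have [_ ->] := dh s sT.
  by rewrite mulr_ge0_le0 ?expR_ge0// subr_le0 EC.
rewrite /h mulr0 expR0 mulr1 mulNr expRN ler_pdivrMr ?expR_gt0//.
Qed.

End Picard.

(** * Differentiation along the flow *)

Section SmallFamilies.
Context (R : realType) (F : set_system R) {FF : Filter F}.
Local Notation mu := (@lebesgue_measure R).
Implicit Types (r b : R -> R -> R) (u v w : R -> R) (k e : R).

(** Smallness is taken along an arbitrary filter so that one calculus serves both the continuity in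
    time, along the filter of times in [[0, T]], and the difference quotients, along [0^']. *)
Definition sup_small r := forall e, 0 < e ->
  \forall s \near F, forall x, 0 <= x <= 1 -> `|r s x| <= e.

Definition l2_small r := forall e, 0 < e ->
  \forall s \near F, sqi 0 1 (r s) /\ nsq 0 1 (r s) <= e.

Definition near_bounded k b := \forall s \near F,
  measurable_fun (`[0, 1] : set R) (b s) /\ forall x, 0 <= x <= 1 -> `|b s x| <= k.

Lemma sup_smallD r1 r2 : sup_small r1 -> sup_small r2 ->
  sup_small (fun s x => r1 s x + r2 s x).
Proof.
move=> H1 H2 e e0; have e2 : 0 < e / 2 by rewrite divr_gt0.
near=> s => x x01; rewrite (le_trans (ler_normD _ _))// [leRHS]splitr.
by rewrite lerD//; move: x x01; near: s; [exact: H1|exact: H2].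
Unshelve. all: by end_near. Qed.

Lemma sup_smallM k r b : near_bounded k b -> sup_small r ->
  sup_small (fun s x => b s x * r s x).
Proof.
move=> Hb Hr e e0.
have k0 : 0 < `|k| + 1 by rewrite ltr_wpDl.
have ek : 0 < e / (`|k| + 1) by rewrite divr_gt0.
near=> s.
have bk : forall x, 0 <= x <= 1 -> `|b s x| <= k by near: s; apply: filterS Hb => s [].
have re : forall x, 0 <= x <= 1 -> `|r s x| <= e / (`|k| + 1) by near: s; exact: Hr.
move=> x x01; rewrite normrM.
rewrite (le_trans (ler_pM _ _ (le_trans (bk _ x01) (ler_norm _)) (re _ x01)))//.
by rewrite mulrA ler_pdivrMr// mulrC ler_pM2l// lerDl.
Unshelve. all: by end_near. Qed.

Lemma l2_smallD r1 r2 : l2_small r1 -> l2_small r2 ->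
  l2_small (fun s x => r1 s x + r2 s x).
Proof.
move=> H1 H2 e e0; have e4 : 0 < e / 4 by rewrite divr_gt0.
near=> s.
have [s1 n1] : sqi 0 1 (r1 s) /\ nsq 0 1 (r1 s) <= e / 4 by near: s; exact: H1.
have [s2 n2] : sqi 0 1 (r2 s) /\ nsq 0 1 (r2 s) <= e / 4 by near: s; exact: H2.
split; first exact: sqiD.
by rewrite (le_trans (nsqD s1 s2))//; lra.
Unshelve. all: by end_near. Qed.

Lemma eq_near_l2_small r1 r2 :
  (\forall s \near F, forall x, 0 <= x <= 1 -> r1 s x = r2 s x) ->
  l2_small r1 -> l2_small r2.
Proof.
move=> H Hr e e0; near=> s.
have [s1 n1] : sqi 0 1 (r1 s) /\ nsq 0 1 (r1 s) <= e by near: s; exact: Hr.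
have Es x : 0 <= x <= 1 -> r1 s x = r2 s x by move: x; near: s; exact: H.
by rewrite -(eq_nsq Es); split => //; apply: eq_sqi s1.
Unshelve. all: by end_near. Qed.

Lemma eq_near_sup_small r1 r2 :
  (\forall s \near F, forall x, 0 <= x <= 1 -> r1 s x = r2 s x) ->
  sup_small r1 -> sup_small r2.
Proof.
move=> H Hr e e0; near=> s.
have r1e : forall x, 0 <= x <= 1 -> `|r1 s x| <= e by near: s; exact: Hr.
have Es : forall x, 0 <= x <= 1 -> r1 s x = r2 s x by near: s.
by move=> x x01; rewrite -Es// r1e.
Unshelve. all: by end_near. Qed.

Lemma l2_smallM k r b : near_bounded k b -> l2_small r ->
  l2_small (fun s x => b s x * r s x).
Proof.
move=> Hb Hr e e0.
have k0 : 0 < k ^+ 2 + 1 by rewrite ltr_wpDl// sqr_ge0.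
have ek : 0 < e / (k ^+ 2 + 1) by rewrite divr_gt0.
near=> s.
have [mb bk] : measurable_fun (`[0, 1] : set R) (b s) /\ forall x, 0 <= x <= 1 -> `|b s x| <= k.
  by near: s.
have [sr nr] : sqi 0 1 (r s) /\ nsq 0 1 (r s) <= e / (k ^+ 2 + 1) by near: s; exact: Hr.
split; first exact: sqiM_bounded bk sr.
rewrite (le_trans (nsqM_bounded mb bk sr))//.
move: nr; rewrite ler_pdivlMr// => nr; apply: le_trans nr.
by rewrite mulrC ler_wpM2l ?nsq_ge0// lerDl.
Unshelve. all: by end_near. Qed.

Lemma l2_smallN r : l2_small r -> l2_small (fun s x => - r s x).
Proof.
move=> H e e0; near=> s.
have [s1 n1] : sqi 0 1 (r s) /\ nsq 0 1 (r s) <= e by near: s; exact: H.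
by rewrite nsqN; split => //; exact: sqiN.
Unshelve. all: by end_near. Qed.

Lemma sup_l2_smallM r v : (\forall s \near F, measurable_fun (`[0, 1] : set R) (r s)) ->
  sup_small r -> sqi 0 1 v -> l2_small (fun s x => r s x * v x).
Proof.
move=> Hm Hr sv e e0.
have n0 : 0 < nsq 0 1 v + 1 by rewrite ltr_wpDl// nsq_ge0.
have e0' : 0 < Num.sqrt (e / (nsq 0 1 v + 1)) by rewrite sqrtr_gt0 divr_gt0.
near=> s.
have ms : measurable_fun (`[0, 1] : set R) (r s) by near: s.
have rs : forall x, 0 <= x <= 1 -> `|r s x| <= Num.sqrt (e / (nsq 0 1 v + 1)).
  by near: s; exact: Hr.
split; first exact: sqiM_bounded rs sv.
rewrite (le_trans (nsqM_bounded ms rs sv))// sqr_sqrtr ?divr_ge0 ?(ltW e0) ?(ltW n0)//.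
by rewrite mulrAC ler_pdivrMr// ler_wpM2l ?(ltW e0)// lerDl.
Unshelve. all: by end_near. Qed.

Lemma sup_l2_small r : (\forall s \near F, measurable_fun (`[0, 1] : set R) (r s)) ->
  sup_small r -> l2_small r.
Proof.
move=> Hm Hr; have := sup_l2_smallM Hm Hr (sqi_cst 0 1 1).
by apply: eq_near_l2_small; near=> s => x _; rewrite mulr1.
Unshelve. all: by end_near. Qed.

(** The form taken by the density arguments: a part [q1] that tends to zero since the approximant is
    regular, and a part [q2] that is merely small, by the choice of the approximant. *)
Lemma l2_small_approx r : (forall e, 0 < e -> exists q1 q2, [/\ l2_small q1,
    \forall s \near F, sqi 0 1 (q2 s) /\ nsq 0 1 (q2 s) <= e &
    \forall s \near F, forall x, 0 <= x <= 1 -> r s x = q1 s x + q2 s x]) ->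
  l2_small r.
Proof.
move=> H e e0; have e4 : 0 < e / 4 by rewrite divr_gt0.
have [q1 [q2 [H1 H2 H3]]] := H _ e4.
near=> s.
have [s1 n1] : sqi 0 1 (q1 s) /\ nsq 0 1 (q1 s) <= e / 4 by near: s; exact: H1.
have [s2 n2] : sqi 0 1 (q2 s) /\ nsq 0 1 (q2 s) <= e / 4 by near: s; exact: H2.
have Es x : 0 <= x <= 1 -> q1 s x + q2 s x = r s x.
  by move=> x01; apply/esym; move: x x01; near: s; exact: H3.
rewrite -(eq_nsq Es); split; first exact: eq_sqi Es (sqiD s1 s2).
by rewrite (le_trans (nsqD s1 s2))//; lra.
Unshelve. all: by end_near. Qed.

End SmallFamilies.

(** * Regular quantities and their derivative along the flow *)

Section Transported.
Context (R : realType) (T : R) (f : R -> R -> R).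
Implicit Types (u ux d v vx : R -> R -> R) (t s : R).

Local Notation at_time t := (within `[0, T] (nbhs t)).

Definition l2_derivative (u : R -> R -> R) (t : R) (w : R -> R) :=
  sqi 0 1 w /\ l2_small 0^' (fun h x => h^-1 * (u (t + h) x - u t x) - w x).

(* [transported u ux d]: [u] is as regular as the first derivative of a solution,
   [ux] is its space derivative and [d] its derivative along the flow of [f], that
   is [d = u_t + f u_x]; [u |-> d] is a derivation. *)
Record transported u ux d : Prop := Transported {
  tr_ac : forall t, 0 <= t <= T -> ac 0 1 (u t) (ux t);
  tr_sqi : forall t, 0 <= t <= T -> sqi 0 1 (ux t);
  tr_bounded : exists k, forall t x, 0 <= t <= T -> 0 <= x <= 1 -> `|u t x| <= k;
  tr_sup : forall t, 0 <= t <= T -> sup_small (at_time t) (fun s x => u s x - u t x);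
  tr_l2 : forall t, 0 <= t <= T -> l2_small (at_time t) (fun s x => ux s x - ux t x);
  tr_derivative : forall t, 0 < t < T ->
    l2_derivative u t (fun x => d t x - f t x * ux t x) }.

Lemma near_at_time t : \forall s \near at_time t, 0 <= s <= T.
Proof.
by apply/near_within_eps; exists 1 => // s; rewrite /= in_itv.
Qed.

Lemma near_shift t : 0 < t < T -> \forall h \near 0^', 0 <= t + h <= T.
Proof.
move=> /andP[t0 tT]; apply/near_dnbhs_eps; exists (Num.min t (T - t)).
  by rewrite lt_min t0 subr_gt0.
move=> h _; rewrite subr0 lt_min !ltr_norml => /andP[/andP[? ?] /andP[? ?]].
by apply/andP; split; lra.
Qed.

Lemma sup_small_shift u t : 0 < t < T ->
  sup_small (at_time t) (fun s x => u s x - u t x) ->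
  sup_small 0^' (fun h x => u (t + h) x - u t x).
Proof.
move=> tT H e e0; have /near_within_eps[d d0 dP] := H e e0.
have /near_dnbhs_eps[d' d'0 d'P] := near_shift tT.
apply/near_dnbhs_eps; exists (Num.min d d'); first by rewrite lt_min d0.
move=> h h0; rewrite subr0 lt_min => /andP[hd hd']; apply: dP.
  by rewrite /= in_itv/=; apply: d'P => //; rewrite subr0.
by rewrite addrC addKr.
Qed.

Lemma eq_transported u ux d u' ux' d' :
  (forall t x, 0 <= t <= T -> 0 <= x <= 1 -> u t x = u' t x) ->
  (forall t x, 0 <= t <= T -> 0 <= x <= 1 -> ux t x = ux' t x) ->
  (forall t x, 0 < t < T -> 0 <= x <= 1 -> d t x = d' t x) ->
  transported u ux d -> transported u' ux' d'.
Proof.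
move=> eu eux ed [ac_ sq_ [k bd] sup l2 der]; split.
- move=> t tT; apply: eq_ac (ac_ t tT) => x x01; [exact: eu|exact: eux].
- by move=> t tT; apply: eq_sqi (sq_ t tT) => x x01; exact: eux.
- by exists k => t x tT x01; rewrite -eu// bd.
- move=> t tT e e0; near=> s => x x01.
  have sT : 0 <= s <= T by near: s; exact: near_at_time.
  rewrite -!eu//; move: x x01; near: s; exact: sup.
- move=> t tT; apply: eq_near_l2_small (l2 t tT); near=> s => x x01.
  have sT : 0 <= s <= T by near: s; exact: near_at_time.
  by rewrite !eux.
- move=> t tT; have tT' : 0 <= t <= T by move: tT => /andP[/ltW -> /ltW ->].
  have [sw dw] := der t tT.
  have ew x : 0 <= x <= 1 -> d t x - f t x * ux t x = d' t x - f t x * ux' t x.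
    by move=> x01; rewrite ed// eux.
  split; first exact: eq_sqi ew sw.
  apply: eq_near_l2_small dw; near=> h => x x01.
  have hT : 0 <= t + h <= T by near: h; exact: near_shift.
  by rewrite !eu// ew.
Unshelve. all: by end_near. Qed.

Lemma tr_measurable u ux d t : transported u ux d -> 0 <= t <= T ->
  measurable_fun (`[0, 1] : set R) (u t).
Proof. by move=> /tr_ac + tT => /(_ t tT); exact: ac_measurable. Qed.

Lemma tr_near_bounded u ux d : transported u ux d -> exists2 k, 0 <= k &
  [/\ forall t, 0 <= t <= T -> near_bounded (at_time t) k u,
      forall t, 0 < t < T -> near_bounded 0^' k (fun h => u (t + h)) &
      forall t x, 0 <= t <= T -> 0 <= x <= 1 -> `|u t x| <= k].
Proof.
move=> tr; have [k0 bd] := tr_bounded tr.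
pose k := Num.max 0 k0.
have uk t x : 0 <= t <= T -> 0 <= x <= 1 -> `|u t x| <= k.
  by move=> tT x01; rewrite le_max bd ?orbT.
exists k; first by rewrite le_max lexx.
split=> // t tT; near=> s.
- have sT : 0 <= s <= T by near: s; exact: near_at_time.
  by split; [exact: tr_measurable tr sT|move=> x; exact: uk].
- have sT : 0 <= t + s <= T by near: s; exact: near_shift.
  by split; [exact: tr_measurable tr sT|move=> x; exact: uk].
Unshelve. all: by end_near. Qed.

Lemma transported_time (phi phi' : R -> R) : continuous phi ->
  (forall t, 0 < t < T -> is_derive t 1 phi (phi' t)) ->
  transported (fun t _ => phi t) (fun _ _ => 0) (fun t _ => phi' t).
Proof.
move=> cphi dphi; split.
- by move=> t _; exact: ac_cst.
- by move=> t _; exact: sqi_cst.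
- have [k _ kP] := within_continuous_bounded (continuous_within (D := `[0, T]) cphi).
  by exists k => t _ tT _; exact: kP.
- move=> t tT e e0; apply/near_within_eps.
  have /continuous_eps/(_ _ e0)[d d0 dP] := cphi t.
  by exists d => // s _ st x _; rewrite ltW// dP.
- move=> t tT; apply: sup_l2_small; first by apply: nearW => s; exact: measurable_cst.
  by move=> e e0; apply: nearW => s x _; rewrite subrr normr0 ltW.
- move=> t tT; split.
    by apply: eq_sqi (sqi_cst 0 1 (phi' t)) => x _; rewrite mulr0 subr0.
  apply: sup_l2_small.
    apply: nearW => s.
    apply: (@eq_measurable_fun _ _ _ _ _ (cst (s^-1 * (phi (t + s) - phi t) - phi' t))) => //.
    by move=> x _; rewrite mulr0 subr0.
  move=> e e0; have /is_derive_eps/(_ _ e0)[d d0 dP] := dphi t tT.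
  apply/near_dnbhs_eps; exists d => // h h0; rewrite subr0 => hd x _.
  rewrite mulr0 subr0.
  have -> : h^-1 * (phi (t + h) - phi t) - phi' t =
    h^-1 * (phi (t + h) - phi t - h * phi' t) by field.
  by rewrite normrM normfV mulrC ler_pdivrMr ?normr_gt0// dP.
Qed.

Lemma transportedD u ux d v vx c : transported u ux d -> transported v vx c ->
  transported (fun t x => u t x + v t x) (fun t x => ux t x + vx t x)
              (fun t x => d t x + c t x).
Proof.
move=> tu tv; have [ku _ [_ _ uk]] := tr_near_bounded tu.
have [kv _ [_ _ vk]] := tr_near_bounded tv; split.
- by move=> t tT; apply: acD; [exact: tr_ac tu t tT|exact: tr_ac tv t tT].
- by move=> t tT; apply: sqiD; [exact: tr_sqi tu t tT|exact: tr_sqi tv t tT].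
- exists (ku + kv) => t x tT x01; rewrite (le_trans (ler_normD _ _))// lerD ?uk ?vk//.
- move=> t tT; apply: eq_near_sup_small (sup_smallD (tr_sup tu tT) (tr_sup tv tT)).
  by apply: nearW => s x _; ring.
- move=> t tT; apply: eq_near_l2_small (l2_smallD (tr_l2 tu tT) (tr_l2 tv tT)).
  by apply: nearW => s x _; ring.
- move=> t tT; have [su du] := tr_derivative tu tT; have [sv dv] := tr_derivative tv tT.
  split; first by apply: eq_sqi (sqiD su sv) => x _; ring.
  by apply: eq_near_l2_small (l2_smallD du dv); apply: nearW => s x _; ring.
Qed.

Lemma transportedM u ux d v vx c : transported u ux d -> transported v vx c ->
  transported (fun t x => u t x * v t x) (fun t x => ux t x * v t x + u t x * vx t x)
              (fun t x => d t x * v t x + u t x * c t x).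
Proof.
move=> tu tv; have [ku ku0 [nu nu' uk]] := tr_near_bounded tu.
have [kv kv0 [nv nv' vk]] := tr_near_bounded tv.
have mu_ t (tT : 0 <= t <= T) := tr_measurable tu tT.
have mv t (tT : 0 <= t <= T) := tr_measurable tv tT.
have nearB (F : set_system R) (FF : Filter F) (w : R -> R) k :
    measurable_fun (`[0, 1] : set R) w -> (forall x, 0 <= x <= 1 -> `|w x| <= k) ->
    near_bounded F k (fun _ => w) by move=> *; apply: nearW.
split.
- by move=> t tT; apply: acM; [exact: tr_ac tu t tT|exact: tr_ac tv t tT].
- move=> t tT; apply: sqiD.
    apply: (@eq_sqi _ _ _ (fun x => v t x * ux t x)); first by move=> x _; rewrite mulrC.
    by apply: sqiM_bounded (mv _ tT) (fun x => vk t x tT) (tr_sqi tu tT).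
  by apply: sqiM_bounded (mu_ _ tT) (fun x => uk t x tT) (tr_sqi tv tT).
- exists (ku * kv) => t x tT x01; rewrite normrM ler_pM ?uk ?vk//.
- move=> t tT.
  apply: eq_near_sup_small (sup_smallD (sup_smallM (nv t tT) (tr_sup tu tT))
    (sup_smallM (nearB _ _ _ _ (mu_ t tT) (fun x => uk t x tT)) (tr_sup tv tT))).
  by apply: nearW => s x _; ring.
- move=> t tT.
  have m1 : \forall s \near at_time t, measurable_fun (`[0, 1] : set R) (fun x => v s x - v t x).
    near=> s; have sT : 0 <= s <= T by near: s; exact: near_at_time.
    by apply: measurable_funB; exact: mv.
  have m2 : \forall s \near at_time t, measurable_fun (`[0, 1] : set R) (fun x => u s x - u t x).
    near=> s; have sT : 0 <= s <= T by near: s; exact: near_at_time.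
    by apply: measurable_funB; exact: mu_.
  (* The derivatives [ux] and [vx] converge in L^2 only. Their increments are multiplied by bounded
     factors, while the increments of [u] and [v], uniformly small, multiply fixed square-integrable
     functions. *)
  apply: eq_near_l2_small (l2_smallD (l2_smallD (l2_smallM (nv t tT) (tr_l2 tu tT))
    (sup_l2_smallM m1 (tr_sup tv tT) (tr_sqi tu tT)))
    (l2_smallD (l2_smallM (nu t tT) (tr_l2 tv tT))
    (sup_l2_smallM m2 (tr_sup tu tT) (tr_sqi tv tT)))).
  by apply: nearW => s x _; ring.
- move=> t tT; have tT' : 0 <= t <= T by move: tT => /andP[/ltW -> /ltW ->].
  have [su du] := tr_derivative tu tT; have [sv dv] := tr_derivative tv tT.
  have m1 : \forall h \near 0^', measurable_fun (`[0, 1] : set R) (fun x => v (t + h) x - v t x).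
    near=> h; have sT : 0 <= t + h <= T by near: h; exact: near_shift.
    by apply: measurable_funB; exact: mv.
  split.
    have := sqiD (sqiM_bounded (mv _ tT') (fun x => vk t x tT') su)
                 (sqiM_bounded (mu_ _ tT') (fun x => uk t x tT') sv).
    by apply: eq_sqi => x _ /=; ring.
  (* The quotient of the product is [v (t + h)] times that of [u] plus [u t] times that of [v]. The
     middle term replaces [v (t + h)] by [v t] in front of the derivative of [u]. *)
  apply: eq_near_l2_small (l2_smallD (l2_smallD (l2_smallM (nv' t tT) du)
    (sup_l2_smallM m1 (sup_small_shift tT (tr_sup tv tT')) su))
    (l2_smallM (nearB _ _ _ _ (mu_ t tT') (fun x => uk t x tT')) dv)).
  by apply: nearW => s x _; ring.
Unshelve. all: by end_near. Qed.

(** An increment of the inverse is [- (u s)^-1 * (u t)^-1] times that of [u], and the lower bound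
    [m] makes this factor bounded uniformly in [s] and [t]. *)
Lemma transportedV u ux d m : 0 < m ->
  (forall t x, 0 <= t <= T -> 0 <= x <= 1 -> m <= u t x) -> transported u ux d ->
  transported (fun t x => (u t x)^-1) (fun t x => - ux t x * (u t x)^-1 ^+ 2)
              (fun t x => - d t x * (u t x)^-1 ^+ 2).
Proof.
move=> m0 um tu.
have mu_ t (tT : 0 <= t <= T) := tr_measurable tu tT.
have u0 t x : 0 <= t <= T -> 0 <= x <= 1 -> u t x != 0.
  by move=> tT x01; rewrite gt_eqF// (lt_le_trans m0)// um.
have ge0 t x : 0 <= t <= T -> 0 <= x <= 1 -> 0 <= (u t x)^-1.
  by move=> tT x01; rewrite invr_ge0 (le_trans (ltW m0))// um.
have km t x : 0 <= t <= T -> 0 <= x <= 1 -> `|(u t x)^-1| <= m^-1.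
  move=> tT x01; rewrite ger0_norm ?ge0// lef_pV2 ?um// posrE//.
  by rewrite (lt_le_trans m0)// um.
have acv t (tT : 0 <= t <= T) := acV m0 (fun x => um t x tT) (tr_ac tu tT).
have mg t (tT : 0 <= t <= T) := ac_measurable (acv t tT).
have mgg t s (tT : 0 <= t <= T) (sT : 0 <= s <= T) :=
  measurable_funM (mg _ tT) (mg _ sT).
have kmm t s x : 0 <= t <= T -> 0 <= s <= T -> 0 <= x <= 1 ->
    `|(u t x)^-1 * (u s x)^-1| <= m^-1 * m^-1.
  by move=> tT sT x01; rewrite normrM ler_pM ?km.
have nb t : 0 <= t <= T -> near_bounded (at_time t) (m^-1 * m^-1)
    (fun s x => (u s x)^-1 * (u t x)^-1).
  move=> tT; near=> s; have sT : 0 <= s <= T by near: s; exact: near_at_time.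
  by split; [exact: mgg|move=> x; exact: kmm].
have nb2 t : 0 <= t <= T -> near_bounded (at_time t) (m^-1 * m^-1)
    (fun s x => (u s x)^-1 * (u s x)^-1).
  move=> tT; near=> s; have sT : 0 <= s <= T by near: s; exact: near_at_time.
  by split; [exact: mgg|move=> x; exact: kmm].
have supV t : 0 <= t <= T -> sup_small (at_time t) (fun s x => (u s x)^-1 - (u t x)^-1).
  move=> tT e e0; have := sup_smallM (nb t tT) (tr_sup tu tT) e0.
  move=> H; near=> s; have sT : 0 <= s <= T by near: s; exact: near_at_time.
  have Hs : forall x, 0 <= x <= 1 ->
    `|(u s x)^-1 * (u t x)^-1 * (u s x - u t x)| <= e by near: s; exact: H.
  move=> x x01; have -> : (u s x)^-1 - (u t x)^-1 = - ((u s x)^-1 * (u t x)^-1 * (u s x - u t x)).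
    by field; rewrite !u0.
  by rewrite normrN Hs.
have mV t : 0 <= t <= T ->
    \forall s \near at_time t, measurable_fun (`[0, 1] : set R) (fun x => (u s x)^-1 - (u t x)^-1).
  move=> tT; near=> s; have sT : 0 <= s <= T by near: s; exact: near_at_time.
  by apply: measurable_funB; exact: mg.
split.
- exact: acv.
- move=> t tT; have := sqiM_bounded (mgg _ _ tT tT) (fun x => kmm t t x tT tT)
    (sqiN (tr_sqi tu tT)).
  by apply: eq_sqi => x _; rewrite expr2 mulrC.
- by exists m^-1 => t x tT x01; exact: km.
- exact: supV.
- move=> t tT.
  have nbs : near_bounded (at_time t) (m^-1 + m^-1) (fun s x => (u s x)^-1 + (u t x)^-1).
    near=> s; have sT : 0 <= s <= T by near: s; exact: near_at_time.
    split; first by apply: measurable_funD; exact: mg.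
    by move=> x x01; rewrite (le_trans (ler_normD _ _))// lerD// km.
  apply: eq_near_l2_small (l2_smallN (l2_smallD (l2_smallM (nb2 t tT) (tr_l2 tu tT))
    (l2_smallM nbs (sup_l2_smallM (mV t tT) (supV t tT) (tr_sqi tu tT))))).
  by apply: nearW => s x _; ring.
- move=> t tT; have tT' : 0 <= t <= T by move: tT => /andP[/ltW -> /ltW ->].
  have [su du] := tr_derivative tu tT.
  have nbh : near_bounded 0^' (m^-1 * m^-1) (fun h x => (u (t + h) x)^-1 * (u t x)^-1).
    near=> h; have sT : 0 <= t + h <= T by near: h; exact: near_shift.
    by split; [exact: mgg|move=> x; exact: kmm].
  have nbt : near_bounded 0^' m^-1 (fun _ x => (u t x)^-1).
    by apply: nearW => _; split; [exact: mg|move=> x; exact: km].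
  have mVh : \forall h \near 0^', measurable_fun (`[0, 1] : set R) (fun x => (u (t + h) x)^-1 - (u t x)^-1).
    near=> h; have sT : 0 <= t + h <= T by near: h; exact: near_shift.
    by apply: measurable_funB; exact: mg.
  split.
    have := sqiM_bounded (mgg _ _ tT' tT') (fun x => kmm t t x tT' tT') (sqiN su).
    by apply: eq_sqi => x _ /=; ring.
  apply: eq_near_l2_small (l2_smallN (l2_smallD (l2_smallM nbh du) (l2_smallM nbt
    (sup_l2_smallM mVh (sup_small_shift (u := fun t x => (u t x)^-1) tT (supV t tT')) su)))).
  near=> h => x x01.
  have h0 : h != 0 by near: h; exact: nbhs_dnbhs_neq.
  have sT : 0 <= t + h <= T by near: h; exact: near_shift.
  by field; rewrite h0 !u0.
Unshelve. all: by end_near. Qed.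

End Transported.

(** * Composition of a Sobolev function with the inverse flow *)

Section Composition.
Context (R : realType).
Local Notation mu := (@lebesgue_measure R).
Variables (T m M N C : R) (f X xi Y : R -> R -> R).
Hypotheses (m0 : 0 < m) (N0 : 0 <= N) (C0 : 0 <= C).
Hypothesis dX : forall t, 0 <= t <= T -> forall y : R, is_derive y 1 (X t) (xi t y).
Hypothesis cxi : forall t, 0 <= t <= T -> continuous (xi t).
Hypothesis xi_ge : forall t, 0 <= t <= T -> forall y, m <= xi t y.
Hypothesis xi_le : forall t, 0 <= t <= T -> forall y, xi t y <= M.
Hypothesis YK : forall t, 0 <= t <= T -> cancel (Y t) (X t).
Hypothesis XN : forall t y, 0 <= t <= T -> 0 <= y <= 1 -> `|X t y| <= N.
Hypothesis XC : forall s t y, 0 <= s <= T -> 0 <= t <= T -> 0 <= y <= 1 ->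
  `|X s y - X t y| <= C * `|s - t|.
Hypothesis xi_sup : forall t, 0 <= t <= T ->
  sup_small (within `[0, T] (nbhs t)) (fun s y => xi s y - xi t y).
Hypothesis X_derivative : forall t, 0 < t < T ->
  sup_small 0^' (fun h y => h^-1 * (X (t + h) y - X t y) + f t y * xi t y).
Hypothesis cf : forall t, 0 <= t <= T -> {within `[0, 1], continuous (f t)}.
Implicit Types (t s p q : R) (a g e : R -> R).

Let xi0 t : 0 <= t <= T -> forall y, 0 < xi t y.
Proof. by move=> tT y; rewrite (lt_le_trans m0)// xi_ge. Qed.

Let cX t : 0 <= t <= T -> continuous (X t).
Proof. by move=> tT; exact: cov_continuous (dX tT). Qed.

Let X_le t p q : 0 <= t <= T -> (X t p <= X t q) = (p <= q).
Proof. by move=> tT; exact: cov_le (dX tT) (xi0 tT) _ _. Qed.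

Let cov t g p q : 0 <= t <= T -> p <= q -> itg `[X t p, X t q] g ->
  itg `[p, q] (fun y => g (X t y) * xi t y) /\
  \int[mu]_(x in `[X t p, X t q]) g x = \int[mu]_(y in `[p, q]) (g (X t y) * xi t y).
Proof.
move=> tT pq ig; split.
  exact: (@cov_itg _ (X t) (Y t) (xi t) (dX tT) (cxi tT) (xi0 tT) (YK tT)).
exact: (@cov_Rintegral _ (X t) (Y t) (xi t) (dX tT) (cxi tT) (xi0 tT) (YK tT)).
Qed.

Lemma ac_comp a a' t : (forall p q, ac p q a a') -> 0 <= t <= T ->
  ac 0 1 (fun y => a (X t y)) (fun y => a' (X t y) * xi t y).
Proof.
move=> A tT; split.
  by have [] := cov tT ler01 (A (X t 0) (X t 1)).1.
move=> x y x0 xy y1.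
have Xxy : X t x <= X t y by rewrite X_le.
have [ia /(_ (X t x) (X t y) (lexx _) Xxy (lexx _)) ->] := A (X t x) (X t y).
by have [] := cov tT xy ia.
Qed.

(** As [xi >= m], the Jacobian needed for the change of variables can be inserted at the cost of
    [m^-1]. The images of [0,1] at all times lie in [[- N, N]], whence a bound uniform in [t]. *)
Lemma sqi_comp g t : (forall p q, sqi p q g) -> 0 <= t <= T ->
  sqi 0 1 (fun y => g (X t y)) /\ nsq 0 1 (fun y => g (X t y)) <= m^-1 * nsq (- N) N g.
Proof.
move=> sg tT.
have mgX : measurable_fun (`[0, 1] : set R) (fun y => g (X t y)).
  apply: measurable_comp (sg (X t 0) (X t 1)).1 _ => //.
    by move=> _ [y /= + <-] /=; rewrite !in_itv/= !X_le.
  exact: (measurable_funTS (continuous_measurable_fun (cX tT))).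
have X01 : X t 0 <= X t 1 by rewrite X_le.
have [ig Ig] := cov tT ler01 (sg (X t 0) (X t 1)).2.
have bd y : `|g (X t y) ^+ 2| <= m^-1 * (g (X t y) ^+ 2 * xi t y).
  rewrite ger0_norm ?sqr_ge0// mulrCA ler_peMr ?sqr_ge0//.
  by rewrite mulrC ler_pdivlMr// mul1r xi_ge.
have igX : itg `[0, 1] (fun y => g (X t y) ^+ 2).
  by apply: itg_le (itgZ _ m^-1 ig) _ => //; exact: measurable_funX.
split; first by [].
apply: (@le_trans _ _ (\int[mu]_(y in `[0, 1]) (m^-1 * (g (X t y) ^+ 2 * xi t y)))).
  apply: int_le => //; first exact: itgZ.
  by move=> y _; rewrite (le_trans (ler_norm _)).
rewrite RintegralZl// ler_wpM2l ?invr_ge0 ?(ltW m0)//.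
rewrite -Ig; have := XN tT (y := 0); have := XN tT (y := 1).
rewrite !lexx ler01 !ler_norml => /(_ isT)/andP[_ X1] /(_ isT)/andP[X0 _].
exact: nsq_sub.
Qed.

Lemma shift_int g k p q : continuous g -> p <= q ->
  \int[mu]_(x in `[p, q]) g (x + k) = \int[mu]_(x in `[p + k, q + k]) g x.
Proof.
move=> cg pq.
have dk (y : R) : is_derive y 1 (fun y => y + k) 1.
  apply/is_derive_eps => e e0; exists 1 => // h _.
  have -> : y + h + k - (y + k) - h * 1 = 0 by ring.
  by rewrite normr0 mulr_ge0// ltW.
have c1 : continuous (fun _ : R => 1 : R) by move=> x; exact: cvg_cst.
have k2 : cancel (fun y : R => y - k) (fun y => y + k) by move=> y; rewrite subrK.
rewrite (@cov_Rintegral _ _ _ _ dk c1 (fun _ => ltr01) k2 g p q)//; last exact: itg_continuous.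
by apply: int_eq => x _; rewrite mulr1.
Qed.

(* The increment of a primitive [e] is bounded by the Cauchy-Schwarz inequality;
   the integral of the resulting right-hand side telescopes. *)
Lemma nsq_increment e e' t h k : (forall p q, ac p q e e') -> (forall p q, sqi p q e') ->
  0 <= t <= T -> 0 <= t + h <= T -> C * `|h| <= k -> 0 < k -> k <= 1 ->
  nsq 0 1 (fun y => e (X (t + h) y) - e (X t y)) <=
  m^-1 * (2 * k ^+ 2 * nsq (- (N + 1)) (N + 1) e').
Proof.
move=> A se tT hT Chk k0 k1.
pose S := prim (fun x => e' x ^+ 2).
have ie p q : itg `[p, q] (fun x => e' x ^+ 2) by case: (se p q).
have cS : continuous S by exact: prim_continuous.
have SB p q : p <= q -> S q - S p = nsq p q e' by move=> pq; exact: primB.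
have S_mono p q : p <= q -> S p <= S q by move=> pq; rewrite -subr_ge0 SB// nsq_ge0.
have mX s : 0 <= s <= T -> continuous (X s) by exact: cX.
have ce : continuous e.
  move=> x; have /ac_continuous := A (x - 1) (x + 1).
  move=> /continuous_within_itvP[]; first by lra.
  by move=> /(_ x) H _ _; apply: H; rewrite in_itv/=; apply/andP; split; lra.
have cq : continuous (fun y => e (X (t + h) y) - e (X t y)).
  move=> y; apply: cvgB.
    by apply: (@continuous_comp _ _ _ (X (t + h)) e); [exact: mX|exact: ce].
  by apply: (@continuous_comp _ _ _ (X t) e); [exact: mX|exact: ce].
pose g x := S (x + k) - S (x - k).
have cg : continuous g.
  move=> x; apply: cvgB.
    apply: (@continuous_comp _ _ _ (fun x : R => x + k) S); last exact: cS.
    by apply: cvgD; [exact: cvg_id|exact: cvg_cst].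
  apply: (@continuous_comp _ _ _ (fun x : R => x - k) S); last exact: cS.
  by apply: cvgB; [exact: cvg_id|exact: cvg_cst].
have g0 x : 0 <= g x by rewrite subr_ge0 S_mono//; lra.
have cgX : continuous (fun y => g (X t y)).
  by move=> y; apply: (@continuous_comp _ _ _ (X t) g); [exact: mX|exact: cg].
have [igX IgX] := cov tT ler01 (itg_continuous (X t 0) (X t 1) cg).
apply: (@le_trans _ _ (\int[mu]_(y in `[0, 1]) (k * g (X t y)))).
  apply: int_le => //.
  - by case: (sqi_continuous 0 1 cq).
  - by apply: itgZ => //; exact: itg_continuous.
  move=> y /=; rewrite in_itv/= => y01.
  have := XC hT tT y01; rewrite addrAC subrr add0r => Xk.
  have {}Xk : `|X (t + h) y - X t y| <= k by exact: le_trans Chk.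
  have XX : X t y - k <= X (t + h) y <= X t y + k.
    by move: Xk; rewrite ler_norml => /andP[? ?]; apply/andP; split; lra.
  have Xy : X t y - k <= X t y <= X t y + k by apply/andP; split; lra.
  rewrite (le_trans (ac_hoelder (A (X t y - k) (X t y + k)) (se _ _) XX Xy))//.
  by rewrite ler_pM ?nsq_ge0// /g SB//; lra.
rewrite RintegralZl//; last exact: itg_continuous.
apply: (@le_trans _ _ (k * (m^-1 * \int[mu]_(x in `[X t 0, X t 1]) g x))).
  rewrite ler_wpM2l ?(ltW k0)// IgX -RintegralZl//; apply: int_le => //.
  - exact: itg_continuous.
  - exact: itgZ.
  move=> y _; rewrite mulrCA ler_peMr//.
  by rewrite mulrC ler_pdivlMr// mul1r xi_ge.
rewrite mulrCA ler_wpM2l ?invr_ge0 ?(ltW m0)//.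
have X01 : X t 0 <= X t 1 by rewrite X_le.
rewrite /g RintegralB//; first last.
- apply: itg_continuous => x; apply: (@continuous_comp _ _ _ (fun x : R => x - k) S); last exact: cS.
  by apply: cvgB; [exact: cvg_id|exact: cvg_cst].
- apply: itg_continuous => x; apply: (@continuous_comp _ _ _ (fun x : R => x + k) S); last exact: cS.
  by apply: cvgD; [exact: cvg_id|exact: cvg_cst].
rewrite !shift_int//.
have iS p q : itg `[p, q] S by exact: itg_continuous.
(* Only windows of width [2 k] around the two ends remain; they lie in [[- (N + 1), N + 1]] because
   [k <= 1], and [S] is monotone. Their width supplies a second factor [k], the first being that of
   [ac_hoelder]. *)
have -> : \int[mu]_(x in `[X t 0 + k, X t 1 + k]) S x - \int[mu]_(x in `[X t 0 - k, X t 1 - k]) S x =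
    \int[mu]_(x in `[X t 1 - k, X t 1 + k]) S x - \int[mu]_(x in `[X t 0 - k, X t 0 + k]) S x.
  have E1 : prim S (X t 1 + k) - prim S (X t 0 + k) = \int[mu]_(x in `[X t 0 + k, X t 1 + k]) S x.
    by apply: primB => //; lra.
  have E2 : prim S (X t 1 - k) - prim S (X t 0 - k) = \int[mu]_(x in `[X t 0 - k, X t 1 - k]) S x.
    by apply: primB => //; lra.
  have E3 : prim S (X t 1 + k) - prim S (X t 1 - k) = \int[mu]_(x in `[X t 1 - k, X t 1 + k]) S x.
    by apply: primB => //; lra.
  have E4 : prim S (X t 0 + k) - prim S (X t 0 - k) = \int[mu]_(x in `[X t 0 - k, X t 0 + k]) S x.
    by apply: primB => //; lra.
  by rewrite -E1 -E2 -E3 -E4; ring.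
have := XN tT (y := 0); have := XN tT (y := 1).
rewrite !lexx ler01 !ler_norml => /(_ isT)/andP[X1' X1] /(_ isT)/andP[X0 X0'].
have B1 : \int[mu]_(x in `[X t 1 - k, X t 1 + k]) S x <= S (N + 1) * (2 * k).
  have -> : S (N + 1) * (2 * k) = \int[mu]_(x in `[X t 1 - k, X t 1 + k]) S (N + 1).
    by rewrite int_cst; [congr (_ * _); ring|lra].
  apply: int_le => //; first exact: itg_cst.
  by move=> x /=; rewrite in_itv/= => /andP[? ?]; apply: S_mono; lra.
have B0 : S (- (N + 1)) * (2 * k) <= \int[mu]_(x in `[X t 0 - k, X t 0 + k]) S x.
  have -> : S (- (N + 1)) * (2 * k) = \int[mu]_(x in `[X t 0 - k, X t 0 + k]) S (- (N + 1)).
    by rewrite int_cst; [congr (_ * _); ring|lra].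
  apply: int_le => //; first exact: itg_cst.
  by move=> x /=; rewrite in_itv/= => /andP[? ?]; apply: S_mono; lra.
have -> : 2 * k ^+ 2 * nsq (- (N + 1)) (N + 1) e' =
    k * (S (N + 1) * (2 * k) - S (- (N + 1)) * (2 * k)).
  by rewrite -SB; [ring|lra].
by rewrite ler_wpM2l ?(ltW k0)// lerB.
Qed.

Let near_T t : \forall s \near within `[0, T] (nbhs t), 0 <= s <= T.
Proof. exact: near_at_time. Qed.

Lemma XN_itv t y : 0 <= t <= T -> 0 <= y <= 1 -> X t y \in `[- N, N].
Proof. by move=> tT y01; rewrite in_itv/= -ler_norml XN. Qed.

Lemma near_XC t (e : R) : 0 <= t <= T -> 0 < e -> \forall s \near within `[0, T] (nbhs t),
  forall y, 0 <= y <= 1 -> `|X s y - X t y| < e.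
Proof.
move=> tT e0; have C1 : 0 < C + 1 by rewrite ltr_wpDl.
apply/near_within_eps; exists (e / (C + 1)); first by rewrite divr_gt0.
move=> s; rewrite /= in_itv/= => sT st y y01.
rewrite (le_lt_trans (XC sT tT y01))//.
rewrite (@le_lt_trans _ _ ((C + 1) * `|s - t|))//; first by rewrite ler_wpM2r// lerDl.
by rewrite mulrC -ltr_pdivlMr.
Qed.

Lemma comp_sup_small g t : continuous g -> 0 <= t <= T ->
  sup_small (within `[0, T] (nbhs t)) (fun s y => g (X s y) - g (X t y)).
Proof.
move=> cg tT e e0; have [d d0 dP] := uniform_continuity (- N) N cg e0.
near=> s; have sT : 0 <= s <= T by near: s; exact: near_T.
have Xs : forall y, 0 <= y <= 1 -> `|X s y - X t y| < d by near: s; exact: near_XC.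
by move=> y y01; rewrite ltW// dP ?XN_itv// Xs.
Unshelve. all: by end_near. Qed.

(** For [g] in L^2 nothing can be said pointwise. A continuous [h] close to [g] is composed instead,
    and [sqi_comp] bounds the error uniformly in time. *)
Lemma comp_l2_small g t : (forall p q, sqi p q g) -> 0 <= t <= T ->
  l2_small (within `[0, T] (nbhs t)) (fun s y => g (X s y) - g (X t y)).
Proof.
move=> sg tT; apply: l2_small_approx => e e0.
have em : 0 < e * m / 4 by rewrite divr_gt0// mulr_gt0.
have [h ch gh] := continuous_density (sg (- N) N) em.
have sgh p q : sqi p q (fun x => g x - h x).
  by apply: sqiB => //; exact: sqi_continuous.
exists (fun s y => h (X s y) - h (X t y)).
exists (fun s y => (g (X s y) - h (X s y)) - (g (X t y) - h (X t y))); split.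
- apply: sup_l2_small (comp_sup_small ch tT); near=> s.
  have sT : 0 <= s <= T by near: s; exact: near_T.
  apply: measurable_funB; apply: measurable_continuous_comp => //;
    exact: (measurable_funTS (continuous_measurable_fun (cX _))).
- near=> s; have sT : 0 <= s <= T by near: s; exact: near_T.
  have [ss ns] := sqi_comp sgh sT; have [st nt] := sqi_comp sgh tT.
  split; first exact: sqiB.
  rewrite (le_trans (nsqB ss st))//.
  have : m^-1 * nsq (- N) N (fun x => g x - h x) <= m^-1 * (e * m / 4).
    by rewrite ler_wpM2l ?invr_ge0 ?(ltW m0)// ltW.
  have -> : m^-1 * (e * m / 4) = e / 4 by field; rewrite gt_eqF.
  by move: ns nt; lra.
- by near=> s => y _; ring.
Unshelve. all: by end_near. Qed.

(** For continuous [g] the primitive is continuously differentiable, and the chain rule with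
    [X_t = - f X_x] holds uniformly in [y] by uniform continuity of [g] on [[- N, N]]. *)
Lemma comp_derivative_continuous g t : continuous g -> 0 < t < T ->
  sup_small 0^' (fun h y => h^-1 * (prim g (X (t + h) y) - prim g (X t y)) +
                            g (X t y) * (f t y * xi t y)).
Proof.
move=> cg tT; have tT' : 0 <= t <= T by move: tT => /andP[/ltW -> /ltW ->].
have [k k0 gk] := within_continuous_bounded (continuous_within (D := `[- N, N]) cg).
have mg : measurable_fun (`[0, 1] : set R) (fun y => g (X t y)).
  apply: measurable_continuous_comp => //.
  exact: (measurable_funTS (continuous_measurable_fun (cX _))).
have gXk y : 0 <= y <= 1 -> `|g (X t y)| <= k.
  by move=> y01; apply: gk; have := XN_itv tT' y01; rewrite in_itv.
have H1 : sup_small 0^' (fun h y => g (X t y) *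
    (h^-1 * (X (t + h) y - X t y) + f t y * xi t y)).
  apply: sup_smallM (X_derivative tT).
  by apply: nearW => h; split; [exact: mg|exact: gXk].
suff H2 : sup_small 0^' (fun h y => h^-1 * (prim g (X (t + h) y) - prim g (X t y) -
    g (X t y) * (X (t + h) y - X t y))).
  by apply: eq_near_sup_small (sup_smallD H1 H2); apply: nearW => h y _; ring.
move=> e e0; have C1 : 0 < C + 1 by rewrite ltr_wpDl.
have e1 : 0 < e / (C + 1) by rewrite divr_gt0.
have [d d0 dP] := uniform_continuity (- N) N cg e1.
have near_h : \forall h \near (0 : R)^', `|h| < d / (C + 1).
  apply/near_dnbhs_eps; exists (d / (C + 1)); first by rewrite divr_gt0.
  by move=> h _; rewrite subr0.
near=> h => y y01.
have h0 : h != 0 by near: h; exact: nbhs_dnbhs_neq.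
have hT : 0 <= t + h <= T by near: h; exact: near_shift.
have hd : `|h| < d / (C + 1) by near: h.
have Xh := XC hT tT' y01; rewrite addrAC subrr add0r in Xh.
have Xd : `|X (t + h) y - X t y| < d.
  rewrite (le_lt_trans Xh)// (@le_lt_trans _ _ ((C + 1) * `|h|))//.
    by rewrite ler_wpM2r// lerDl.
  by rewrite mulrC -ltr_pdivlMr.
set p := X t y in Xh Xd *; set q := X (t + h) y in Xh Xd *.
have pN : p \in `[- N, N] by exact: XN_itv.
have qN : q \in `[- N, N] by exact: XN_itv.
have main : `|prim g q - prim g p - g p * (q - p)| <= e / (C + 1) * `|q - p|.
  have ig (a b : R) : itg `[a, b] g by exact: itg_continuous.
  have key (a b : R) : a <= b -> a \in `[- N, N] -> b \in `[- N, N] -> `|b - a| < d ->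
      p \in `[a, b] -> `|prim g b - prim g a - g p * (b - a)| <= e / (C + 1) * (b - a).
    rewrite !in_itv/= => ab /andP[Na aN] /andP[Nb bN] bad /andP[ap pb].
    rewrite primB// -(int_cst _ ab).
    rewrite -RintegralB; [|by []|exact: ig|exact: itg_cst].
    apply: int_bounded => //; first by apply: itg_measurable; apply: itgB => //; exact: itg_cst.
    move=> x; rewrite in_itv/= => /andP[ax xb]; rewrite ltW// dP//.
    - by rewrite in_itv/= (le_trans Na)//= (le_trans xb).
    - move: bad; rewrite ger0_norm ?subr_ge0// => bad.
      by rewrite ltr_norml; apply/andP; split; lra.
  have [pq|/ltW qp] := leP p q.
    apply: (le_trans (key p q pq pN qN Xd _)); first by rewrite in_itv/= lexx.
    by rewrite ler_wpM2l ?ler_norm// ltW.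
  have qpd : `|p - q| < d by rewrite distrC.
  have := key q p qp qN pN qpd; rewrite in_itv/= qp lexx => /(_ isT) H.
  have -> : prim g q - prim g p - g p * (q - p) = - (prim g p - prim g q - g p * (p - q)).
    by ring.
  by rewrite normrN (le_trans H)// ler_wpM2l ?(ltW e1)// distrC ler_norm.
rewrite normrM normfV mulrC ler_pdivrMr ?normr_gt0// (le_trans main)//.
apply: (@le_trans _ _ (e / (C + 1) * (C * `|h|))); first by rewrite ler_wpM2l// ltW.
by rewrite mulrA ler_wpM2r// mulrAC ler_pdivrMr// ler_wpM2l ?lerDl// ltW.
Unshelve. all: by end_near. Qed.

(** The hypothesis [X_derivative] says that [X_t + f X_x = 0]: functions of [X] are constant along
    the flow, whence the last component 0. As [a'] is only in L^2, [a] is split into the primitive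
    of a continuous [g], to which the classical chain rule applies, and a remainder [b] with small
    [b'], whose difference quotients are bounded in L^2 by [nsq_increment]. *)
Lemma transported_comp a a' : (forall p q, ac p q a a') -> (forall p q, sqi p q a') ->
  transported T f (fun t y => a (X t y)) (fun t y => a' (X t y) * xi t y) (fun _ _ => 0).
Proof.
move=> A sa.
have ca : continuous a.
  move=> x; have /ac_continuous := A (x - 1) (x + 1).
  move=> /continuous_within_itvP[]; first by lra.
  by move=> /(_ x) H _ _; apply: H; rewrite in_itv/=; apply/andP; split; lra.
have mxi t : 0 <= t <= T -> measurable_fun (`[0, 1] : set R) (xi t).
  by move=> tT; exact: (measurable_funTS (continuous_measurable_fun (cxi tT))).
have xi_norm t y : 0 <= t <= T -> `|xi t y| <= M.
  by move=> tT; rewrite gtr0_norm ?xi0// xi_le.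
have sxi t : 0 <= t <= T -> sqi 0 1 (fun y => a' (X t y) * xi t y).
  move=> tT; have := sqiM_bounded (mxi _ tT) (fun y _ => xi_norm t y tT) (sqi_comp sa tT).1.
  by apply: eq_sqi => y _; rewrite mulrC.
split.
- by move=> t tT; exact: ac_comp.
- exact: sxi.
- have [k _ ak] := within_continuous_bounded (continuous_within (D := `[- N, N]) ca).
  exists k => t y tT y01; apply: ak; by have := XN_itv tT y01; rewrite in_itv.
- by move=> t tT; exact: comp_sup_small.
- move=> t tT.
  have nb : near_bounded (within `[0, T] (nbhs t)) M xi.
    near=> s; have sT : 0 <= s <= T by near: s; exact: near_T.
    by split; [exact: mxi|move=> y _; exact: xi_norm].
  have mB : \forall s \near within `[0, T] (nbhs t),
      measurable_fun (`[0, 1] : set R) (fun y => xi s y - xi t y).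
    near=> s; have sT : 0 <= s <= T by near: s; exact: near_T.
    by apply: measurable_funB; exact: mxi.
  apply: eq_near_l2_small (l2_smallD (l2_smallM nb (comp_l2_small sa tT))
    (sup_l2_smallM mB (xi_sup tT) (sqi_comp sa tT).1)).
  by apply: nearW => s y _; ring.
- move=> t tT; have tT' : 0 <= t <= T by move: tT => /andP[/ltW -> /ltW ->].
  have [kf kf0 fk] := within_continuous_bounded (cf tT').
  have mf : measurable_fun (`[0, 1] : set R) (f t).
    by apply: subspace_continuous_measurable_fun (cf tT').
  have M0 : 0 <= M by rewrite (le_trans (normr_ge0 _) (xi_norm t 0 tT')).
  have mfxi : measurable_fun (`[0, 1] : set R) (fun y => f t y * xi t y).
    by apply: measurable_funM => //; exact: mxi.
  have fxik y : 0 <= y <= 1 -> `|f t y * xi t y| <= kf * M.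
    by move=> y01; rewrite normrM ler_pM ?fk ?xi_norm.
  have sfa : sqi 0 1 (fun y => f t y * xi t y * a' (X t y)).
    exact: sqiM_bounded fxik (sqi_comp sa tT').1.
  split; first by apply: eq_sqi (sqiN sfa) => y _; ring.
  (* The first summand stems from the difference quotient of [b], the second from the term with
     [f t y * xi t y * b']; the outer factors 2 are those of [nsqD]. *)
  pose K := 2 * (m^-1 * (2 * (C + 1) ^+ 2)) + 2 * ((kf * M) ^+ 2 * m^-1).
  have C1 : 0 < C + 1 by rewrite ltr_wpDl.
  have K0 : 0 <= K.
    by rewrite addr_ge0// !mulr_ge0// ?invr_ge0 ?sqr_ge0 ?ltW// mulr_ge0// ltW.
  apply: l2_small_approx => e e0.
  have eK : 0 < e / (K + 1) by rewrite divr_gt0// ltr_wpDl.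
  have [g cg ag] := continuous_density (sa (- (N + 1)) (N + 1)) eK.
  have ig p q : itg `[p, q] g by exact: itg_continuous.
  pose b x := a x + -1 * prim g x; pose b' x := a' x - g x.
  have Ab p q : ac p q b b'.
    apply: eq_ac (acD (A p q) (acZ (-1) (prim_ac p q ig))) => // x _.
    by rewrite mulN1r.
  have sb p q : sqi p q b' by apply: sqiB => //; exact: sqi_continuous.
  have nb : nsq (- N) N b' <= nsq (- (N + 1)) (N + 1) b'.
    by apply: (nsq_sub _ _ _ (sb _ _)); move: N0; lra.
  have cb : continuous b.
    move=> x; apply: cvgD; first exact: ca.
    by apply: cvgM; [exact: cvg_cst|exact: prim_continuous].
  have mX s : 0 <= s <= T -> continuous (X s) by exact: cX.
  exists (fun h y => h^-1 * (prim g (X (t + h) y) - prim g (X t y)) +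
                            g (X t y) * (f t y * xi t y)).
  exists (fun h y => h^-1 * (b (X (t + h) y) - b (X t y)) + f t y * xi t y * b' (X t y)).
  split.
  + apply: sup_l2_small; last exact: comp_derivative_continuous.
    near=> h; have hT : 0 <= t + h <= T by near: h; exact: near_shift.
    have cp : continuous (prim g) by exact: prim_continuous.
    apply: measurable_funD; last first.
      apply: measurable_funM mfxi; apply: measurable_continuous_comp => //.
      exact: (measurable_funTS (continuous_measurable_fun (mX _ _))).
    apply: measurable_funM; first exact: measurable_cst.
    apply: measurable_funB; apply: measurable_continuous_comp => //;
      exact: (measurable_funTS (continuous_measurable_fun (mX _ _))).
  + have near_h : \forall h \near (0 : R)^', `|h| < (C + 1)^-1.
      apply/near_dnbhs_eps; exists (C + 1)^-1; first by rewrite invr_gt0.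
      by move=> h _; rewrite subr0.
    near=> h.
    have hT : 0 <= t + h <= T by near: h; exact: near_shift.
    have h0 : h != 0 by near: h; exact: nbhs_dnbhs_neq.
    have h1 : (C + 1) * `|h| <= 1.
      by rewrite mulrC -ler_pdivlMr// div1r ltW//; near: h.
    (* The width [(C + 1) * |h|] replaces [C * |h|] since [nsq_increment] requires a positive width
       and [C] may be 0. *)
    have hpos : 0 < (C + 1) * `|h| by rewrite mulr_gt0// normr_gt0.
    have Ch : C * `|h| <= (C + 1) * `|h| by rewrite ler_wpM2r// lerDl.
    have s1 : sqi 0 1 (fun y => b (X (t + h) y) - b (X t y)).
      apply: sqiB; apply: sqi_continuous => y.
        by apply: (@continuous_comp _ _ _ (X (t + h)) b); [exact: mX|exact: cb].
      by apply: (@continuous_comp _ _ _ (X t) b); [exact: mX|exact: cb].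
    have [s2 n2] := sqi_comp sb tT'.
    split; first by apply: sqiD; [exact: sqiZ|exact: sqiM_bounded fxik s2].
    rewrite (le_trans (nsqD (sqiZ _ s1) (sqiM_bounded mfxi fxik s2)))// nsqZ//.
    have n1 := nsq_increment Ab sb tT' hT Ch hpos h1.
    have n3 := nsqM_bounded mfxi fxik s2.
    set B := nsq (- (N + 1)) (N + 1) b' in nb n1 *.
    have B0 : 0 <= B by exact: nsq_ge0.
    have N1 : h^-1 ^+ 2 * nsq 0 1 (fun y => b (X (t + h) y) - b (X t y)) <=
        m^-1 * (2 * (C + 1) ^+ 2) * B.
      have -> : m^-1 * (2 * (C + 1) ^+ 2) * B =
          h^-1 ^+ 2 * (m^-1 * (2 * ((C + 1) * `|h|) ^+ 2 * B)).
        rewrite exprMn real_normK ?num_real//; field.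
        by rewrite h0 gt_eqF.
      by rewrite ler_wpM2l ?sqr_ge0.
    have N3 : nsq 0 1 (fun y => f t y * xi t y * b' (X t y)) <= (kf * M) ^+ 2 * m^-1 * B.
      rewrite (le_trans n3)// -mulrA ler_wpM2l ?sqr_ge0// (le_trans n2)//.
      by rewrite ler_wpM2l ?invr_ge0 ?(ltW m0).
    apply: (@le_trans _ _ (K * B)); first by rewrite /K; move: N1 N3; lra.
    apply: (@le_trans _ _ (K * (e / (K + 1)))); first by rewrite ler_wpM2l// ltW.
    by rewrite mulrA ler_pdivrMr ?ltr_wpDl// mulrC ler_wpM2l ?lerDl ?ltW.
  + by apply: nearW => h y _; rewrite /b /b'; ring.
Unshelve. all: by end_near. Qed.

End Composition.

(** * Uniqueness *)

Section EnergyMethod.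
Context (R : realType).
Local Notation mu := (@lebesgue_measure R).
Implicit Types (u v w g : R -> R) (t s x y : R).

Lemma vanishes_on_diagonalP (T : R) (d : R -> R -> R) : vanishes_on_diagonal T d <->
  forall t, 0 <= t <= T -> forall e, 0 < e ->
  \forall s \near within `[0, T] (nbhs t), `|d s t| < e.
Proof.
split=> [H t tT e e0|H t].
  have := H t; rewrite in_itv/= => /(_ tT)/cvgP_eps/(_ _ e0).
  by apply: filterS => s; rewrite subr0.
rewrite in_itv/= => tT; apply/cvgP_eps => e /(H t tT).
by apply: filterS => s; rewrite subr0.
Qed.

(** Translation between the L^2 norm and its square. It needs [u] to be square-integrable near [t],
    since [L2_norm] is identified with the root of [nsq] for square-integrable functions. *)
Lemma L2_time_derivativeP (T t : R) (u : R -> R -> R) w : 0 < t < T ->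
  (forall s, 0 <= s <= T -> sqi 0 1 (u s)) ->
  L2_time_derivative u t w <-> l2_derivative u t w.
Proof.
move=> tT su.
have tT' : 0 <= t <= T by move: tT => /andP[/ltW -> /ltW ->].
have sq h : sqi 0 1 w -> 0 <= t + h <= T ->
    sqi 0 1 (fun x => h^-1 * (u (t + h) x - u t x) - w x).
  by move=> sw hT; apply: sqiB => //; apply: sqiZ; apply: sqiB; exact: su.
split=> [[/L2P sw H]|[sw H]]; split => //; try exact/L2P.
- move=> e e0; near=> h; have hT : 0 <= t + h <= T by near: h; exact: near_shift.
  split; first exact: sq.
  have : `|L2_norm (fun x => h^-1 * (u (t + h) x - u t x) - w x) - 0| < Num.sqrt e.
    by near: h; move/cvgP_eps : H; apply; rewrite sqrtr_gt0.
  rewrite subr0 L2_normE; last exact: sq.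
  by rewrite ger0_norm ?sqrtr_ge0// ltr_sqrt// => /ltW.
- apply/cvgP_eps => e e0.
  have e20 : 0 < e ^+ 2 / 2 by rewrite divr_gt0// exprn_gt0.
  near=> h.
  have hT : 0 <= t + h <= T by near: h; exact: near_shift.
  rewrite subr0 L2_normE; last exact: sq.
  rewrite ger0_norm ?sqrtr_ge0// -(ger0_norm (ltW e0)) -sqrtr_sqr ltr_sqrt ?exprn_gt0//.
  rewrite (@le_lt_trans _ _ (e ^+ 2 / 2))//; last first.
    by rewrite ltr_pdivrMr// ltr_pMr ?exprn_gt0// ltr1n.
  suff [] : sqi 0 1 (fun x => h^-1 * (u (t + h) x - u t x) - w x) /\
     nsq 0 1 (fun x => h^-1 * (u (t + h) x - u t x) - w x) <= e ^+ 2 / 2 by [].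
  by near: h; exact: (H _ e20).
Unshelve. all: by end_near. Qed.

Lemma ae_nsq_eq0 u v : sqi 0 1 u -> sqi 0 1 v ->
  {ae mu, forall x, x \in `[0, 1] -> u x = v x} -> nsq 0 1 (fun x => u x - v x) = 0.
Proof.
move=> su sv uv; have [_ iw] := sqiB su sv.
rewrite /nsq /Rintegral (@ae_eq_integral _ _ _ mu _ (cst 0%E)) ?integral0//.
- exact: (measurable_int mu iw).
- case: uv => N [mN N0 sN]; exists N; split => // x /= H; apply: sN => /= uv; apply: H.
  by move=> x01; rewrite uv ?subrr ?expr0n.
Qed.

Lemma l2_derivative_ae (T t : R) (u : R -> R -> R) w w' : 0 < t < T ->
  (forall s, 0 <= s <= T -> sqi 0 1 (u s)) -> sqi 0 1 w' ->
  {ae mu, forall x, x \in `[0, 1] -> w x = w' x} ->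
  l2_derivative u t w -> l2_derivative u t w'.
Proof.
move=> tT su sw' ww' [sw H]; split => //.
have small : l2_small (0 : R)^' (fun _ x => w x - w' x).
  move=> e e0; apply: nearW => _; split; first exact: sqiB.
  by rewrite ae_nsq_eq0// ltW.
by apply: eq_near_l2_small (l2_smallD H small); apply: nearW => h x _; ring.
Qed.

Lemma l2_derivativeB (t : R) (u v : R -> R -> R) w z :
  l2_derivative u t w -> l2_derivative v t z ->
  l2_derivative (fun t x => u t x - v t x) t (fun x => w x - z x).
Proof.
move=> [sw H] [sz K]; split; first exact: sqiB.
apply: eq_near_l2_small (l2_smallD H (l2_smallN K)).
by apply: nearW => h x _; ring.
Qed.

Lemma nsq_perturb u v : sqi 0 1 u -> sqi 0 1 v ->
  nsq 0 1 (fun x => u x + v x) = nsq 0 1 u + 2 * \int[mu]_(x in `[0, 1]) (u x * v x) + nsq 0 1 v.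
Proof.
move=> su sv; have [_ iu] := su; have [_ iv] := sv; have iuv := sqi_mul su sv.
rewrite /nsq -RintegralZl// -!RintegralD//; first last.
- exact: itgZ.
- by apply: itgD => //; exact: itgZ.
by apply: int_eq => x _; ring.
Qed.

Lemma int_mul_le u v k e : sqi 0 1 u -> sqi 0 1 v -> 0 <= k -> 0 <= e ->
  nsq 0 1 u <= k ^+ 2 -> nsq 0 1 v <= e ^+ 2 ->
  `|\int[mu]_(x in `[0, 1]) (u x * v x)| <= k * e.
Proof.
move=> su sv k0 e0 uk ve.
rewrite -(ger0_norm (mulr_ge0 k0 e0)) -!sqrtr_sqr ler_wsqrtr//.
rewrite (le_trans (cauchy_schwarz su sv))// exprMn ler_pM ?nsq_ge0//.
Qed.

Lemma nsq_continuous (T : R) (v : R -> R -> R) :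
  (forall t, 0 <= t <= T -> sqi 0 1 (v t)) ->
  (forall t, 0 <= t <= T ->
     l2_small (within `[0, T] (nbhs t)) (fun s x => v s x - v t x)) ->
  {within `[0, T], continuous (fun t => nsq 0 1 (v t))}.
Proof.
move=> sv H; apply/within_continuousP => t; rewrite /= in_itv/= => tT e e0.
pose k := Num.sqrt (nsq 0 1 (v t)).
have k0 : 0 <= k by exact: sqrtr_ge0.
pose d := Num.min 1 (e / (2 * (2 * k + 1))).
have K0 : 0 < 2 * (2 * k + 1) by rewrite mulr_gt0// ltr_wpDl// mulr_ge0.
have d0 : 0 < d by rewrite lt_min ltr01 divr_gt0.
have d1 : d <= 1 by rewrite ge_min lexx.
have de : d * (2 * (2 * k + 1)) <= e by rewrite -ler_pdivlMr// ge_min lexx orbT.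
have dd0 : 0 < d ^+ 2 by rewrite exprn_gt0.
have /near_within_eps[d' d'0 dP] := H t tT _ dd0.
exists d' => // s; rewrite /= in_itv/= => sT st.
have [|sq nq] := dP s _ st; first by rewrite /= in_itv.
rewrite (@eq_nsq _ _ _ (v s) (fun x => v t x + (v s x - v t x))); last by move=> x _; ring.
rewrite (nsq_perturb (sv t tT) sq).
have B : `|\int[mu]_(x in `[0, 1]) (v t x * (v s x - v t x))| <= k * d.
  by apply: int_mul_le => //; [exact: sv|exact: ltW|rewrite sqr_sqrtr ?nsq_ge0].
have n0 := nsq_ge0 0 1 (fun x => v s x - v t x).
move: B; rewrite ler_norml => /andP[B1 B2].
have dd : d ^+ 2 <= d by rewrite expr2 ler_piMr// ltW.
have : 2 * (k * d) + d < e.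
  have kd0 : 0 <= k * d by rewrite mulr_ge0// ltW.
  by apply: lt_le_trans de; lra.
by move=> ?; rewrite ltr_norml; apply/andP; split; lra.
Qed.

(** The square is expanded around [u t] with increment [h * (w + q)], where [q] is the error of the
    difference quotient. The first-order term is twice the scalar product with [w]; what remains is
    [h] times a quantity that tends to zero. *)
Lemma nsq_derivative (T t : R) (u : R -> R -> R) w : 0 < t < T ->
  (forall s, 0 <= s <= T -> sqi 0 1 (u s)) -> l2_derivative u t w ->
  is_derive t 1 (fun s => nsq 0 1 (u s)) (2 * \int[mu]_(x in `[0, 1]) (u t x * w x)).
Proof.
move=> tT su [sw H].
have tT' : 0 <= t <= T by move: tT => /andP[/ltW -> /ltW ->].
apply/is_derive_eps => e e0.
pose k := Num.sqrt (nsq 0 1 (u t)).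
have k0 : 0 <= k by exact: sqrtr_ge0.
have k1 : 0 < 4 * (k + 1) by rewrite mulr_gt0// ltr_wpDl.
pose d := e / (4 * (k + 1)); have d0 : 0 < d by rewrite divr_gt0.
have dk : 2 * (k * d) <= e / 2.
  have -> : e / 2 = 2 * ((k + 1) * d) by rewrite /d; field; rewrite gt_eqF// ltr_wpDl.
  by rewrite ler_wpM2l// ler_wpM2r ?(ltW d0)// lerDl.
have dd0 : 0 < d ^+ 2 by rewrite exprn_gt0.
pose W := 2 * nsq 0 1 w + 2 * d ^+ 2.
have W0 : 0 < W by rewrite ltr_wpDl ?mulr_ge0 ?nsq_ge0// mulr_gt0.
have /near_dnbhs_eps[d1 d10 d1P] := H _ dd0.
have /near_dnbhs_eps[d2 d20 d2P] := near_shift tT.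
exists (Num.min (Num.min d1 d2) (e / (2 * W))).
  by rewrite !lt_min d10 d20 divr_gt0// mulr_gt0.
move=> h; rewrite !lt_min => /andP[/andP[hd1 hd2] hW].
have [->|h0] := eqVneq h 0; first by rewrite addr0 mul0r !subrr normr0 mulr0.
have [|sq nq] := d1P h h0; first by rewrite subr0.
have hT : 0 <= t + h <= T by apply: d2P; rewrite ?subr0.
set q := fun x => h^-1 * (u (t + h) x - u t x) - w x in sq nq.
have swq := sqiD sw sq.
rewrite (@eq_nsq _ _ _ (u (t + h)) (fun x => u t x + h * (w x + q x))); last first.
  by move=> x _; rewrite /q; field.
rewrite (nsq_perturb (su t tT') (sqiZ h swq)) nsqZ//.
have -> : \int[mu]_(x in `[0, 1]) (u t x * (h * (w x + q x))) =
    h * (\int[mu]_(x in `[0, 1]) (u t x * w x) + \int[mu]_(x in `[0, 1]) (u t x * q x)).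
  have iw := sqi_mul (su t tT') sw; have iq := sqi_mul (su t tT') sq.
  rewrite -RintegralD// -RintegralZl//; last exact: itgD.
  by apply: int_eq => x _; ring.
have B : `|\int[mu]_(x in `[0, 1]) (u t x * q x)| <= k * d.
  by apply: int_mul_le => //; [exact: su|exact: ltW|rewrite sqr_sqrtr ?nsq_ge0].
set A := \int[mu]_(x in `[0, 1]) (u t x * w x); set B' := \int[mu]_(x in _) _ in B *.
set N := nsq 0 1 (fun x => w x + q x).
have N0 : 0 <= N by exact: nsq_ge0.
have NW : N <= W by rewrite (le_trans (nsqD sw sq))// /W lerD2l ler_wpM2l.
have -> : nsq 0 1 (u t) + 2 * (h * (A + B')) + h ^+ 2 * N - nsq 0 1 (u t) - h * (2 * A) =
  h * (2 * B' + h * N) by ring.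
rewrite normrM mulrC ler_wpM2r// (le_trans (ler_normD _ _))// [leRHS]splitr lerD//.
  by rewrite normrM ger0_norm// (le_trans _ dk)// ler_wpM2l.
rewrite normrM (ger0_norm N0) (@le_trans _ _ (e / (2 * W) * W))//.
  by rewrite ler_pM// ltW.
by rewrite le_eqVlt; apply/orP; left; apply/eqP; field; rewrite gt_eqF.
Qed.

Lemma ac_nsq_eq0 u v : ac 0 1 u v -> nsq 0 1 u = 0 -> forall x, 0 <= x <= 1 -> u x = 0.
Proof.
move=> A n0; have cu := ac_continuous A.
pose U := (fun x => u x ^+ 2) \o clamp 0 1.
have cU : continuous U.
  have := continuous_clamp ler01 cu => cUc x.
  by apply: (@continuous_comp _ _ _ (u \o clamp 0 1) (fun z : R => z ^+ 2));
    [exact: cUc|exact: exprn_continuous].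
have U0 y : 0 <= U y by exact: sqr_ge0.
have IU : \int[mu]_(y in `[0, 1]) U y = 0.
  rewrite -[RHS]n0; apply: int_eq => y /=; rewrite in_itv/= => y01.
  by rewrite /U /= clamp_id.
have inner y : 0 < y < 1 -> u y = 0.
  move=> y01; have := int_continuous_eq0 cU U0 IU y01.
  rewrite /U /= clamp_id; last by move: y01 => /andP[/ltW -> /ltW ->].
  by move/eqP; rewrite sqrf_eq0 => /eqP.
move=> x x01; apply/eqP; rewrite -normr_le0; apply/ler_addgt0Pr => e e0; rewrite add0r.
have /within_continuousP/(_ x) := cu; rewrite /= in_itv/= => /(_ x01 _ e0)[d d0 dP].
pose k := Num.min (d / 2) (1 / 4).
have k0 : 0 < k by rewrite lt_min !divr_gt0.
have kd : k <= d / 2 by rewrite ge_min lexx.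
have k4 : k <= 1 / 4 by rewrite ge_min lexx orbT.
pose y := if x < 1 / 2 then x + k else x - k.
have y01 : 0 < y < 1 by move: x01 => /andP[? ?]; rewrite /y; case: (ltP x (1 / 2)) => ?; apply/andP; split; lra.
have yx : `|y - x| < d.
  by rewrite /y; case: (ltP x (1 / 2)) => _; rewrite ltr_norml; apply/andP; split; lra.
have := dP y _ yx; rewrite /= in_itv/= inner// sub0r normrN => H.
by rewrite ltW// H//; move: y01 => /andP[/ltW -> /ltW ->].
Qed.

(** The Sobolev embedding with explicit constants: [u x ^+ 2 <= 2 * u y ^+ 2 + 2 * (u x - u y) ^+ 2]
    is averaged over [y]. *)
Lemma ac_sup_bound u v x : ac 0 1 u v -> sqi 0 1 v -> 0 <= x <= 1 ->
  u x ^+ 2 <= 2 * nsq 0 1 u + 2 * nsq 0 1 v.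
Proof.
move=> A sv x01; have su : sqi 0 1 u by exact/sqi_within/(ac_continuous A).
have -> : u x ^+ 2 = \int[mu]_(y in `[0, 1]) (u x ^+ 2) by rewrite int_cst//; ring.
rewrite -[2 * nsq _ _ v](_ : \int[mu]_(y in `[0, 1]) (2 * nsq 0 1 v) = _); last first.
  by rewrite int_cst//; ring.
rewrite /nsq -RintegralZl//; last by case: su.
rewrite -/(nsq 0 1 v) -RintegralD//; [|apply: itgZ => //; by case: su|exact: itg_cst].
apply: int_le => //; first exact: itg_cst.
  by apply: itgD => //; [apply: itgZ => //; case: su|exact: itg_cst].
move=> y /=; rewrite in_itv/= => y01; have := ac_hoelder A sv x01 y01.
have xy1 : `|x - y| <= 1.
  by move: x01 y01 => /andP[? ?] /andP[? ?]; rewrite ler_norml; apply/andP; split; lra.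
have : `|x - y| * nsq 0 1 v <= nsq 0 1 v by rewrite ler_piMl// nsq_ge0.
have := sqr_ge0 (u x - 2 * u y); have := nsq_ge0 0 1 v; move: (nsq 0 1 v) => V.
by nra.
Qed.

(** A Poincare inequality in the supremum norm, under either normalisation of [f]: mean zero in the
    periodic case, a zero at the left end in the Dirichlet case. *)
Lemma ac_sub_mean u v x : ac 0 1 u v -> sqi 0 1 v -> 0 <= x <= 1 ->
  \int[mu]_(y in `[0, 1]) u y = 0 \/ u 0 = 0 -> u x ^+ 2 <= nsq 0 1 v.
Proof.
move=> A sv x01 H.
have le1 y : 0 <= y <= 1 -> (u x - u y) ^+ 2 <= nsq 0 1 v.
  move=> y01; rewrite (le_trans (ac_hoelder A sv x01 y01))// ler_piMl ?nsq_ge0//.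
  by move: x01 y01 => /andP[? ?] /andP[? ?]; rewrite ler_norml; apply/andP; split; lra.
case: H => [m0|u0]; last by have := le1 0; rewrite u0 subr0 lexx ler01; exact.
have su : sqi 0 1 u by exact/sqi_within/(ac_continuous A).
have sxu : sqi 0 1 (fun y => u x - u y) by apply: sqiB => //; exact: sqi_cst.
have -> : u x = \int[mu]_(y in `[0, 1]) (u x - u y).
  rewrite RintegralB//; [|exact: itg_cst|exact: sqi_itg].
  by rewrite m0 int_cst// !subr0 mulr1.
rewrite (le_trans (int_sqr_le ler01 sxu))// subr0 mul1r.
have -> : nsq 0 1 v = \int[mu]_(y in `[0, 1]) nsq 0 1 v by rewrite int_cst//; ring.
apply: int_le; [by []|by case: sxu|exact: itg_cst|].
by move=> y /=; rewrite in_itv/=; exact: le1.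
Qed.

End EnergyMethod.

Section Uniqueness.
Context (R : realType).
Local Notation mu := (@lebesgue_measure R).
Implicit Types (u v w g : R -> R) (t s x y : R).

Lemma H2_norm_small u v w (e : R) : sqi 0 1 u -> sqi 0 1 v -> sqi 0 1 w -> 0 < e ->
  `|H2_norm u v w| < e ->
  [/\ nsq 0 1 u < e ^+ 2, nsq 0 1 v < e ^+ 2 & nsq 0 1 w < e ^+ 2].
Proof.
move=> su sv sw e0; rewrite /H2_norm !L2_norm_sqr// ger0_norm ?sqrtr_ge0//.
rewrite -{1}(ger0_norm (ltW e0)) -sqrtr_sqr ltr_sqrt ?exprn_gt0//.
by have := nsq_ge0 0 1 u; have := nsq_ge0 0 1 v; have := nsq_ge0 0 1 w; split; lra.
Qed.

Lemma H1_norm_small u v (e : R) : sqi 0 1 u -> sqi 0 1 v -> 0 < e ->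
  `|H1_norm u v| < e -> nsq 0 1 u < e ^+ 2 /\ nsq 0 1 v < e ^+ 2.
Proof.
move=> su sv e0; rewrite /H1_norm !L2_norm_sqr// ger0_norm ?sqrtr_ge0//.
rewrite -{1}(ger0_norm (ltW e0)) -sqrtr_sqr ltr_sqrt ?exprn_gt0//.
by have := nsq_ge0 0 1 u; have := nsq_ge0 0 1 v; split; lra.
Qed.

(** What the energy estimate uses of a solution, with bounds uniform in time. The nonlocal term is
    kept only as some constant [I] in [x]: it will be integrated against a difference of two [f_x],
    which has mean zero. *)
Record solution_view bc (T : R) (f fx fxx rho rhox : R -> R -> R) : Prop := SolutionView {
  sv_f : forall t, 0 <= t <= T -> ac 0 1 (f t) (fx t);
  sv_fx : forall t, 0 <= t <= T -> ac 0 1 (fx t) (fxx t);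
  sv_fxx : forall t, 0 <= t <= T -> sqi 0 1 (fxx t);
  sv_rho : forall t, 0 <= t <= T -> ac 0 1 (rho t) (rhox t);
  sv_rhox : forall t, 0 <= t <= T -> sqi 0 1 (rhox t);
  sv_fx_small : forall t, 0 <= t <= T ->
    l2_small (within `[0, T] (nbhs t)) (fun s x => fx s x - fx t x);
  sv_rho_small : forall t, 0 <= t <= T ->
    l2_small (within `[0, T] (nbhs t)) (fun s x => rho s x - rho t x);
  sv_bounds : exists2 B, 0 <= B & forall t, 0 <= t <= T ->
    [/\ nsq 0 1 (fxx t) <= B, nsq 0 1 (rhox t) <= B,
        forall x, 0 <= x <= 1 -> `|fx t x| <= B &
        forall x, 0 <= x <= 1 -> `|rho t x| <= B];
  sv_boundary : forall t, 0 <= t <= T -> boundary_conditions bc (f t) (fx t) (rho t);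
  sv_fxt : forall t, 0 < t < T -> exists I,
    l2_derivative fx t (fun x => - (f t x * fxx t x) + fx t x ^+ 2 - rho t x + I);
  sv_rhot : forall t, 0 < t < T ->
    l2_derivative rho t (fun x => - (f t x * rhox t x) + rho t x * fx t x) }.

Lemma solutionP bc (f0 rho0 : R -> R) (T : R) f fx fxx rho rhox :
  solution bc f0 rho0 T f fx fxx rho rhox -> solution_view bc T f fx fxx rho rhox.
Proof.
case=> Hf Cf _ _ Hr Cr Hb _ Ef Er.
have Hf' t (tT : 0 <= t <= T) : ac 0 1 (f t) (fx t) /\ ac 0 1 (fx t) (fxx t) /\ sqi 0 1 (fxx t).
  by have [|/H1P[A1 s1] /H1P[A2 s2]] := Hf t; [rewrite in_itv|].
have Hr' t (tT : 0 <= t <= T) : ac 0 1 (rho t) (rhox t) /\ sqi 0 1 (rhox t).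
  by apply/H1P/Hr; rewrite in_itv.
have sq u v : ac 0 1 u v -> sqi 0 1 u by move=> /ac_continuous/sqi_within.
have sf t (tT : 0 <= t <= T) : sqi 0 1 (f t) by have [/sq] := Hf' t tT.
have sfx t (tT : 0 <= t <= T) : sqi 0 1 (fx t) by have [_ [/sq]] := Hf' t tT.
have sfxx t (tT : 0 <= t <= T) : sqi 0 1 (fxx t) by have [_ []] := Hf' t tT.
have sr t (tT : 0 <= t <= T) : sqi 0 1 (rho t) by have [/sq] := Hr' t tT.
have srx t (tT : 0 <= t <= T) : sqi 0 1 (rhox t) by have [] := Hr' t tT.
have small_f t (tT : 0 <= t <= T) (e : R) (e0 : 0 < e) :
  \forall s \near within `[0, T] (nbhs t),
    nsq 0 1 (fun x => fx s x - fx t x) <= e /\ nsq 0 1 (fun x => fxx s x - fxx t x) <= e.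
  have se : 0 < Num.sqrt e by rewrite sqrtr_gt0.
  have H := (vanishes_on_diagonalP _ _).1 Cf t tT _ se.
  near=> s; have sT : 0 <= s <= T by near: s; exact: near_at_time.
  have : `|H2_norm (f s \- f t) (fx s \- fx t) (fxx s \- fxx t)| < Num.sqrt e by near: s.
  move=> /H2_norm_small[]//; try by apply: sqiB; auto.
  by rewrite sqr_sqrtr ?(ltW e0)// => _ /ltW ? /ltW.
have small_r t (tT : 0 <= t <= T) (e : R) (e0 : 0 < e) :
  \forall s \near within `[0, T] (nbhs t),
    nsq 0 1 (fun x => rho s x - rho t x) <= e /\ nsq 0 1 (fun x => rhox s x - rhox t x) <= e.
  have se : 0 < Num.sqrt e by rewrite sqrtr_gt0.
  have H := (vanishes_on_diagonalP _ _).1 Cr t tT _ se.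
  near=> s; have sT : 0 <= s <= T by near: s; exact: near_at_time.
  have : `|H1_norm (rho s \- rho t) (rhox s \- rhox t)| < Num.sqrt e by near: s.
  move=> /H1_norm_small[]//; try by apply: sqiB; auto.
  by rewrite sqr_sqrtr ?(ltW e0)// => /ltW ? /ltW.
have mk (u : R -> R -> R) : (forall t, 0 <= t <= T -> sqi 0 1 (u t)) ->
    (forall t, 0 <= t <= T -> forall e : R, 0 < e -> \forall s \near within `[0, T] (nbhs t),
      nsq 0 1 (fun x => u s x - u t x) <= e) -> forall t, 0 <= t <= T ->
    l2_small (within `[0, T] (nbhs t)) (fun s x => u s x - u t x).
  move=> su nu t tT e e0; near=> s.
  have sT : 0 <= s <= T by near: s; exact: near_at_time.
  by split; [apply: sqiB; auto|near: s; exact: nu].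
have lf : forall t, 0 <= t <= T ->
    l2_small (within `[0, T] (nbhs t)) (fun s x => fx s x - fx t x).
  by apply: mk sfx _ => t tT e e0; apply: filterS (small_f t tT e e0) => s [].
have lfx : forall t, 0 <= t <= T ->
    l2_small (within `[0, T] (nbhs t)) (fun s x => fxx s x - fxx t x).
  by apply: mk sfxx _ => t tT e e0; apply: filterS (small_f t tT e e0) => s [].
have lr : forall t, 0 <= t <= T ->
    l2_small (within `[0, T] (nbhs t)) (fun s x => rho s x - rho t x).
  by apply: mk sr _ => t tT e e0; apply: filterS (small_r t tT e e0) => s [].
have lrx : forall t, 0 <= t <= T ->
    l2_small (within `[0, T] (nbhs t)) (fun s x => rhox s x - rhox t x).
  by apply: mk srx _ => t tT e e0; apply: filterS (small_r t tT e e0) => s [].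
have cprod u v w : ac 0 1 u v -> sqi 0 1 w -> sqi 0 1 (fun x => u x * w x).
  by move=> /ac_continuous; exact: sqiM_continuous.
split => //.
- by move=> t /Hf'[].
- by move=> t /Hf'[_ []].
- by move=> t /Hr'[].
(* The squared norms are continuous on the compact time interval, hence bounded; [ac_sup_bound]
   converts them into bounds of [fx] and [rho]. The summand 1 in [B] lets [a ^+ 2 <= B - 1] imply
   [|a| <= B]. *)
- have [k1 k10 fk1] := within_continuous_bounded (nsq_continuous sfx lf).
  have [k2 k20 fk2] := within_continuous_bounded (nsq_continuous sfxx lfx).
  have [k3 k30 fk3] := within_continuous_bounded (nsq_continuous sr lr).
  have [k4 k40 fk4] := within_continuous_bounded (nsq_continuous srx lrx).
  pose B := 1 + 2 * (k1 + k2 + k3 + k4).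
  have abs_le (a : R) : a ^+ 2 <= B - 1 -> `|a| <= B.
    move=> aB; have B1 : 1 <= B by rewrite /B; lra.
    rewrite -ler_sqr ?nnegrE ?(le_trans _ B1)// real_normK ?num_real//.
    by move: aB B1; nra.
  exists B; first by rewrite /B; lra.
  move=> t tT; have := fk1 t tT; have := fk2 t tT; have := fk3 t tT; have := fk4 t tT.
  rewrite !(ger0_norm (nsq_ge0 _ _ _)) => h4 h3 h2 h1.
  split; [rewrite /B; lra|rewrite /B; lra|move=> x x01|move=> x x01]; apply: abs_le.
    have [_ [A s]] := Hf' t tT; have := ac_sup_bound A s x01; rewrite /B; lra.
  have [A s] := Hr' t tT; have := ac_sup_bound A s x01; rewrite /B; lra.
- move=> t tT; have tT' : 0 <= t <= T by move: tT => /andP[/ltW -> /ltW ->].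
  have [|w /(L2_time_derivativeP _ tT sfx) dw aw] := Ef t; first by rewrite in_itv.
  exists (nonlocal (fx t) (rho t)); apply: (l2_derivative_ae tT sfx _ _ dw).
    have [A1 [A2 s]] := Hf' t tT'.
    apply: sqiD; last exact: sqi_cst.
    apply: sqiB; last exact: sr.
    apply: sqiD; first exact/sqiN/(cprod _ _ _ A1).
    by apply: eq_sqi (cprod _ _ _ A2 (sfx t tT')) => x _; rewrite expr2.
  case: aw => N [mN N0 sN]; exists N; split => // x /= H; apply: sN => /= uv; apply: H.
  by move=> /uv <-; ring.
- move=> t tT; have tT' : 0 <= t <= T by move: tT => /andP[/ltW -> /ltW ->].
  have [|w /(L2_time_derivativeP _ tT sr) dw aw] := Er t; first by rewrite in_itv.
  apply: (l2_derivative_ae tT sr _ _ dw).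
    have [A1 [A2 s]] := Hf' t tT'; have [A3 s3] := Hr' t tT'.
    by apply: sqiD; [exact/sqiN/(cprod _ _ _ A1)|exact: cprod A3 (sfx t tT')].
  case: aw => N [mN N0 sN]; exists N; split => // x /= H; apply: sN => /= uv; apply: H.
  by move=> /uv <-; ring.
Unshelve. all: by end_near. Qed.

(** * The energy estimate for the difference of two solutions *)

Section TwoSolutions.
Variables (bc : boundary_kind) (T : R).
Variables (f fx fxx rho rhox g gx gxx sigma sigmax : R -> R -> R).
Hypothesis vf : solution_view bc T f fx fxx rho rhox.
Hypothesis vg : solution_view bc T g gx gxx sigma sigmax.

Let del t x := fx t x - gx t x.
Let r t x := rho t x - sigma t x.

Let ac_fg t : 0 <= t <= T -> ac 0 1 (fun x => f t x - g t x) (del t).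
Proof.
move=> tT; apply: eq_ac (acD (sv_f vf tT) (acZ (-1) (sv_f vg tT))) => x _; rewrite /del; ring.
Qed.

Let ac_del t : 0 <= t <= T -> ac 0 1 (del t) (fun x => fxx t x - gxx t x).
Proof.
move=> tT; apply: eq_ac (acD (sv_fx vf tT) (acZ (-1) (sv_fx vg tT))) => x _; rewrite /del; ring.
Qed.

Let ac_r t : 0 <= t <= T -> ac 0 1 (r t) (fun x => rhox t x - sigmax t x).
Proof.
move=> tT; apply: eq_ac (acD (sv_rho vf tT) (acZ (-1) (sv_rho vg tT))) => x _; rewrite /r; ring.
Qed.

Let sq_del t : 0 <= t <= T -> sqi 0 1 (del t).
Proof. by move=> /ac_del/ac_continuous/sqi_within. Qed.

Let sq_r t : 0 <= t <= T -> sqi 0 1 (r t).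
Proof. by move=> /ac_r/ac_continuous/sqi_within. Qed.

Let fg_le t x : 0 <= t <= T -> 0 <= x <= 1 -> (f t x - g t x) ^+ 2 <= nsq 0 1 (del t).
Proof.
move=> tT x01; apply: ac_sub_mean (ac_fg tT) (sq_del tT) x01 _.
have := sv_boundary vf tT; have := sv_boundary vg tT; rewrite /boundary_conditions.
have itgf h hx : ac 0 1 h hx -> itg `[0, 1] h by move=> /ac_continuous/itg_cont.
case: bc => [[-> _ _ _] [-> _ _ _]|[_ _ _ mg] [_ _ _ mf]]; [by right; rewrite subrr|left].
rewrite RintegralB//; [|exact: itgf (sv_f vf tT)|exact: itgf (sv_f vg tT)].
by rewrite mf mg subrr.
Qed.

Let int_del t : 0 <= t <= T -> \int[mu]_(x in `[0, 1]) del t x = 0.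
Proof.
move=> tT; have [_ /(_ 0 1) <-//] := ac_fg tT.
have := sv_boundary vf tT; have := sv_boundary vg tT; rewrite /boundary_conditions.
by case: bc => [[-> -> _ _] [-> -> _ _]|[-> _ _ _] [-> _ _ _]]; rewrite !subrr.
Qed.

(* the transport term: [2 f u u_x = (f u^2)_x - f_x u^2], and [f u^2] has equal
   values at the endpoints *)
Let int_transport t u ux : 0 <= t <= T -> ac 0 1 u ux -> sqi 0 1 ux ->
  f t 1 * u 1 ^+ 2 = f t 0 * u 0 ^+ 2 ->
  \int[mu]_(x in `[0, 1]) (2 * (f t x * (u x * ux x))) =
  - \int[mu]_(x in `[0, 1]) (fx t x * u x ^+ 2).
Proof.
move=> tT A su end_; have Af := sv_f vf tT.
have [_ /(_ 0 1 (lexx _) ler01 (lexx _))] := acM Af (acM A A).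
rewrite -!expr2 end_ subrr => /esym.
have cu := ac_continuous A; have cfl := ac_continuous Af.
have sfu : sqi 0 1 (fun x => f t x * u x).
  by apply: sqiM_continuous cfl _; exact: sqi_within.
have sfxu : sqi 0 1 (fun x => u x * fx t x).
  by apply: sqiM_continuous cu _; apply/sqi_within/(ac_continuous (sv_fx vf tT)).
have i1 : itg `[0, 1] (fun x => fx t x * u x ^+ 2).
  by apply: eq_itg (sqi_mul sfxu (sqi_within cu)) => // x _; ring.
have i2 : itg `[0, 1] (fun x => 2 * (f t x * (u x * ux x))).
  by apply: itgZ => //; apply: eq_itg (sqi_mul sfu su) => // x _; ring.
rewrite (@int_eq _ _ _ (fun x => fx t x * u x ^+ 2 + 2 * (f t x * (u x * ux x)))); last first.
  by move=> x _; ring.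
by rewrite RintegralD// => /eqP; rewrite addrC addr_eq0 => /eqP.
Qed.

Let energy t := nsq 0 1 (del t) + nsq 0 1 (r t).

(** No derivative is lost. Transport by [f] integrates to terms without derivatives; the constant
    [I - I'] is orthogonal to [del]; and where [f - g] multiplies [gxx] or [sigmax], its supremum is
    controlled by the norm of [del] while the other factor has squared norm at most [B]. The
    remaining terms are of order zero with bounded coefficients. *)
Let energy_derivative B t : 0 < t < T -> 0 <= B ->
  [/\ nsq 0 1 (gxx t) <= B, nsq 0 1 (sigmax t) <= B,
      forall x, 0 <= x <= 1 -> `|fx t x| <= B,
      forall x, 0 <= x <= 1 -> `|gx t x| <= B &
      forall x, 0 <= x <= 1 -> `|sigma t x| <= B] ->
  exists2 E', is_derive t 1 energy E' & E' <= (8 * B + 2) * energy t.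
Proof.
move=> tT B0 [gxxB sigmaxB fxB gxB sigmaB].
have tT' : 0 <= t <= T by move: tT => /andP[/ltW -> /ltW ->].
have [I fxt] := sv_fxt vf tT; have [I' gxt] := sv_fxt vg tT.
have ddel := l2_derivativeB fxt gxt.
have dr := l2_derivativeB (sv_rhot vf tT) (sv_rhot vg tT).
have D1 := nsq_derivative tT sq_del ddel; have D2 := nsq_derivative tT sq_r dr.
have D := is_deriveD D1 D2; eexists; first exact: D.
have Adel := ac_del tT'; have Ar := ac_r tT'.
have cdel := ac_continuous Adel; have cr := ac_continuous Ar.
have cf := ac_continuous (sv_f vf tT'); have cg := ac_continuous (sv_f vg tT').
have cfx := ac_continuous (sv_fx vf tT'); have cgx := ac_continuous (sv_fx vg tT').
have cs := ac_continuous (sv_rho vg tT').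
have sdelx : sqi 0 1 (fun x => fxx t x - gxx t x).
  by apply: sqiB; [exact: sv_fxx vf _ tT'|exact: sv_fxx vg _ tT'].
have srx : sqi 0 1 (fun x => rhox t x - sigmax t x).
  by apply: sqiB; [exact: sv_rhox vf _ tT'|exact: sv_rhox vg _ tT'].
have bf := sv_boundary vf tT'; have bg := sv_boundary vg tT'.
have T1 := int_transport tT' Adel sdelx; have T2 := int_transport tT' Ar srx.
have {}T1 : \int[mu]_(x in `[0, 1]) (2 * (f t x * (del t x * (fxx t x - gxx t x)))) =
    - \int[mu]_(x in `[0, 1]) (fx t x * del t x ^+ 2).
  apply: T1; move: bf bg; rewrite /boundary_conditions /del.
  by case: bc => [[-> -> _ _] _|[-> -> _ _] [_ -> _ _]]; rewrite ?mul0r.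
have {}T2 : \int[mu]_(x in `[0, 1]) (2 * (f t x * (r t x * (rhox t x - sigmax t x)))) =
    - \int[mu]_(x in `[0, 1]) (fx t x * r t x ^+ 2).
  apply: T2; move: bf bg; rewrite /boundary_conditions /r.
  by case: bc => [[-> -> _ _] _|[-> _ -> _] [_ _ -> _]]; rewrite ?mul0r.
set d := nsq 0 1 (del t); have d0 : 0 <= d by exact: nsq_ge0.
have mD : @measurable _ (measurableTypeR R) `[0, 1]%classic by exact: measurable_itv.
have sdel := sq_del tT'; have sr := sq_r tT'.
have [_ i_del2] := sdel; have [_ i_r2] := sr.
have prod_int u w : {within `[0, 1], continuous u} -> sqi 0 1 w ->
    itg `[0, 1] (fun x => u x * w x).
  by move=> /sqi_within; exact: sqi_mul.
have sc u w : {within `[0, 1], continuous u} -> sqi 0 1 w -> sqi 0 1 (fun x => u x * w x).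
  exact: sqiM_continuous.
have sgxx := sv_fxx vg tT'; have ssx := sv_rhox vg tT'.
have i_fd : itg `[0, 1] (fun x => fx t x * del t x ^+ 2).
  by apply: eq_itg (sqi_mul (sc _ _ cfx sdel) sdel) => // x _; ring.
have i_fr : itg `[0, 1] (fun x => fx t x * r t x ^+ 2).
  by apply: eq_itg (sqi_mul (sc _ _ cfx sr) sr) => // x _; ring.
have i_td : itg `[0, 1] (fun x => 2 * (f t x * (del t x * (fxx t x - gxx t x)))).
  by apply: itgZ => //; apply: eq_itg (sqi_mul (sc _ _ cf sdel) sdelx) => // x _; ring.
have i_tr : itg `[0, 1] (fun x => 2 * (f t x * (r t x * (rhox t x - sigmax t x)))).
  by apply: itgZ => //; apply: eq_itg (sqi_mul (sc _ _ cf sr) srx) => // x _; ring.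
(* What is left of [2 del del_t + 2 r r_t] once the transport by [f] and the constant [I - I'] are
   removed. *)
pose q x := - 2 * (f t x - g t x) * gxx t x * del t x
  + 2 * (fx t x + gx t x) * del t x ^+ 2 - 2 * r t x * del t x
  - 2 * (f t x - g t x) * sigmax t x * r t x
  + 2 * fx t x * r t x ^+ 2 + 2 * sigma t x * del t x * r t x.
(* At each point [(f - g)^2] is at most [d]; the products with [gxx] and [sigmax] are split by
   Young's inequality, and [d] then multiplies integrals that are at most [B]. *)
pose major x := (6 * B + 2) * del t x ^+ 2 + (4 * B + 2) * r t x ^+ 2
  + d * gxx t x ^+ 2 + d * sigmax t x ^+ 2.
have cfg := ac_continuous (ac_fg tT').
have iq : itg `[0, 1] q.
  have j1 : itg `[0, 1] (fun x => -2 * (((f t x - g t x) * gxx t x) * del t x)).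
    by apply: itgZ => //; apply: sqi_mul => //; exact: sc.
  have j2 : itg `[0, 1] (fun x => 2 * ((fx t x * del t x) * del t x)).
    by apply: itgZ => //; apply: sqi_mul => //; exact: sc.
  have j3 : itg `[0, 1] (fun x => 2 * ((gx t x * del t x) * del t x)).
    by apply: itgZ => //; apply: sqi_mul => //; exact: sc.
  have j4 : itg `[0, 1] (fun x => -2 * (r t x * del t x)).
    by apply: itgZ => //; apply: sqi_mul.
  have j5 : itg `[0, 1] (fun x => -2 * (((f t x - g t x) * sigmax t x) * r t x)).
    by apply: itgZ => //; apply: sqi_mul => //; exact: sc.
  have j6 : itg `[0, 1] (fun x => 2 * ((fx t x * r t x) * r t x)).
    by apply: itgZ => //; apply: sqi_mul => //; exact: sc.
  have j7 : itg `[0, 1] (fun x => 2 * ((sigma t x * del t x) * r t x)).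
    by apply: itgZ => //; apply: sqi_mul => //; exact: sc.
  have := itgD mD (itgD mD (itgD mD j1 j2) (itgD mD j3 j4)) (itgD mD (itgD mD j5 j6) j7).
  by apply: eq_itg => // x _; rewrite /q; ring.
have imajor : itg `[0, 1] major.
  apply: itgD => //; last by apply: itgZ => //; case: ssx.
  apply: itgD => //; last by apply: itgZ => //; case: sgxx.
  by apply: itgD => //; exact: itgZ.
have q_le x : `[0, 1]%classic x ->
    fx t x * del t x ^+ 2 + fx t x * r t x ^+ 2 + q x <= major x.
  rewrite /= in_itv/= => x01.
  have := fg_le tT' x01; rewrite -/d => fg2.
  have := fxB x x01; have := gxB x x01; have := sigmaB x x01.
  rewrite !ler_norml /q /major; set D' := del t x; set r' := r t x; set k := f t x - g t x.
  move=> /andP[s1 s2] /andP[g1 g2] /andP[f1 f2].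
  have Dsq := sqr_ge0 D'; have rsq := sqr_ge0 r'.
  have p1 : - 2 * k * gxx t x * D' <= d * gxx t x ^+ 2 + D' ^+ 2.
    have := sqr_ge0 (k * gxx t x + D'); have := sqr_ge0 (gxx t x).
    by move: fg2; rewrite -/k; nra.
  have p2 : - 2 * k * sigmax t x * r' <= d * sigmax t x ^+ 2 + r' ^+ 2.
    have := sqr_ge0 (k * sigmax t x + r'); have := sqr_ge0 (sigmax t x).
    by move: fg2; rewrite -/k; nra.
  have p3 : 2 * sigma t x * D' * r' <= B * (D' ^+ 2 + r' ^+ 2).
    have := sqr_ge0 (D' + r'); have := sqr_ge0 (D' - r'); nra.
  have p4 : - 2 * r' * D' <= r' ^+ 2 + D' ^+ 2 by have := sqr_ge0 (D' + r'); nra.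
  have p5 : 3 * fx t x * D' ^+ 2 <= 3 * B * D' ^+ 2 by rewrite ler_wpM2r//; lra.
  have p6 : 2 * gx t x * D' ^+ 2 <= 2 * B * D' ^+ 2 by rewrite ler_wpM2r//; lra.
  have p7 : 3 * fx t x * r' ^+ 2 <= 3 * B * r' ^+ 2 by rewrite ler_wpM2r//; lra.
  lra.
have iw1 := sqi_mul sdel ddel.1; have iw2 := sqi_mul sr dr.1.
rewrite -!RintegralZl// -RintegralD//; [|exact: itgZ|exact: itgZ].
rewrite (@int_eq _ _ _ (fun x => - 1 * (2 * (f t x * (del t x * (fxx t x - gxx t x)))) +
    - 1 * (2 * (f t x * (r t x * (rhox t x - sigmax t x)))) + (q x + 2 * (I - I') * del t x)));
    last first.
  by move=> x _; rewrite /q /del /r; ring.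
have idel := sqi_itg sdel.
rewrite RintegralD//; [|by apply: itgD => //; exact: itgZ|by apply: itgD => //; exact: itgZ].
rewrite RintegralD//; [|exact: itgZ|exact: itgZ].
rewrite [X in _ + X]RintegralD//; last exact: itgZ.
rewrite (RintegralZl _ mD i_td) (RintegralZl _ mD i_tr) (RintegralZl _ mD idel).
rewrite int_del// mulr0 addr0 T1 T2 !mulN1r !opprK.
rewrite -RintegralD// -RintegralD//; last exact: itgD.
apply: (@le_trans _ _ (\int[mu]_(x in `[0, 1]) major x)).
  by apply: int_le => //; do 2 apply: itgD => //.
rewrite /major RintegralD//; last 2 first.
- apply: itgD => //; last by apply: itgZ => //; case: sgxx.
  by apply: itgD => //; exact: itgZ.
- by apply: itgZ => //; case: ssx.
rewrite RintegralD//; last 2 first.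
- by apply: itgD => //; exact: itgZ.
- by apply: itgZ => //; case: sgxx.
rewrite RintegralD//; [|exact: itgZ|exact: itgZ].
rewrite !RintegralZl//; [|by case: ssx|by case: sgxx].
rewrite -!/(nsq _ _ _) -/d /energy -/d.
set R' := nsq 0 1 (r t); have R0 : 0 <= R' by exact: nsq_ge0.
have h1 : d * nsq 0 1 (gxx t) <= d * B by rewrite ler_wpM2l.
have h2 : d * nsq 0 1 (sigmax t) <= d * B by rewrite ler_wpM2l.
have h3 : 0 <= B * d by rewrite mulr_ge0.
have h4 : 0 <= B * R' by rewrite mulr_ge0.
lra.
Qed.

Hypothesis f_init : forall x, 0 <= x <= 1 -> f 0 x = g 0 x.
Hypothesis rho_init : forall x, 0 <= x <= 1 -> rho 0 x = sigma 0 x.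

Let energy0 t : 0 <= t <= T -> energy t = 0.
Proof.
move=> tT; have T0 : 0 <= (0 : R) <= T by move: tT => /andP[t0 tT]; rewrite lexx (le_trans t0).
have [B1 B10 H1] := sv_bounds vf; have [B2 B20 H2] := sv_bounds vg.
pose B := B1 + B2; have B0 : 0 <= B by exact: addr_ge0.
have HB s : 0 <= s <= T -> [/\ nsq 0 1 (gxx s) <= B, nsq 0 1 (sigmax s) <= B,
      forall x, 0 <= x <= 1 -> `|fx s x| <= B,
      forall x, 0 <= x <= 1 -> `|gx s x| <= B &
      forall x, 0 <= x <= 1 -> `|sigma s x| <= B].
  move=> sT; have [_ _ b1 _] := H1 s sT; have [b2 b3 b4 b5] := H2 s sT.
  have B1B : B1 <= B by rewrite lerDl.
  have B2B : B2 <= B by rewrite lerDr.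
  split; rewrite ?(le_trans _ B2B)// => x x01.
  - exact: le_trans (b1 x x01) B1B.
  - exact: le_trans (b4 x x01) B2B.
  - exact: le_trans (b5 x x01) B2B.
have /choice[E' E'P] : forall s, exists E', 0 < s < T ->
    is_derive s 1 energy E' /\ E' <= (8 * B + 2) * energy s.
  move=> s; have [sT|] := boolP (0 < s < T); last by exists 0.
  have sT' : 0 <= s <= T by move: sT => /andP[/ltW -> /ltW ->].
  by have [E' dE E'le] := energy_derivative sT B0 (HB s sT'); exists E'.
have cE : {within `[0, T], continuous energy}.
  have l1 s (sT : 0 <= s <= T) : l2_small (within `[0, T] (nbhs s)) (fun z x => del z x - del s x).
    apply: eq_near_l2_small (l2_smallD (sv_fx_small vf sT) (l2_smallN (sv_fx_small vg sT))).
    by apply: nearW => z x _; rewrite /del; ring.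
  have l2 s (sT : 0 <= s <= T) : l2_small (within `[0, T] (nbhs s)) (fun z x => r z x - r s x).
    apply: eq_near_l2_small (l2_smallD (sv_rho_small vf sT) (l2_smallN (sv_rho_small vg sT))).
    by apply: nearW => z x _; rewrite /r; ring.
  have c1 := nsq_continuous sq_del l1; have c2 := nsq_continuous sq_r l2.
  by move=> x; have := continuousD (c1 x) (c2 x); apply.
have E0 : energy 0 = 0.
  have r0 : nsq 0 1 (r 0) = 0.
    rewrite (@eq_nsq _ _ _ _ (fun=> 0)); last by move=> x x01; rewrite /r rho_init// subrr.
    by rewrite /nsq int_cst// expr0n mul0r.
  (* At time 0 only [f = g] is given. The derivative of [(f - g) del] is [del^2 + (f - g) del_x]; as
     [f - g] vanishes, [del^2] has integral zero. *)
  have d0 : nsq 0 1 (del 0) = 0.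
    have [_ /(_ 0 1 (lexx _) ler01 (lexx _))] := acM (ac_fg T0) (ac_del T0).
    rewrite !f_init ?lexx ?ler01// !subrr !mul0r subrr => /esym H; rewrite -[RHS]H.
    apply: int_eq => x /=; rewrite in_itv/= => x01.
    by rewrite f_init// subrr mul0r addr0 expr2.
  by rewrite /energy d0 r0 addr0.
have := gronwall cE (fun s sT => (E'P s sT).1) (fun s sT => (E'P s sT).2) tT.
rewrite E0 mul0r => le0; apply/eqP; rewrite eq_le le0 addr_ge0//; exact: nsq_ge0.
Qed.

Lemma solution_unique t x : 0 <= t <= T -> 0 <= x <= 1 ->
  [/\ f t x = g t x, fx t x = gx t x & rho t x = sigma t x].
Proof.
move=> tT x01; have := energy0 tT; rewrite /energy => /eqP.
rewrite paddr_eq0 ?nsq_ge0// => /andP[/eqP d0 /eqP r0]; split.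
- have := fg_le tT x01; rewrite d0 => H; apply/eqP; rewrite -subr_eq0 -sqrf_eq0.
  by rewrite eq_le H sqr_ge0.
- by have := ac_nsq_eq0 (ac_del tT) d0 x01; rewrite /del => /eqP; rewrite subr_eq0 => /eqP.
- by have := ac_nsq_eq0 (ac_r tT) r0 x01; rewrite /r => /eqP; rewrite subr_eq0 => /eqP.
Qed.

End TwoSolutions.
End Uniqueness.

(** * The ordinary differential equation *)

Section BoundedLipschitz.
Context (R : realType).
Local Notation mu := (@lebesgue_measure R).
Implicit Types (g h : (nat -> R) -> R -> R) (u v : nat -> R) (x y : R).

Definition state_dist_le u v (d : R) := forall j, `|u j - v j| <= d.

(** All ingredients of the vector field lie in this class, stable under sums, products, integration
    in [x], and inverses of functions bounded below. The Lipschitz condition is uniform in [x], so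
    that it survives integration; continuity in [x] provides integrability. *)
Record bounded_lipschitz g : Prop := BoundedLipschitz {
  bl_bound : exists2 B, 0 <= B & forall u x, `|g u x| <= B;
  bl_lip : exists2 L, 0 <= L & forall u v d x, state_dist_le u v d ->
    `|g u x - g v x| <= L * d;
  bl_continuous : forall u, continuous (g u) }.

Lemma state_dist_ge0 u v d : state_dist_le u v d -> 0 <= d.
Proof. by move=> /(_ 0%N); apply: le_trans. Qed.

Lemma bl_fun (k : R -> R) A : continuous k -> (forall x, `|k x| <= A) ->
  bounded_lipschitz (fun _ => k).
Proof.
move=> ck kA; split=> //.
- by exists A => //; apply: le_trans (kA 0).
- by exists 0 => // u v d x _; rewrite subrr normr0 mul0r.
Qed.

Lemma bl_cst (k : R) : bounded_lipschitz (fun _ _ => k).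
Proof. by apply: (@bl_fun (fun=> k) `|k|) => // x; exact: cvg_cst. Qed.

Lemma blD g h : bounded_lipschitz g -> bounded_lipschitz h ->
  bounded_lipschitz (fun u x => g u x + h u x).
Proof.
move=> [[Bg Bg0 gB] [Lg Lg0 gL] gc] [[Bh Bh0 hB] [Lh Lh0 hL] hc]; split.
- exists (Bg + Bh); first exact: addr_ge0.
  by move=> u x; rewrite (le_trans (ler_normD _ _))// lerD.
- exists (Lg + Lh); first exact: addr_ge0.
  move=> u v d x uv; rewrite opprD addrACA (le_trans (ler_normD _ _))// mulrDl.
  by rewrite lerD ?gL ?hL.
- by move=> u x; apply: cvgD; [exact: gc|exact: hc].
Qed.

Lemma blM g h : bounded_lipschitz g -> bounded_lipschitz h ->
  bounded_lipschitz (fun u x => g u x * h u x).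
Proof.
move=> [[Bg Bg0 gB] [Lg Lg0 gL] gc] [[Bh Bh0 hB] [Lh Lh0 hL] hc]; split.
- exists (Bg * Bh); first exact: mulr_ge0.
  by move=> u x; rewrite normrM ler_pM.
- exists (Lg * Bh + Bg * Lh); first by rewrite addr_ge0// mulr_ge0.
  move=> u v d x uv.
  have -> : g u x * h u x - g v x * h v x =
    (g u x - g v x) * h u x + g v x * (h u x - h v x) by ring.
  rewrite (le_trans (ler_normD _ _))// [leRHS]mulrDl !normrM lerD//.
    by rewrite mulrAC ler_pM// gL.
  by rewrite -mulrA ler_pM// hL.
- by move=> u x; apply: cvgM; [exact: gc|exact: hc].
Qed.

Lemma blN g : bounded_lipschitz g -> bounded_lipschitz (fun u x => - g u x).
Proof.
move=> /(blM (bl_cst (-1))) [B L c]; split.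
- by case: B => B B0 gB; exists B => // u x; have := gB u x; rewrite mulN1r.
- by case: L => L L0 gL; exists L => // u v d x uv; have := gL u v d x uv; rewrite !mulN1r.
- by move=> u; have := c u; under eq_fun do rewrite mulN1r.
Qed.

Lemma blX g n : bounded_lipschitz g -> bounded_lipschitz (fun u x => g u x ^+ n).
Proof.
move=> bg; elim: n => [|n IH]; first exact: bl_cst.
by have := blM bg IH; under eq_fun do under eq_fun do rewrite -exprS.
Qed.

Lemma blV g m : 0 < m -> (forall u x, m <= g u x) -> bounded_lipschitz g ->
  bounded_lipschitz (fun u x => (g u x)^-1).
Proof.
move=> m0 mg [[B B0 gB] [L L0 gL] gc].
have g0 u x : 0 < g u x by exact: lt_le_trans (mg u x).
have gV u x : (g u x)^-1 <= m^-1 by rewrite lef_pV2 ?posrE.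
split.
- exists m^-1; first by rewrite invr_ge0 ltW.
  by move=> u x; rewrite gtr0_norm ?invr_gt0.
- exists (m^-1 * m^-1 * L); first by rewrite !mulr_ge0 ?invr_ge0 ?(ltW m0).
  move=> u v d x uv.
  have -> : (g u x)^-1 - (g v x)^-1 = - ((g u x)^-1 * (g v x)^-1 * (g u x - g v x)).
    by field; rewrite !gt_eqF.
  rewrite normrN normrM -[leRHS]mulrA ler_pM ?gL//.
  have gV0 w y : 0 <= (g w y)^-1 by rewrite invr_ge0 ltW.
  by rewrite ger0_norm ?mulr_ge0// ler_pM.
- move=> u x; apply: cvgV; first by rewrite gt_eqF.
  exact: gc.
Qed.

Lemma bl_clamp (k0 k1 k2 : R -> R) A i j l p q : 0 <= A ->
  continuous k0 -> continuous k1 -> continuous k2 ->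
  (forall x, `|k0 x| <= A) -> (forall x, `|k1 x| <= A) -> (forall x, `|k2 x| <= A) ->
  p <= q ->
  bounded_lipschitz (fun u x => clamp p q (k0 x * u i + k1 x * u j + k2 x * u l)).
Proof.
move=> A0 c0 c1 c2 b0 b1 b2 pq; split.
- exists (`|p| + `|q|); first exact: addr_ge0.
  move=> u x; have /andP[h1 h2] := clamp_itv (k0 x * u i + k1 x * u j + k2 x * u l) pq.
  rewrite ler_norml; have := ler_norm q; have := ler_norm (- p); rewrite normrN.
  by have := normr_ge0 p; have := normr_ge0 q => *; apply/andP; split; lra.
- exists (3 * A); first exact: mulr_ge0.
  move=> u v d x uv; rewrite (le_trans (clamp_lip _ _ _ _))//.
  have -> : k0 x * u i + k1 x * u j + k2 x * u l - (k0 x * v i + k1 x * v j + k2 x * v l) =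
    k0 x * (u i - v i) + k1 x * (u j - v j) + k2 x * (u l - v l) by ring.
  have H k (m : nat) : `|k| <= A -> `|k * (u m - v m)| <= A * d.
    by move=> kA; rewrite normrM ler_pM.
  rewrite (le_trans (ler_normD _ _))//.
  have -> : 3 * A * d = A * d + A * d + A * d by ring.
  by rewrite lerD ?H// (le_trans (ler_normD _ _))// lerD ?H.
- move=> u x; apply: (@continuous_comp _ _ _ (fun x => _) (clamp p q));
    last exact: clamp_continuous.
  apply: cvgD; last by apply: cvgM; [exact: c2|exact: cvg_cst].
  apply: cvgD; first by apply: cvgM; [exact: c0|exact: cvg_cst].
  by apply: cvgM; [exact: c1|exact: cvg_cst].
Qed.

Lemma bl_int g : bounded_lipschitz g ->
  bounded_lipschitz (fun u _ => \int[mu]_(x in `[0, 1]) g u x).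
Proof.
move=> [[B B0 gB] [L L0 gL] gc].
have ig u : itg `[0, 1] (g u) by exact: itg_continuous.
split.
- exists B => // u _; rewrite -[B]mulr1 -[X in _ <= B * X]subr0.
  by apply: int_bounded => //; exact: itg_measurable.
- exists L => // u v d _ uv; rewrite -RintegralB; [|by []|exact: ig|exact: ig].
  rewrite -[L * d]mulr1 -[X in _ <= _ * X]subr0; apply: int_bounded => //.
    by apply: itg_measurable; exact: itgB (ig u) (ig v).
  by move=> x _; exact: gL.
- by move=> u x; exact: cvg_cst.
Qed.

(** A primitive on the line may grow linearly; clamping its argument to [0,1] bounds it and changes
    nothing on the domain of integration of [Qc]. *)
Lemma bl_prim g : bounded_lipschitz g ->
  bounded_lipschitz (fun u x => prim (g u) (clamp 0 1 x)).
Proof.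
move=> [[B B0 gB] [L L0 gL] gc].
have ig u p q : itg `[p, q] (g u) by exact: itg_continuous.
have c01 x := clamp_itv x (ler01 : 0 <= 1 :> R).
have c0 x : 0 <= clamp 0 1 x :> R by have /andP[] := c01 x.
have c1 x : clamp 0 1 x - 0 <= 1 :> R by rewrite subr0; have /andP[] := c01 x.
split.
- exists B => // u x; rewrite prim_pos// (le_trans (int_bounded (c0 x) (itg_measurable (ig u _ _)) (k := B) _))//.
  by rewrite ler_piMr.
- exists L => // u v d x uv; rewrite !prim_pos// -RintegralB; [|by []|exact: ig|exact: ig].
  have := @int_bounded _ 0 (clamp 0 1 x) (L * d) (fun x => g u x - g v x) (c0 x).
  move=> /(_ _ _)/le_trans; apply.
  + by apply: itg_measurable; exact: itgB (ig u _ _) (ig v _ _).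
  + by move=> z _; exact: gL.
  + by rewrite ler_piMr// mulr_ge0// (state_dist_ge0 uv).
- move=> u x; apply: (@continuous_comp _ _ _ (clamp 0 1) (prim (g u))).
    exact: clamp_continuous.
  by apply: prim_continuous => p q; exact: ig.
Qed.

End BoundedLipschitz.

(** * The clamped system of ordinary differential equations *)

Section CutoffSystem.
Context (R : realType).
Local Notation mu := (@lebesgue_measure R).
Variables (a b : R -> R) (A m M : R).
Hypotheses (ca : continuous a) (cb : continuous b).
Hypotheses (aA : forall x, `|a x| <= A) (bA : forall x, `|b x| <= A).
Hypotheses (A1 : 1 <= A) (m0 : 0 < m) (m1 : m <= 1) (M1 : 1 <= M).
Implicit Types (u v : nat -> R) (x y t s : R).

(** With [a] for [f0'] and [b] for [rho0]: [wst] is [w] and [zst] is [w_t], as linear combinations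
    of the coordinates; [wc] and [zc] are their clamped versions, from which [Jc], the space
    derivative [1 / w] of the flow, its time derivative [Jtc] and the nonlocal term [Ic] are
    formed. *)
Definition wst u x := 1 * u 0%N + - a x * u 1%N + b x * u 2%N.
Definition zst u x := 1 * u 3%N + - a x * u 4%N + b x * u 5%N.
Definition wc u x := clamp m M (wst u x).
Definition zc u x := clamp (- M) M (zst u x).
Definition Jc u x := (wc u x)^-1.
Definition Jtc u x := - (zc u x * Jc u x ^+ 2).
Definition Ic u := \int[mu]_(x in `[0, 1]) (b x * Jc u x ^+ 2) -
  2 * \int[mu]_(x in `[0, 1]) (zc u x ^+ 2 * Jc u x ^+ 3).
(** In the variables of the flow, the mean of the velocity is the integral of [(Q + prim J_t) * J];
    as [J] has integral 1, this value of [Q] makes it vanish. *)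
Definition Qc u := - \int[mu]_(x in `[0, 1]) (prim (Jtc u) (clamp 0 1 x) * Jc u x).

(* [u 0, u 1, u 2] are the coefficients of [w = 1 / gamma_x] on [1, - f0', rho0]
   and [u 3, u 4, u 5] those of [w_t]; the clamps make the field globally Lipschitz *)
Definition field u (k : nat) : R :=
  match k with
  | 0%N => clamp (- M) M (u 3%N)
  | 1%N => clamp (- M) M (u 4%N)
  | 2%N => clamp (- M) M (u 5%N)
  | 3%N => - (Ic u * clamp (- M) M (u 0%N))
  | 4%N => - (Ic u * clamp (- M) M (u 1%N))
  | 5%N => 1 - Ic u * clamp (- M) M (u 2%N)
  | _ => 0
  end.

Definition init (k : nat) : R := match k with 0%N => 1 | 4%N => 1 | _ => 0 end.

Let A0 : 0 <= A. Proof. exact: le_trans A1. Qed.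
Let mM : m <= M. Proof. exact: le_trans M1. Qed.
Let MM : - M <= M. Proof. by rewrite ge0_cp// (le_trans _ M1). Qed.

Let c1 : continuous (fun _ : R => 1 : R). Proof. by move=> x; exact: cvg_cst. Qed.
Let cNa : continuous (fun x => - a x). Proof. by move=> x; apply: cvgN; exact: ca. Qed.

Lemma bl_wc : bounded_lipschitz wc.
Proof.
apply: (@bl_clamp _ (fun=> 1) (fun x => - a x) b A 0 1 2) => // x.
  by rewrite normr1.
by rewrite normrN.
Qed.

Lemma bl_zc : bounded_lipschitz zc.
Proof.
apply: (@bl_clamp _ (fun=> 1) (fun x => - a x) b A 3 4 5) => // x.
  by rewrite normr1.
by rewrite normrN.
Qed.

Lemma bl_coord i : bounded_lipschitz (fun u (_ : R) => clamp (- M) M (u i)).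
Proof.
have c0 : continuous (fun _ : R => 0 : R) by move=> x; exact: cvg_cst.
have [B L c] : bounded_lipschitz (fun u (x : R) => clamp (- M) M
    ((fun=> 1 : R) x * u i + (fun=> 0 : R) x * u i + (fun=> 0) x * u i)).
  by apply: (@bl_clamp _ _ _ _ A) => // x; rewrite ?normr1 ?normr0.
have E u : clamp (- M) M (1 * u i + 0 * u i + 0 * u i) = clamp (- M) M (u i).
  by congr clamp; ring.
split.
- by case: B => B B0 gB; exists B => // u x; rewrite -E; exact: gB.
- by case: L => L L0 gL; exists L => // u v d x uv; rewrite -!E; exact: gL.
- by move=> u x; exact: cvg_cst.
Qed.

Lemma wc_ge u x : m <= wc u x. Proof. by have /andP[] := clamp_itv (wst u x) mM. Qed.

Lemma wc_le u x : wc u x <= M. Proof. by have /andP[] := clamp_itv (wst u x) mM. Qed.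

Lemma wc_gt0 u x : 0 < wc u x. Proof. exact: lt_le_trans (wc_ge u x). Qed.

Lemma bl_Jc : bounded_lipschitz Jc.
Proof. by apply: (blV m0) bl_wc => u x; exact: wc_ge. Qed.

Lemma bl_Jtc : bounded_lipschitz Jtc.
Proof. by apply/blN/blM; [exact: bl_zc|exact/blX/bl_Jc]. Qed.

Lemma bl_Ic : bounded_lipschitz (fun u (_ : R) => Ic u).
Proof.
apply: blD; first by apply: bl_int; apply: blM; [exact: bl_fun cb bA|exact/blX/bl_Jc].
apply/blN/blM; first exact: bl_cst.
by apply: bl_int; apply: blM; apply: blX; [exact: bl_zc|exact: bl_Jc].
Qed.

Lemma bl_Qc : bounded_lipschitz (fun u (_ : R) => Qc u).
Proof. by apply/blN/bl_int/blM; [exact/bl_prim/bl_Jtc|exact: bl_Jc]. Qed.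

Lemma bl_field k : bounded_lipschitz (fun u (_ : R) => field u k).
Proof.
case: k => [|[|[|[|[|[|k]]]]]]; try exact: bl_coord; last exact: bl_cst.
- by apply/blN/blM; [exact: bl_Ic|exact: bl_coord].
- by apply/blN/blM; [exact: bl_Ic|exact: bl_coord].
- apply: blD; first exact: bl_cst.
  by apply/blN/blM; [exact: bl_Ic|exact: bl_coord].
Qed.

(** The clamped coordinates contribute [M], the source term 1, and the products with [Ic] the last
    summand. The lifespan and the step length of the continuation are derived from this bound on the
    speed of the trajectory. *)
Definition field_bound := 1 + M + M * (A * m^-1 ^+ 2 + 2 * (M ^+ 2 * m^-1 ^+ 3)).

Lemma Ic_bound u : `|Ic u| <= A * m^-1 ^+ 2 + 2 * (M ^+ 2 * m^-1 ^+ 3).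
Proof.
have J1 x : 0 <= Jc u x <= m^-1.
  by rewrite invr_ge0 ltW ?wc_gt0//= lef_pV2 ?posrE ?wc_gt0// wc_ge.
have Jn n x : `|Jc u x ^+ n| <= m^-1 ^+ n.
  by have /andP[J0 Jm] := J1 x; rewrite ger0_norm ?exprn_ge0// lerXn2r ?nnegrE ?(le_trans J0).
have bI (g : (nat -> R) -> R -> R) k : bounded_lipschitz g -> (forall x, `|g u x| <= k) ->
    `|\int[mu]_(x in `[0, 1]) g u x| <= k.
  move=> [_ _ cg] gk; rewrite -[k]mulr1 -[X in _ <= k * X]subr0.
  by apply: int_bounded => //; apply: itg_measurable; exact: itg_continuous.
rewrite /Ic (le_trans (ler_normB _ _))// lerD//.
  apply: (bI (fun u x => b x * Jc u x ^+ 2)) => [|x].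
    by apply: blM; [exact: bl_fun cb bA|exact/blX/bl_Jc].
  by rewrite normrM ler_pM.
rewrite normrM ger0_norm// ler_wpM2l//.
apply: (bI (fun u x => zc u x ^+ 2 * Jc u x ^+ 3)) => [|x].
  by apply: blM; apply: blX; [exact: bl_zc|exact: bl_Jc].
have zM : `|zc u x| <= M by rewrite ler_norml; exact: clamp_itv.
have M0 : 0 <= M by exact: le_trans M1.
by rewrite normrM ler_pM// normrX lerXn2r ?nnegrE.
Qed.

Lemma field_le u k : `|field u k| <= field_bound.
Proof.
have M0 : 0 <= M by exact: le_trans M1.
have cM i : `|clamp (- M) M (u i)| <= M by rewrite ler_norml; exact: clamp_itv.
have IM := Ic_bound u; set I1 := (X in _ <= X) in IM.
have I0 : 0 <= I1 by exact: le_trans IM.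
have h0 : 0 <= M * I1 by exact: mulr_ge0.
have h i : `|Ic u * clamp (- M) M (u i)| <= M * I1 by rewrite normrM mulrC ler_pM.
rewrite /field_bound -/I1.
case: k => [|[|[|[|[|[|k]]]]]] /=; rewrite ?normrN ?normr0.
- by have := cM 3; lra.
- by have := cM 4; lra.
- by have := cM 5; lra.
- by have := h 0; lra.
- by have := h 1; lra.
- by rewrite (le_trans (ler_normB _ _))// normr1; have := h 2; lra.
- lra.
Qed.

Lemma cutoff_solution B : (forall u k, `|field u k| <= B) ->
  exists y : R -> nat -> R, [/\ forall k, y 0 k = init k,
  forall s t k, `|y t k - y s k| <= B * `|t - s| &
  forall t k, 0 < t -> is_derive t 1 (fun s => y s k) (field (y t) k)].
Proof.
move=> fB.
have /choice[L HL] : forall k, exists L, 0 <= L /\ forall u v d, state_dist_le u v d ->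
    `|field u k - field v k| <= L * d.
  move=> k; have [_ [L L0 fL] _] := bl_field k; exists L; split => // u v d.
  exact: (fL u v d 0).
(* One Lipschitz constant is needed for all indices; it suffices to dominate the first six, as the
   field vanishes from index 6 on. *)
pose Ls := 1 + L 0%N + L 1%N + L 2%N + L 3%N + L 4%N + L 5%N.
have [[l0 l1] l2] := (proj1 (HL 0%N), proj1 (HL 1%N), proj1 (HL 2%N)).
have [[l3 l4] l5] := (proj1 (HL 3%N), proj1 (HL 4%N), proj1 (HL 5%N)).
have Ls0 : 0 < Ls by rewrite /Ls; lra.
apply: (@picard R nat field Ls B init Ls0 _ fB).
move=> u v d k uv; have d0 := state_dist_ge0 uv.
have le k' : (k' < 6)%N -> L k' <= Ls.
  by case: k' => [|[|[|[|[|[|]]]]]]// _; rewrite /Ls; lra.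
have [k6|k6] := ltnP k 6.
  by rewrite (le_trans ((HL k).2 u v d uv))// ler_wpM2r// le.
have fz u' : field u' k = 0 by case: k k6 => [|[|[|[|[|[|]]]]]].
by rewrite !fz subrr normr0 mulr_ge0// ltW.
Qed.

End CutoffSystem.

Section MeanValue.
Context (R : realType).
Implicit Types (phi : R -> R) (s t r c d l : R).

(** The two ends may come in either order or coincide, whence the closed range for the intermediate
    point. *)
Lemma mean_value phi (phi' : R -> R) s t :
  (forall r, Num.min s t <= r <= Num.max s t -> is_derive r 1 phi (phi' r)) ->
  exists2 c, Num.min s t <= c <= Num.max s t & phi t - phi s = phi' c * (t - s).
Proof.
wlog st : s t / s <= t => [H|].
  case/orP: (le_total s t) => [|ts]; first exact: H.
  move=> D; have [|c cI cE] := H _ _ ts; first by rewrite minC maxC.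
  exists c; first by rewrite minC maxC.
  by rewrite -opprB cE; ring.
rewrite (min_idPl st) (max_idPr st) => D.
have [ts|lt_st] := leP t s.
  have -> : t = s by apply/le_anti; rewrite st ts.
  by exists s; rewrite ?lexx// !subrr mulr0.
have [||c cI cE] := @MVT R phi phi' s t lt_st.
- by move=> r; rewrite in_itv/= => /andP[sr rt]; apply: D; rewrite !ltW.
- apply/within_continuousP => x; rewrite /= in_itv/= => xI.
  have /is_derive_continuous/continuous_eps cx := D x xI.
  by move=> e e0; have [d d0 dE] := cx e e0; exists d => // z _; apply: dE.
by exists c; move: cI; rewrite in_itv/= => /andP[sc ct] //; rewrite !ltW.
Qed.

Lemma min_max_dist s t c : Num.min s t <= c <= Num.max s t -> `|c - s| <= `|t - s|.
Proof.
move=> /andP[]; rewrite ge_min le_max => h1 h2.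
have := ler_norm (t - s); have := ler_norm (- (t - s)); rewrite normrN ler_norml.
by case/orP: h1 => h1; case/orP: h2 => h2 l1 l2; apply/andP; split; lra.
Qed.

Lemma min_max_itv s t c p q : s \in `[p, q] -> t \in `[p, q] ->
  Num.min s t <= c <= Num.max s t -> c \in `[p, q].
Proof.
rewrite !in_itv/= ge_min le_max => /andP[? ?] /andP[? ?] /andP[c1 c2].
by apply/andP; split; [case/orP: c1|case/orP: c2] => ?; lra.
Qed.

Lemma is_derive_quadratic phi t l C d : 0 < d ->
  (forall h, `|h| < d -> `|phi (t + h) - phi t - h * l| <= C * h ^+ 2) ->
  is_derive t 1 phi l.
Proof.
move=> d0 H; apply/is_derive_eps => e e0.
have C1 : 0 < `|C| + 1 by rewrite ltr_wpDl.
exists (Num.min d (e / (`|C| + 1))); first by rewrite lt_min d0 divr_gt0.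
move=> h; rewrite lt_min => /andP[hd he]; rewrite (le_trans (H h hd))//.
rewrite -[h ^+ 2]ger0_norm ?sqr_ge0// normrX expr2 mulrA ler_wpM2r//.
move: he; rewrite ltr_pdivlMr// => he.
have := ler_norm C; have := normr_ge0 h; nra.
Qed.

End MeanValue.

Section Data.
Context (R : realType).
Local Notation mu := (@lebesgue_measure R).

(* [a] and [b] extend [f0'] and [rho0] to the real line, with weak derivatives
   [a'] and [b'] *)
Record extended_data (bc : boundary_kind) (a b a' b' : R -> R) (A : R) : Prop := {
  ext_ca : continuous a;
  ext_cb : continuous b;
  ext_aA : forall x, `|a x| <= A;
  ext_bA : forall x, `|b x| <= A;
  ext_A1 : 1 <= A;
  ext_ac_a : forall p q, ac p q a a';
  ext_ac_b : forall p q, ac p q b b';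
  ext_sqi_a : forall p q, sqi p q a';
  ext_sqi_b : forall p q, sqi p q b';
  ext_mean : \int[mu]_(x in `[0, 1]) a x = 0;
  ext_cover : forall x, exists2 x', 0 <= x' <= 1 & a x = a x' /\ b x = b x';
  ext_boundary : match bc with
    | Dirichlet => b 0 = 0 /\ b 1 = 0
    | Periodic => forall x, a (x + 1) = a x /\ b (x + 1) = b x
    end }.

Record trajectory (a b : R -> R) (m M : R) (y : R -> nat -> R) (B : R) : Prop := {
  traj_m0 : 0 < m;
  traj_m1 : m <= 1;
  traj_M1 : 1 <= M;
  traj_init : forall k, y 0 k = init R k;
  traj_B0 : 0 <= B;
  traj_lip : forall s t k, `|y t k - y s k| <= B * `|t - s|;
  traj_derive : forall (t : R) k, 0 < t ->
    is_derive t 1 (fun s => y s k) (field a b m M (y t) k) }.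

(** No clamp is active at [u]: the clamped field takes there the same values as the original one. *)
Record good_time (a b : R -> R) (m M : R) (u : nat -> R) : Prop := {
  good_w : forall x, m <= wst a b u x <= M;
  good_z : forall x, `|zst a b u x| <= M;
  good_u : forall k, (k < 6)%N -> `|u k| <= M }.

End Data.

(** * Lagrangian quantities along a trajectory without active clamps *)

Section Trajectory.
Context (R : realType).
Local Notation mu := (@lebesgue_measure R).
Variables (bc : boundary_kind) (a b a' b' : R -> R) (A m M B T : R) (y : R -> nat -> R).
Hypothesis ext : extended_data bc a b a' b' A.
Hypothesis traj : trajectory a b m M y B.
Hypothesis good : forall t, 0 <= t <= T -> good_time a b m M (y t).
Implicit Types (x s t : R).

Local Notation w t := (wst a b (y t)).
Local Notation z t := (zst a b (y t)).
Local Notation J t := (Jc a b m M (y t)).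
Local Notation Jt t := (Jtc a b m M (y t)).
Local Notation I t := (Ic a b m M (y t)).

Let ca := ext_ca ext.
Let cb := ext_cb ext.
Let aA := ext_aA ext.
Let bA := ext_bA ext.
Let A1 := ext_A1 ext.
Let m0 := traj_m0 traj.
Let m1 := traj_m1 traj.
Let M1 := traj_M1 traj.

Let clampM q : `|q| <= M -> clamp (- M) M q = q.
Proof. by rewrite ler_norml => ?; apply: clamp_id. Qed.

Lemma wcE t x : 0 <= t <= T -> wc a b m M (y t) x = w t x.
Proof. by move=> /good[h _ _]; apply: clamp_id. Qed.

Lemma zcE t x : 0 <= t <= T -> zc a b M (y t) x = z t x.
Proof. by move=> /good[_ h _]; apply: clampM. Qed.

Lemma JE t x : 0 <= t <= T -> J t x = (w t x)^-1.
Proof. by move=> tT; rewrite /Jc wcE. Qed.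

Lemma w_gt0 t x : 0 <= t <= T -> 0 < w t x.
Proof. by move=> /good[/(_ x)/andP[h _] _ _]; exact: lt_le_trans h. Qed.

Lemma trajectory_continuous k : continuous (fun t => y t k).
Proof. by apply: (@lipschitz_continuous _ B) => s t; exact: (traj_lip traj). Qed.

Lemma state_dist s t : state_dist_le (y t) (y s) (B * `|t - s|).
Proof. by move=> k; exact: (traj_lip traj). Qed.

Let combination_derive i j k t x : 0 < t ->
  is_derive t 1 (fun s => 1 * y s i + - a x * y s j + b x * y s k)
    (1 * field a b m M (y t) i + - a x * field a b m M (y t) j + b x * field a b m M (y t) k).
Proof.
move=> t0; have D l := traj_derive traj l t0.
have Z q l : is_derive t 1 (fun s => q * y s l) (q * field a b m M (y t) l).
  by have := is_deriveZ q (D l).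
by apply: is_deriveD.
Qed.

Lemma wst_derive t x : 0 < t < T -> is_derive t 1 (fun s => w s x) (z t x).
Proof.
move=> /andP[t0 tT]; have tI : 0 <= t <= T by rewrite !ltW.
have [_ _ yM] := good tI.
by have := combination_derive 0 1 2 x t0; rewrite /= !clampM ?yM.
Qed.

Lemma zst_derive t x : 0 < t < T ->
  is_derive t 1 (fun s => z s x) (b x - I t * w t x).
Proof.
move=> /andP[t0 tT]; have tI : 0 <= t <= T by rewrite !ltW.
have [_ _ yM] := good tI.
have := combination_derive 3 4 5 x t0; rewrite /= !clampM ?yM// => D.
apply: (is_derive_eq D); rewrite /wst; ring.
Qed.

Lemma inner_ball t : 0 < t < T ->
  exists2 d, 0 < d & forall s, `|s - t| < d -> 0 < s < T.
Proof.
move=> /andP[t0 tT]; exists (Num.min t (T - t)); first by rewrite lt_min t0 subr_gt0.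
move=> s; rewrite lt_min !ltr_norml => /andP[/andP[? _] /andP[_ ?]].
by apply/andP; split; lra.
Qed.

Lemma Jc_derive t x : 0 < t < T -> is_derive t 1 (fun s => J s x) (Jt t x).
Proof.
move=> tI; have /andP[/ltW t0 /ltW tT] := tI; have tI' : 0 <= t <= T by rewrite t0.
have [d d0 dE] := inner_ball tI.
apply: (is_derive_near d0 (f := fun s => (w s x)^-1)).
  by move=> s /dE/andP[s0 sT]; rewrite JE// !ltW.
have w0 : w t x != 0 by rewrite gt_eqF// w_gt0.
have D := @is_deriveV _ (fun s => w s x) _ _ _ w0 (wst_derive x tI).
by apply: (is_derive_eq D); rewrite /Jtc JE// zcE// exprVn /GRing.scale/= mulNr mulrC.
Qed.

(** The second time derivative of [1 / w], computed from [w_tt = b - I w]. *)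
Definition Jttc u x := - ((b x - Ic a b m M u * wc a b m M u x) * Jc a b m M u x ^+ 2) +
  2 * (zc a b M u x ^+ 2 * Jc a b m M u x ^+ 3).

Lemma Jtc_derive t x : 0 < t < T -> is_derive t 1 (fun s => Jt s x) (Jttc (y t) x).
Proof.
move=> tI; have /andP[/ltW t0 /ltW tT] := tI; have tI' : 0 <= t <= T by rewrite t0.
have [d d0 dE] := inner_ball tI.
apply: (is_derive_near d0 (f := fun s => - (z s x * J s x ^+ 2))).
  by move=> s /dE/andP[s0 sT]; rewrite /Jtc zcE// !ltW.
have DJ := Jc_derive x tI; have Dz := zst_derive x tI.
have D : is_derive t 1 (fun s => - (z s x * (J s x * J s x)))
  (- (z t x *: (J t x *: Jt t x + J t x *: Jt t x) +
      (J t x * J t x) *: (b x - I t * w t x))).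
  exact: is_deriveN (is_deriveM Dz (is_deriveM DJ DJ)).
apply: (is_derive_eq D); rewrite /Jttc wcE// zcE// /Jtc zcE// /GRing.scale/=; ring.
Qed.

Lemma bl_Jttc : bounded_lipschitz Jttc.
Proof.
have bJ := bl_Jc ca cb aA bA A1 m0 m1 M1; have bz := bl_zc ca cb aA bA A1 M1.
have bw := bl_wc ca cb aA bA A1 m1 M1; have bI := bl_Ic ca cb aA bA A1 m0 m1 M1.
apply: blD; last first.
  by apply: blM; [exact: bl_cst|apply: blM; apply: blX].
apply/blN/blM; last exact: blX.
by apply: blD; [exact: bl_fun cb bA|apply/blN/blM].
Qed.

(** The time derivative is itself Lipschitz along the trajectory, so that the remainder is of second
    order uniformly in [x]. Integrals over [x] can then be differentiated in time by mere
    estimation. *)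
Lemma bl_taylor (g g' : (nat -> R) -> R -> R) : bounded_lipschitz g' ->
  (forall t x, 0 < t < T -> is_derive t 1 (fun s => g (y s) x) (g' (y t) x)) ->
  exists2 C, 0 <= C & forall s t x, 0 < s < T -> 0 < t < T ->
    `|g (y t) x - g (y s) x - (t - s) * g' (y s) x| <= C * (t - s) ^+ 2.
Proof.
move=> [_ [L L0 gL] _] D; exists (L * B); first by rewrite mulr_ge0// (traj_B0 traj).
move=> s t x sI tI.
have [|c cI cE] := @mean_value _ (fun r => g (y r) x) (fun r => g' (y r) x) s t.
  move=> r; rewrite ge_min le_max => /andP[h1 h2]; apply: D.
  move: sI tI => /andP[s0 sT] /andP[t0 tT].
  by case/orP: h1 => h1; case/orP: h2 => h2; apply/andP; split; lra.
rewrite {}cE (mulrC (t - s)) -mulrBl normrM.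
rewrite -[(t - s) ^+ 2]ger0_norm ?sqr_ge0// normrX expr2 mulrA ler_wpM2r//.
rewrite (le_trans (gL _ _ _ _ (state_dist s c)))// -mulrA ler_wpM2l//.
by rewrite ler_wpM2l ?(traj_B0 traj)// (min_max_dist cI).
Qed.

Lemma bl_int_derive (g g' : (nat -> R) -> R -> R) t :
  bounded_lipschitz g -> bounded_lipschitz g' ->
  (forall t x, 0 < t < T -> is_derive t 1 (fun s => g (y s) x) (g' (y t) x)) ->
  0 < t < T ->
  is_derive t 1 (fun s => \int[mu]_(x in `[0, 1]) g (y s) x)
                (\int[mu]_(x in `[0, 1]) g' (y t) x).
Proof.
move=> [_ _ cg] bg' D tI; have [_ _ cg'] := bg'.
have [C C0 HC] := bl_taylor bg' D.
have [d d0 dE] := inner_ball tI.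
apply: (is_derive_quadratic d0 (C := C)) => h hd.
have thI : 0 < t + h < T by apply: dE; rewrite addrC addKr.
have ig u : itg `[0, 1] (g u) by exact: itg_continuous.
have ig' u : itg `[0, 1] (g' u) by exact: itg_continuous.
have i1 : itg `[0, 1] (fun x => g (y (t + h)) x - g (y t) x) by exact: itgB.
have i2 : itg `[0, 1] (fun x => h * g' (y t) x) by exact: itgZ.
rewrite -RintegralZl; [|by []|exact: ig'].
rewrite -RintegralB; [|by []|exact: ig|exact: ig].
rewrite -RintegralB; [|by []|exact: i1|exact: i2].
have -> : C * h ^+ 2 = C * h ^+ 2 * (1 - 0) by rewrite subr0 mulr1.
apply: int_bounded => // [|x _]; first by apply: itg_measurable; exact: itgB i1 i2.
by have := HC t (t + h) x tI thI; rewrite [t + h - t]addrC addKr.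
Qed.

Lemma bl_int_lipschitz (g : (nat -> R) -> R -> R) : bounded_lipschitz g ->
  continuous (fun t => \int[mu]_(x in `[0, 1]) g (y t) x).
Proof.
move=> /bl_int[_ [L L0 gL] _]; apply: (@lipschitz_continuous _ (L * B)) => s t.
by rewrite (le_trans (gL _ _ _ 0 (state_dist t s)))// mulrA.
Qed.

Local Notation K t := (\int[mu]_(x in `[0, 1]) J t x).
Local Notation K' t := (\int[mu]_(x in `[0, 1]) Jt t x).

(** By the definition of [Ic] the terms with [b] and [w_t ^+ 2] add up to [- I], and [I w / w^2]
    integrates to [I K]. This is where the exact form of the nonlocal term matters. *)
Let int_Jttc t : 0 <= t <= T ->
  \int[mu]_(x in `[0, 1]) Jttc (y t) x = I t * (K t - 1).
Proof.
move=> tI.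
have bJ := bl_Jc ca cb aA bA A1 m0 m1 M1; have bz := bl_zc ca cb aA bA A1 M1.
have ig g : bounded_lipschitz g -> itg `[0, 1] (g (y t)).
  by move=> [_ _ c]; exact: itg_continuous.
have iJ := ig _ bJ.
have ib := ig _ (blM (bl_fun cb bA) (blX 2 bJ)).
have iz := ig _ (blM (blX 2 bz) (blX 3 bJ)).
rewrite (@int_eq _ _ _ (fun x => I t * J t x - (b x * J t x ^+ 2 -
  2 * (zc a b M (y t) x ^+ 2 * J t x ^+ 3))))//; last first.
  move=> x _; rewrite /Jttc {1 2}/Jc.
  have w0 : wc a b m M (y t) x != 0 by rewrite gt_eqF// wc_gt0.
  by rewrite /Jc; field.
rewrite RintegralB; [|by []|exact: itgZ|by apply: itgB => //; exact: itgZ].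
rewrite RintegralB; [|by []|exact: ib|exact: itgZ].
by rewrite !RintegralZl// {2}/Ic mulrBr mulr1.
Qed.

(** Both [K - 1] and [K'] vanish at time 0, the latter because [a] has mean zero, and they solve a
    linear first-order system; Gronwall's inequality for the sum of their squares keeps them at
    zero. *)
Lemma unit_mass t : 0 <= t <= T -> K t = 1 /\ K' t = 0.
Proof.
move=> tI.
have bJ := bl_Jc ca cb aA bA A1 m0 m1 M1; have bJt := bl_Jtc ca cb aA bA A1 m0 m1 M1.
have [BI BI0 IB] := bl_bound (bl_Ic ca cb aA bA A1 m0 m1 M1).
pose E s := (K s - 1) * (K s - 1) + K' s * K' s.
have cE : continuous E.
  have cK : continuous (fun s => K s - 1).
    by move=> s; apply: cvgB; [exact: bl_int_lipschitz bJ s|exact: cvg_cst].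
  have cK' := bl_int_lipschitz bJt.
  by move=> s; apply: cvgD; apply: cvgM; [exact: cK|exact: cK|exact: cK'|exact: cK'].
have dE s : 0 < s < T -> is_derive s 1 E (2 * (K s - 1) * K' s + 2 * K' s * (I s * (K s - 1))).
  move=> sI; have sI' : 0 <= s <= T by case/andP: sI => ? ?; rewrite !ltW.
  have DK := bl_int_derive bJ bJt Jc_derive sI.
  have DK' := bl_int_derive bJt bl_Jttc Jtc_derive sI; rewrite int_Jttc// in DK'.
  have DK1 : is_derive s 1 (fun s => K s - 1) (K' s - 0).
    exact: is_deriveB DK (is_derive_cst _ _ _).
  have := is_deriveD (is_deriveM DK1 DK1) (is_deriveM DK' DK').
  by move=> D; apply: (is_derive_eq D); rewrite /GRing.scale/= subr0; ring.
have E0 : E 0 = 0.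
  have T0 : 0 <= (0 : R) <= T by case/andP: tI => h1 h2; rewrite lexx (le_trans h1 h2).
  have w0 x : w 0 x = 1 by rewrite /wst !(traj_init traj)/=; ring.
  have z0 x : z 0 x = - a x by rewrite /zst !(traj_init traj)/=; ring.
  have J0 x : J 0 x = 1 by rewrite JE// w0 invr1.
  have K0 : K 0 = 1.
    rewrite (@int_eq _ _ _ (fun=> 1))//; first by rewrite int_cst// subr0 mulr1.
  have K'0 : K' 0 = 0.
    rewrite (@int_eq _ _ _ a) ?(ext_mean ext)// => x _.
    by rewrite /Jtc J0 zcE// z0 expr1n mulr1 opprK.
  by rewrite /E K0 K'0 subrr !mulr0 addr0.
have := @gronwall _ E _ (1 + BI) T (continuous_within cE) dE _ t tI.
rewrite E0 mul0r => /(_ _)/le_trans Et.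
have {}Et : E t <= 0.
  apply: Et => // s sI; have := IB (y s) 0; rewrite /E -!expr2 ler_norml => /andP[I1 I2].
  set p := K s - 1; set q := K' s.
  have h1 : 2 * p * q <= p ^+ 2 + q ^+ 2 by have := sqr_ge0 (p - q); nra.
  have h2 : - (2 * p * q) <= p ^+ 2 + q ^+ 2 by have := sqr_ge0 (p + q); nra.
  have -> : 2 * p * q + 2 * q * (I s * p) = 2 * p * q * (1 + I s) by ring.
  have h3 : 2 * p * q * I s <= BI * (p ^+ 2 + q ^+ 2).
    by have [i0|/ltW i0] := leP 0 (I s); nra.
  by nra.
move: Et; rewrite /E -!expr2 => Et.
have /eqP : (K t - 1) ^+ 2 + K' t ^+ 2 = 0.
  by apply/le_anti; rewrite Et addr_ge0 ?sqr_ge0.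
by rewrite paddr_eq0 ?sqr_ge0// !sqrf_eq0 subr_eq0 => /andP[/eqP -> /eqP ->].
Qed.

End Trajectory.

(** * The flow map *)

Section PrimitiveBounds.
Context (R : realType).
Local Notation mu := (@lebesgue_measure R).
Implicit Types (g h : R -> R) (x p k : R).

Lemma prim_bound g k x : continuous g -> 0 <= k -> (forall x, `|g x| <= k) ->
  `|prim g x| <= k * `|x|.
Proof.
move=> cg k0 gk; have ig p q : itg `[p, q] g by exact: itg_continuous.
have [|c _ cE] := @mean_value _ (prim g) g 0 x.
  by move=> r _; apply: prim_derive => //; exact: cg.
by move: cE; rewrite prim0 !subr0 => ->; rewrite normrM ler_wpM2r.
Qed.

Lemma primB_fun g h x : continuous g -> continuous h ->
  prim (fun x => g x - h x) x = prim g x - prim h x.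
Proof.
move=> cg ch; rewrite /prim !RintegralB//; first by ring.
all: exact: itg_continuous.
Qed.

Lemma primZ_fun k g x : continuous g -> prim (fun x => k * g x) x = k * prim g x.
Proof.
move=> cg; rewrite /prim !RintegralZl//; first by ring.
all: exact: itg_continuous.
Qed.

Lemma prim_periodic g x : continuous g -> (forall x, g (x + 1) = g x) ->
  prim g (x + 1) = prim g x + \int[mu]_(x in `[0, 1]) g x.
Proof.
move=> cg pg; have ig p q : itg `[p, q] g by exact: itg_continuous.
have D (r : R) : is_derive r 1 (prim g) (g r) by apply: prim_derive => //; exact: cg.
have [|c _] := @mean_value _ (fun x => prim g (x + 1) - prim g x) (fun=> 0) 0 x.
  move=> r _; have D1 : is_derive (r : R) 1 (prim g \o (fun x => x + 1)) (g (r + 1) * 1).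
    apply: (@is_derive1_comp _ (prim g) (fun x => x + 1)).
    by have := is_deriveD (is_derive_id (r : R) 1) (is_derive_cst (1 : R) (r : R) 1); rewrite addr0.
  by apply: (is_derive_eq (is_deriveB D1 (D r))); rewrite pg mulr1 subrr.
rewrite mul0r add0r prim0 subr0 => /eqP; rewrite subr_eq0 => /eqP.
by rewrite (prim_pos _ ler01) => <-; ring.
Qed.

Lemma int_window g p : continuous g -> (forall x, g (x + 1) = g x) ->
  \int[mu]_(x in `[p, p + 1]) g x = \int[mu]_(x in `[0, 1]) g x.
Proof.
move=> cg pg; rewrite -primB ?lerDl// => [|? ?]; last exact: itg_continuous.
by rewrite prim_periodic// addrC addKr.
Qed.

End PrimitiveBounds.

Section FlowMap.
Context (R : realType).
Local Notation mu := (@lebesgue_measure R).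
Variables (bc : boundary_kind) (a b a' b' : R -> R) (A m M B T : R) (y : R -> nat -> R).
Hypothesis ext : extended_data bc a b a' b' A.
Hypothesis traj : trajectory a b m M y B.
Implicit Types (x s t q : R).

Local Notation J t := (Jc a b m M (y t)).
Local Notation Jt t := (Jtc a b m M (y t)).

Let ca := ext_ca ext.
Let cb := ext_cb ext.
Let aA := ext_aA ext.
Let bA := ext_bA ext.
Let A1 := ext_A1 ext.
Let m0 := traj_m0 traj.
Let m1 := traj_m1 traj.
Let M1 := traj_M1 traj.
Let M0 : 0 < M. Proof. exact: lt_le_trans M1. Qed.
Let bJ : bounded_lipschitz (Jc a b m M) := bl_Jc ca cb aA bA A1 m0 m1 M1.
Let bJt : bounded_lipschitz (Jtc a b m M) := bl_Jtc ca cb aA bA A1 m0 m1 M1.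
Let cJ t : continuous (J t). Proof. by have [_ _] := bJ; exact. Qed.
Let cJt t : continuous (Jt t). Proof. by have [_ _] := bJt; exact. Qed.

(* the velocity of the image of the origin; in the periodic case it is the one for
   which the velocity field has mean zero *)
Definition drift (u : nat -> R) : R :=
  match bc with Dirichlet => 0 | Periodic => Qc a b m M u end.

(** The flow is rebuilt from its space derivative [J]; the first integral is the position of the
    image of the origin. Its time derivative [flow_t] will define the velocity field. *)
Definition flow t x := \int[mu]_(s in `[0, t]) drift (y s) + prim (J t) x.
Definition flow_t t x := drift (y t) + prim (Jt t) x.

Lemma bl_drift : bounded_lipschitz (fun u (_ : R) => drift u).
Proof.
rewrite /drift; case: bc; first exact: bl_cst.
exact: bl_Qc ca cb aA bA A1 m0 m1 M1.
Qed.

Let drift_lipschitz : exists2 L, 0 <= L & forall s t, `|drift (y t) - drift (y s)| <= L * `|t - s|.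
Proof.
have [_ [L L0 dL] _] := bl_drift; exists (L * B); first by rewrite mulr_ge0// (traj_B0 traj).
by move=> s t; rewrite -mulrA; apply: (dL _ _ _ 0); exact: state_dist traj s t.
Qed.

Let drift_continuous : continuous (fun s => drift (y s)).
Proof.
by have [L _ dL] := drift_lipschitz; apply: (lipschitz_continuous (k := L)) => s t; exact: dL.
Qed.

Lemma flow_derive t x : is_derive x 1 (flow t) (J t x).
Proof.
rewrite /flow -[J t x]add0r.
apply: (is_deriveD (f := fun=> _) (g := prim (J t))).
by apply: prim_derive; [move=> ? ?; exact: itg_continuous|exact: cJ].
Qed.

Lemma flow_t_derive t x : is_derive x 1 (flow_t t) (Jt t x).
Proof.
rewrite /flow_t -[Jt t x]add0r.
apply: (is_deriveD (f := fun=> _) (g := prim (Jt t))).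
by apply: prim_derive; [move=> ? ?; exact: itg_continuous|exact: cJt].
Qed.

Lemma J_bounds t x : M^-1 <= J t x <= m^-1.
Proof.
have w0 := wc_gt0 a b m0 m1 M1 (y t) x.
by rewrite !lef_pV2 ?posrE// wc_ge// wc_le.
Qed.

(** The slope [J] is at least [M^-1]; this gives injectivity and the Lipschitz constant [M] of the
    inverse. *)
Lemma flow_expand t p q : `|p - q| <= M * `|flow t p - flow t q|.
Proof.
have [|c _ ->] := @mean_value _ (flow t) (J t) q p; first by move=> r _; exact: flow_derive.
have /andP[Jc0 _] := J_bounds t c.
have J0 : 0 < J t c by apply: lt_le_trans Jc0; rewrite invr_gt0.
rewrite normrM mulrA ler_peMl// gtr0_norm// mulrC -ler_pdivrMr//.
by rewrite mul1r.
Qed.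

Lemma flow_inj t : injective (flow t).
Proof.
move=> p q pq; apply/eqP; rewrite -subr_eq0 -normr_le0.
by have := flow_expand t p q; rewrite pq subrr normr0 mulr0.
Qed.

Let flow_continuous t : continuous (flow t).
Proof. by move=> x; exact: is_derive_continuous (flow_derive t x). Qed.

(** The slope being at least [M^-1], the value [q] is reached within distance
    [r = M * |q - flow t 0|] of the origin. *)
Lemma flow_surj t q : exists x, flow t x = q.
Proof.
pose r := M * `|q - flow t 0|; have r0 : 0 <= r by rewrite mulr_ge0// ltW.
have h p : 0 <= p -> M^-1 * p <= flow t p - flow t 0 /\ flow t (- p) - flow t 0 <= - (M^-1 * p).
  move=> p0.
  have [|c _ cE] := @mean_value _ (flow t) (J t) 0 p; first by move=> ? _; exact: flow_derive.
  have [|d _ dE] := @mean_value _ (flow t) (J t) 0 (- p); first by move=> ? _; exact: flow_derive.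
  have /andP[c1 _] := J_bounds t c; have /andP[d1 _] := J_bounds t d.
  by rewrite cE dE !subr0 mulrN lerN2 !ler_wpM2r.
have [h1 h2] := h r r0; move: h1 h2; rewrite /r mulrA mulVf ?gt_eqF// mul1r -/r => h1 h2.
have := ler_norm (q - flow t 0); have := ler_norm (- (q - flow t 0)); rewrite normrN => l1 l2.
have [|||x _ xE] := @IVT R (flow t) (- r) r q.
- by rewrite ge0_cp.
- exact: continuous_within.
- by rewrite ge_min le_max; apply/andP; split; apply/orP; [left|right]; lra.
by exists x.
Qed.

(** The inverse of the flow, giving the Lagrangian label of the particle located at [q]. By
    surjectivity the default value 0 is never an arbitrary choice. *)
Definition label t q : R := xget 0 [set x | flow t x = q].

Lemma labelK t : cancel (label t) (flow t).
Proof. by move=> q; have [x xE] := flow_surj t q; apply: (xgetPex 0 (P := [set x | flow t x = q])); exists x. Qed.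

Lemma flowK t : cancel (flow t) (label t).
Proof. by move=> x; apply: (@flow_inj t); rewrite labelK. Qed.

Definition stretch t q := wc a b m M (y t) (label t q).

Lemma label_derive t q : is_derive q 1 (label t) (stretch t q).
Proof.
rewrite -{1}(labelK t q) -[stretch t q]invrK.
apply: is_derive_inverse.
- by near=> x; exact: flowK.
- by near=> x; exact: flow_continuous.
- exact: flow_derive.
- by rewrite invr_eq0 gt_eqF// (wc_gt0 a b m0 m1 M1).
Unshelve. all: by end_near. Qed.

Let label_continuous t : continuous (label t).
Proof. by move=> q; exact: is_derive_continuous (label_derive t q). Qed.

Let cwc u : continuous (wc a b m M u).
Proof. by have [_ _] := bl_wc ca cb aA bA A1 m1 M1; exact. Qed.

Lemma stretch_continuous t : continuous (stretch t).
Proof.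
by move=> q; apply: (@continuous_comp _ _ _ (label t) (wc a b m M (y t))); [exact: label_continuous|exact: cwc].
Qed.

Let flow_lipschitz : exists2 C, 0 <= C & forall s t x,
  `|flow t x - flow s x| <= C * (1 + `|x|) * `|t - s|.
Proof.
have [[D D0 dD] _ _] := bl_drift; have [_ [L L0 JL] _] := bJ.
have LB : 0 <= L * B by rewrite mulr_ge0// (traj_B0 traj).
exists (D + L * B); first exact: addr_ge0.
move=> s t x; rewrite /flow opprD addrACA (le_trans (ler_normD _ _))//.
have h1 : `|\int[mu]_(s in `[0, t]) drift (y s) - \int[mu]_(s in `[0, s]) drift (y s)| <= D * `|t - s|.
  by apply: int0_lipschitz => // r; exact: (dD _ 0).
have h2 : `|prim (J t) x - prim (J s) x| <= L * B * `|t - s| * `|x|.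
  rewrite -primB_fun//; apply: prim_bound.
  - by move=> p; apply: cvgB; exact: cJ.
  - by rewrite mulr_ge0.
  - by move=> p; rewrite -mulrA; apply: JL; exact: state_dist traj s t.
have h3 : 0 <= D * `|x| * `|t - s| by rewrite !mulr_ge0.
have h4 : 0 <= L * B * `|t - s| by rewrite mulr_ge0.
rewrite (le_trans (lerD h1 h2))//.
have -> : (D + L * B) * (1 + `|x|) * `|t - s| = D * `|t - s| + L * B * `|t - s| * `|x| +
  (D * `|x| * `|t - s| + L * B * `|t - s|) by ring.
by rewrite lerDl addr_ge0.
Qed.

Let flow0 t : `|flow t 0| <= (sval (cid2 (bl_bound bl_drift))) * `|t|.
Proof.
case: cid2 => D D0 dD /=; rewrite /flow prim0 addr0.
have := @int0_lipschitz _ (fun s => drift (y s)) D 0 t drift_continuous.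
by rewrite int_point !subr0; apply => r; exact: (dD _ 0).
Qed.

(** Up to time [T] the image of the origin moves by at most [D * |T|], and the inverse flow is
    Lipschitz with constant [M]. *)
Lemma label_bounded : exists2 N, 0 <= N & forall t q, 0 <= t <= T -> 0 <= q <= 1 ->
  `|label t q| <= N.
Proof.
move: flow0; case: cid2 => D D0 dD /= f0.
exists (M * (1 + D * `|T|)); first by rewrite mulr_ge0 ?addr_ge0 ?mulr_ge0// ltW.
move=> t q /andP[t0 tT] /andP[q0 q1].
have := flow_expand t (label t q) 0; rewrite subr0 labelK => /le_trans; apply.
rewrite ler_wpM2l ?(ltW M0)// (le_trans (ler_normB _ _))// lerD//.
  by rewrite ger0_norm.
rewrite (le_trans (f0 t))// ler_wpM2l// ger0_norm// (le_trans tT)//; exact: ler_norm.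
Qed.

Lemma label_lipschitz : exists2 C, 0 <= C & forall s t q, 0 <= s <= T -> 0 <= t <= T ->
  0 <= q <= 1 -> `|label s q - label t q| <= C * `|s - t|.
Proof.
have [N N0 XN] := label_bounded; have [C C0 fC] := flow_lipschitz.
exists (M * (C * (1 + N))); first by rewrite !mulr_ge0 ?addr_ge0// ltW.
move=> s t q sT tT q01; rewrite (le_trans (flow_expand s _ _))//.
rewrite labelK -{1}(labelK t q) distrC -mulrA ler_wpM2l ?(ltW M0)//.
rewrite (le_trans (fC _ _ _))// ler_wpM2r// ler_wpM2l// lerD2l; exact: XN.
Qed.

(** Two variations add up: that of the state, on which [wc] depends in a Lipschitz way uniformly in
    [x], and that of the label, to which [comp_sup_small] applies. *)
Lemma stretch_sup t : 0 <= t <= T ->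
  sup_small (within `[0, T] (nbhs t)) (fun s q => stretch s q - stretch t q).
Proof.
move=> tT; have [N N0 XN] := label_bounded; have [C C0 XC] := label_lipschitz.
have [_ [L L0 wL] _] := bl_wc ca cb aA bA A1 m1 M1.
have s1 := comp_sup_small C0 XN XC (@cwc (y t)) tT.
have s2 : sup_small (within `[0, T] (nbhs t))
    (fun s q => wc a b m M (y s) (label s q) - wc a b m M (y t) (label s q)).
  move=> e e0; apply/near_within_eps.
  have d0 : 0 < L * B + 1 by rewrite ltr_wpDl ?mulr_ge0// (traj_B0 traj).
  exists (e / (L * B + 1)); first exact: divr_gt0.
  move=> s _; rewrite ltr_pdivlMr// => se q _.
  rewrite (le_trans (wL _ _ _ _ (state_dist traj t s)))// mulrA.
  by have := normr_ge0 (s - t); nra.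
apply: eq_near_sup_small (sup_smallD s2 s1).
by near=> s => q _; rewrite /stretch addrA subrK.
Unshelve. all: by end_near. Qed.

Let Jt_bound : exists2 k, 0 <= k & forall t x, `|Jt t x| <= k.
Proof. by have [[k k0 Jk] _ _] := bJt; exists k => // t x; exact: Jk. Qed.

Section Good.
Hypothesis good : forall t, 0 <= t <= T -> good_time a b m M (y t).

Let flow_taylor : exists2 C, 0 <= C & forall s t x, 0 < s < T -> 0 < t < T ->
  `|flow t x - flow s x - (t - s) * flow_t s x| <= C * (1 + `|x|) * (t - s) ^+ 2.
Proof.
have [L L0 dL] := drift_lipschitz.
have [C C0 JC] := bl_taylor traj bJt (Jc_derive traj good).
exists (L + C); first exact: addr_ge0.
move=> s t x sI tI.
have -> : flow t x - flow s x - (t - s) * flow_t s x =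
  (\int[mu]_(r in `[0, t]) drift (y r) - \int[mu]_(r in `[0, s]) drift (y r) - (t - s) * drift (y s)) +
  (prim (J t) x - prim (J s) x - (t - s) * prim (Jt s) x) by rewrite /flow /flow_t; ring.
rewrite (le_trans (ler_normD _ _))//.
have h1 : `|\int[mu]_(r in `[0, t]) drift (y r) - \int[mu]_(r in `[0, s]) drift (y r) -
    (t - s) * drift (y s)| <= L * (t - s) ^+ 2.
  have [|c cI ->] := @mean_value _ (fun t => \int[mu]_(r in `[0, t]) drift (y r))
    (fun t => drift (y t)) s t.
    move=> r; rewrite ge_min => /andP[h _].
    have r0 : 0 < r by case/andP: sI tI => s0 _ /andP[t0 _]; case/orP: h; exact: lt_le_trans.
    apply: (int_derive r0) => // [q|]; first exact: itg_continuous.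
    exact: drift_continuous.
  rewrite (mulrC (t - s)) -mulrBl normrM.
  rewrite -[(t - s) ^+ 2]ger0_norm ?sqr_ge0// normrX expr2 mulrA ler_wpM2r//.
  by rewrite (le_trans (dL _ _))// ler_wpM2l// (min_max_dist cI).
have h2 : `|prim (J t) x - prim (J s) x - (t - s) * prim (Jt s) x| <= C * (t - s) ^+ 2 * `|x|.
  have c1 : continuous (fun x => J t x - J s x) by move=> p; apply: cvgB; exact: cJ.
  have c2 : continuous (fun x => (t - s) * Jt s x).
    by move=> p; apply: cvgM; [exact: cvg_cst|exact: cJt].
  rewrite -primB_fun// -primZ_fun// -primB_fun//; apply: prim_bound.
  - by move=> p; apply: cvgB; [exact: c1|exact: c2].
  - by rewrite mulr_ge0// sqr_ge0.
  - by move=> p; exact: JC.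
have h3 : 0 <= L * `|x| * (t - s) ^+ 2 by apply: mulr_ge0; [exact: mulr_ge0|exact: sqr_ge0].
have h4 : 0 <= C * (t - s) ^+ 2 by rewrite mulr_ge0// sqr_ge0.
rewrite (le_trans (lerD h1 h2))//.
have -> : (L + C) * (1 + `|x|) * (t - s) ^+ 2 = L * (t - s) ^+ 2 + C * (t - s) ^+ 2 * `|x| +
  (L * `|x| * (t - s) ^+ 2 + C * (t - s) ^+ 2) by ring.
by rewrite lerDl addr_ge0.
Qed.

Definition velocity t q := flow_t t (label t q).

(** Differentiating [flow t (label t q) = q] in time gives [label_t = - f label_x]. In quantitative
    form there are three errors: the second-order remainder of the flow in time, the change of
    [flow_t] from [x] to [x'], and the change of [J] from [x] to the mean value point [c]. *)
Lemma label_time_derivative t : 0 < t < T ->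
  sup_small 0^' (fun h q => h^-1 * (label (t + h) q - label t q) + velocity t q * stretch t q).
Proof.
move=> tI e e0.
have tI' : 0 <= t <= T by case/andP: tI => ? ?; rewrite !ltW.
have [N N0 XN] := label_bounded; have [C C0 XC] := label_lipschitz.
have [k k0 Jk] := Jt_bound; have [D D0 fD] := flow_taylor.
have e4 : 0 < e / (4 * M) by rewrite divr_gt0// mulr_gt0.
pose C1 := C + 1; have C10 : 0 < C1 by rewrite ltr_wpDl.
pose e1 := e / (4 * M * C1); have e10 : 0 < e1 by rewrite divr_gt0// !mulr_gt0.
have [d1 d10 d1E] := uniform_continuity (- N) N (@cJ t) e10.
pose k1 := k * C + D * (1 + N) + 1.
have k10 : 0 < k1 by rewrite ltr_wpDl ?addr_ge0 ?mulr_ge0 ?addr_ge0.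
have [d2 d20 d2E] := inner_ball tI.
(* For these radii the two errors of second order together, and the error on [J], contribute at most
   [e / 4] each after multiplication by [w <= M]. *)
pose d := Num.min d2 (Num.min (d1 / C1) (e / (4 * M * k1))).
have d0 : 0 < d by rewrite !lt_min d20 !divr_gt0// !mulr_gt0.
apply/near_dnbhs_eps; exists d => // h h0; rewrite subr0 !lt_min => /and3P[hd2 hd1 hk].
move=> q q01.
have thI : 0 < t + h < T by apply: d2E; rewrite addrC addKr.
have thI' : 0 <= t + h <= T by case/andP: thI => ? ?; rewrite !ltW.
set x := label t q; set x' := label (t + h) q.
have xx' : `|x' - x| <= C * `|h|.
  by have := XC (t + h) t q thI' tI' q01; rewrite [t + h - t]addrC addKr.
have xN : x \in `[- N, N] by rewrite in_itv/= -ler_norml; exact: XN.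
have x'N : x' \in `[- N, N] by rewrite in_itv/= -ler_norml; exact: XN.
have [|c cI cE] := @mean_value _ (flow t) (J t) x x'; first by move=> r _; exact: flow_derive.
have [|c' _ c'E] := @mean_value _ (flow_t t) (Jt t) x x'; first by move=> r _; exact: flow_t_derive.
have h1 : `|flow (t + h) x' - flow t x' - h * flow_t t x'| <= D * (1 + N) * h ^+ 2.
  have := fD t (t + h) x' tI thI; rewrite [t + h - t]addrC addKr => /le_trans; apply.
  rewrite ler_wpM2r ?sqr_ge0// ler_wpM2l// lerD2l; exact: XN.
have fx' : flow (t + h) x' = q by exact: labelK.
have fx : flow t x = q by exact: labelK.
have w0 : 0 < wc a b m M (y t) x by exact: wc_gt0.
have wM : wc a b m M (y t) x <= M by exact: wc_le.
have JxE : J t x * wc a b m M (y t) x = 1 by rewrite mulVf// gt_eqF.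
have cN : c \in `[- N, N] by exact: min_max_itv xN x'N cI.
have Jcx : `|J t c - J t x| <= e1.
  apply: ltW; apply: d1E => //.
  rewrite (le_lt_trans (min_max_dist cI))//.
  rewrite (le_lt_trans xx')//; move: hd1; rewrite ltr_pdivlMr// mulrC.
  by apply: le_lt_trans; rewrite ler_wpM2r// lerDl.
have E : h^-1 * (x' - x) + velocity t q * stretch t q =
  wc a b m M (y t) x * h^-1 *
   (- (flow (t + h) x' - flow t x' - h * flow_t t x') - h * (flow_t t x' - flow_t t x)
     - (J t c - J t x) * (x' - x)).
  rewrite /velocity /stretch -/x.
  have -> : flow t x' = J t c * (x' - x) + q by rewrite -cE fx subrK.
  rewrite fx'.
  transitivity (h^-1 * (x' - x) * (J t x * wc a b m M (y t) x) + h^-1 * h * (flow_t t x * wc a b m M (y t) x)).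
    by rewrite JxE mulVf// mulr1 mul1r.
  have aux (hi dx jx jc w p p' : R) : hi * dx * (jx * w) + hi * h * (p * w) =
    w * hi * (- (q - (jc * dx + q) - h * p') - h * (p' - p) - (jc - jx) * dx) by clear; ring.
  exact: aux.
have ha : 0 < `|h| by rewrite normr_gt0.
rewrite E !normrM normfV (gtr0_norm w0) -mulrA mulrCA ler_pdivrMl//.
have b1 : `|- (flow (t + h) x' - flow t x' - h * flow_t t x') - h * (flow_t t x' - flow_t t x)
     - (J t c - J t x) * (x' - x)| <= D * (1 + N) * h ^+ 2 + `|h| * (k * (C * `|h|)) + e1 * (C * `|h|).
  rewrite (le_trans (ler_normB _ _))// lerD//; last by rewrite normrM ler_pM.
  rewrite (le_trans (ler_normB _ _))// lerD// ?normrN//.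
  by rewrite c'E !normrM ler_wpM2l// ler_pM.
have hh : h ^+ 2 = `|h| * `|h| by rewrite -normrM -expr2 ger0_norm// sqr_ge0.
have b2 : D * (1 + N) * h ^+ 2 + `|h| * (k * (C * `|h|)) + e1 * (C * `|h|) <=
  `|h| * (k1 * `|h| + e1 * C1).
  have -> : D * (1 + N) * h ^+ 2 + `|h| * (k * (C * `|h|)) + e1 * (C * `|h|) =
    `|h| * ((D * (1 + N) + k * C) * `|h| + e1 * C) by rewrite hh; ring.
  apply: ler_wpM2l; first exact: ltW.
  apply: lerD; last by rewrite ler_wpM2l ?(ltW e10)// lerDl.
  by rewrite ler_wpM2r// /k1 [X in X <= _]addrC lerDl.
have b3 : k1 * `|h| <= e / (4 * M).
  move: hk; rewrite ltr_pdivlMr ?mulr_gt0// => /ltW hk.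
  rewrite ler_pdivlMr ?mulr_gt0//.
  by have -> : k1 * `|h| * (4 * M) = `|h| * (4 * M * k1) by ring.
have b4 : e1 * C1 = e / (4 * M).
  by rewrite /e1; field; rewrite !gt_eqF.
rewrite (le_trans (ler_pM (ltW w0) _ wM (le_trans b1 b2)))//.
rewrite mulrCA ler_wpM2l// b4.
have b5 : M * (e / (4 * M)) = e / 4 by field; rewrite gt_eqF.
rewrite mulrDr b5; have := ler_wpM2l (ltW M0) b3; rewrite b5; move: (M * _) => r re.
rewrite (le_trans (lerD re (lexx _)))// -subr_ge0.
have -> : e - (e / 4 + e / 4) = e / 2 by field.
by rewrite divr_ge0// ltW.
Qed.

End Good.

End FlowMap.

(** * Solutions from trajectories *)

Section LagrangianSolution.
Context (R : realType).
Local Notation mu := (@lebesgue_measure R).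
Variables (bc : boundary_kind) (a b a' b' : R -> R) (A m M B T : R) (y : R -> nat -> R).
Hypothesis ext : extended_data bc a b a' b' A.
Hypothesis traj : trajectory a b m M y B.
Hypothesis T0 : 0 <= T.
Hypothesis good : forall t, 0 <= t <= T -> good_time a b m M (y t).
Implicit Types (x s t q : R).

Local Notation w t := (wst a b (y t)).
Local Notation z t := (zst a b (y t)).
Local Notation J t := (Jc a b m M (y t)).
Local Notation Jt t := (Jtc a b m M (y t)).
Local Notation flow := (flow bc a b m M y).
Local Notation flow_t := (flow_t bc a b m M y).
Local Notation label := (label bc a b m M y).
Local Notation stretch := (stretch bc a b m M y).

Definition lag_f := velocity bc a b m M y.
Definition lag_W t q := w t (label t q).
Definition lag_Z t q := z t (label t q).
Definition lag_fx t q := - (lag_Z t q * (lag_W t q)^-1).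
Definition lag_rho t q := b (label t q) * (lag_W t q)^-1.
(** The space derivative of [w], for indices 1 and 2, or of [w_t], for 4 and 5, read at the label;
    the factor [stretch] is the space derivative of the label. *)
Let wx i j t q := (- (a' (label t q) * stretch t q) * y t i + b' (label t q) * stretch t q * y t j).
Definition lag_fxx t q :=
  - (wx 4 5 t q * (lag_W t q)^-1 + lag_Z t q * (- wx 1 2 t q * (lag_W t q)^-1 ^+ 2)).
Definition lag_rhox t q := b' (label t q) * stretch t q * (lag_W t q)^-1 +
  b (label t q) * (- wx 1 2 t q * (lag_W t q)^-1 ^+ 2).

Let ca := ext_ca ext.
Let cb := ext_cb ext.
Let aA := ext_aA ext.
Let bA := ext_bA ext.
Let A1 := ext_A1 ext.
Let m0 := traj_m0 traj.
Let m1 := traj_m1 traj.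
Let M1 := traj_M1 traj.
Let M0 : 0 < M. Proof. exact: lt_le_trans M1. Qed.
Let cJ t : continuous (J t). Proof. by have [_ _] := bl_Jc ca cb aA bA A1 m0 m1 M1; exact. Qed.
Let cJt t : continuous (Jt t). Proof. by have [_ _] := bl_Jtc ca cb aA bA A1 m0 m1 M1; exact. Qed.
Let clabel t : continuous (label t).
Proof. by move=> q; exact: is_derive_continuous (label_derive ext traj t q). Qed.
Let cflow_t t : continuous (flow_t t).
Proof. by move=> q; exact: is_derive_continuous (flow_t_derive ext traj t q). Qed.

Lemma lag_f_continuous t : continuous (lag_f t).
Proof.
move=> q; apply: (@continuous_comp _ _ _ (label t) (flow_t t)); first exact: clabel.
exact: cflow_t.
Qed.

(** By the chain rule, from [J_t = - w_t / w^2] and [label_x = w]. *)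
Lemma lag_f_derive t q : 0 <= t <= T -> is_derive q 1 (lag_f t) (lag_fx t q).
Proof.
move=> tT.
have D := @is_derive1_comp _ (flow_t t) (label t) q _ _ (flow_t_derive ext traj t (label t q))
  (label_derive ext traj t q).
apply: (is_derive_eq D); rewrite /lag_fx /lag_Z /lag_W /stretch /Jtc (JE good)// (zcE good)// (wcE good)//.
by field; rewrite gt_eqF// (w_gt0 traj good).
Qed.

Lemma label_transported g g' : (forall p q, ac p q g g') -> (forall p q, sqi p q g') ->
  transported T lag_f (fun t q => g (label t q)) (fun t q => g' (label t q) * stretch t q)
    (fun _ _ => 0).
Proof.
have [N N0 XN] := label_bounded T ext traj; have [C C0 XC] := label_lipschitz T ext traj.
apply: (transported_comp m0 N0 C0 (X := label) (xi := stretch) (Y := flow) (M := M)).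
- by move=> t _ q; exact: label_derive ext traj t q.
- by move=> t _; exact: stretch_continuous ext traj t.
- by move=> t _ q; exact: wc_ge.
- by move=> t _ q; exact: wc_le.
- by move=> t _; exact: flowK ext traj t.
- exact: XN.
- exact: XC.
- exact: stretch_sup ext traj.
- exact: label_time_derivative ext traj good.
- by move=> t _; apply: continuous_within; exact: lag_f_continuous.
Qed.

Let state_transported k : (k < 6)%N ->
  transported T lag_f (fun t _ => y t k) (fun _ _ => 0) (fun t _ => field a b m M (y t) k).
Proof.
move=> k6; apply: transported_time; first exact: trajectory_continuous traj k.
by move=> t /andP[t0 _]; exact: traj_derive traj t k t0.
Qed.

Let combination_transported i j k : (i < 6)%N -> (j < 6)%N -> (k < 6)%N ->
  transported T lag_f
    (fun t q => 1 * y t i + - a (label t q) * y t j + b (label t q) * y t k)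
    (wx j k)
    (fun t q => 1 * field a b m M (y t) i + - a (label t q) * field a b m M (y t) j +
                b (label t q) * field a b m M (y t) k).
Proof.
move=> i6 j6 k6.
have ta := label_transported (ext_ac_a ext) (ext_sqi_a ext).
have tb := label_transported (ext_ac_b ext) (ext_sqi_b ext).
have N1 : transported T lag_f (fun _ _ => - 1) (fun _ _ => 0) (fun _ _ => 0).
  by apply: (@transported_time _ _ _ (fun=> -1) (fun=> 0)) => t; exact: cvg_cst.
have tj := transportedM (transportedM N1 ta) (state_transported j6).
have tk := transportedM tb (state_transported k6).
apply: eq_transported (transportedD (transportedD (state_transported i6) tj) tk).
- by move=> t q _ _; ring.
- by move=> t q _ _; rewrite /wx; ring.
- by move=> t q _ _; ring.
Qed.

Let inner t : 0 < t < T -> 0 <= t <= T.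
Proof. by case/andP => ? ?; rewrite !ltW. Qed.

Let yM t k : 0 <= t <= T -> (k < 6)%N -> clamp (- M) M (y t k) = y t k.
Proof. by move=> tT k6; apply: clamp_id; rewrite -ler_norml; have [_ _ ->] := good tT. Qed.

Lemma lag_W_transported : transported T lag_f lag_W (wx 1 2) lag_Z.
Proof.
apply: eq_transported (@combination_transported 0 1 2 _ _ _) => // t q tT _.
by rewrite /lag_Z /zst /= !yM// inner.
Qed.

Let I t := Ic a b m M (y t).

(** The label is constant along the flow, so that only the coefficients, functions of time, are
    differentiated: [w] yields [w_t], which in turn yields [b - I w]. *)
Lemma lag_Z_transported : transported T lag_f lag_Z (wx 4 5)
  (fun t q => b (label t q) - I t * lag_W t q).
Proof.
apply: eq_transported (@combination_transported 3 4 5 _ _ _) => // t q tT _.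
by rewrite /lag_W /wst /I /= !yM ?inner//; ring.
Qed.

Let W_ge t q : 0 <= t <= T -> 0 <= q <= 1 -> m <= lag_W t q.
Proof. by move=> tT _; have [/(_ (label t q))/andP[]] := good tT. Qed.

Let WVt := transportedV m0 W_ge lag_W_transported.

(** For the derivation along the flow, [- Z / W] has derivative [- (b - I W) / W + Z^2 / W^2]. This
    is the first equation of the system, with [Ic] in place of the nonlocal term. *)
Lemma lag_fx_transported : transported T lag_f lag_fx lag_fxx
  (fun t q => - lag_rho t q + I t + lag_fx t q ^+ 2).
Proof.
have N1 : transported T lag_f (fun _ _ => - 1) (fun _ _ => 0) (fun _ _ => 0).
  by apply: (@transported_time _ _ _ (fun=> -1) (fun=> 0)) => t; exact: cvg_cst.
apply: eq_transported (transportedM N1 (transportedM lag_Z_transported WVt)) => t q tT q01.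
- by rewrite /lag_fx; ring.
- by rewrite /lag_fxx; ring.
- have W0 : lag_W t q != 0 by rewrite gt_eqF// (lt_le_trans m0)// W_ge// inner.
  by rewrite /lag_fx /lag_rho; field.
Qed.

(** As [b] at the label is constant along the flow, the quotient rule leaves [- b Z / W^2]; this is
    the second equation of the system. *)
Lemma lag_rho_transported : transported T lag_f lag_rho lag_rhox
  (fun t q => lag_rho t q * lag_fx t q).
Proof.
have tb := label_transported (ext_ac_b ext) (ext_sqi_b ext).
apply: eq_transported (transportedM tb WVt) => t q tT q01 //.
have W0 : lag_W t q != 0 by rewrite gt_eqF// (lt_le_trans m0)// W_ge// inner.
by rewrite /lag_fx /lag_rho; field.
Qed.

(** [J] is periodic with integral 1, so that its primitive gains exactly 1 over a period and the
    flow descends to the circle. *)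
Let flow_shift t x : 0 <= t <= T -> bc = Periodic -> flow t (x + 1) = flow t x + 1.
Proof.
move=> tT bcE; rewrite /flow prim_periodic//.
  by rewrite (unit_mass ext traj good tT).1 addrA.
move=> q; have := ext_boundary ext; rewrite bcE => /(_ q)[aq bq].
by rewrite /Jc /wc /wst aq bq.
Qed.

Let bcP : bc = Dirichlet \/ bc = Periodic.
Proof. by case: bc; [left|right]. Qed.

Lemma label_periodic t : 0 <= t <= T -> bc = Periodic -> label t 1 = label t 0 + 1.
Proof.
move=> tT bcE; apply: (@flow_inj _ _ a b a' b' A m M B y ext traj t).
by rewrite (labelK ext traj) flow_shift// (labelK ext traj) add0r.
Qed.

Lemma label_dirichlet t : 0 <= t <= T -> bc = Dirichlet ->
  label t 0 = 0 /\ label t 1 = 1.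
Proof.
move=> tT bcE; have d0 : \int[mu]_(s in `[0, t]) drift bc a b m M (y s) = 0.
  by rewrite /drift bcE int_cst ?mul0r//; case/andP: tT.
split; apply: (@flow_inj _ _ a b a' b' A m M B y ext traj t); rewrite (labelK ext traj).
  by rewrite /flow prim0 addr0 d0.
by rewrite /flow prim_pos// (unit_mass ext traj good tT).1 d0 add0r.
Qed.

Let periodic_ab x : bc = Periodic -> a (x + 1) = a x /\ b (x + 1) = b x.
Proof. by move=> bcE; have := ext_boundary ext; rewrite bcE; exact. Qed.

(** The change of variables by the flow. In the periodic case it leads to the window of length 1
    starting at [label t 0], which periodicity moves back to [0,1]. *)
Lemma label_integral t (g : R -> R) : 0 <= t <= T -> continuous g ->
  (bc = Periodic -> forall x, g (x + 1) = g x) ->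
  \int[mu]_(q in `[0, 1]) g (label t q) = \int[mu]_(x in `[0, 1]) (g x * J t x).
Proof.
move=> tT cg pg.
have cgl : continuous (fun q => g (label t q)).
  by move=> q; apply: (@continuous_comp _ _ _ (label t) g); [exact: clabel|exact: cg].
have cgJ : continuous (fun x => g x * J t x).
  by move=> x; apply: cvgM; [exact: cg|exact: cJ].
have J0 x : 0 < J t x by rewrite invr_gt0 wc_gt0.
have l01 : label t 0 <= label t 1.
  have [bcE|bcE] := bcP; first by have [-> ->] := label_dirichlet tT bcE.
  by rewrite label_periodic// lerDl.
have := @cov_Rintegral _ (flow t) (label t) (J t) (flow_derive ext traj t) (@cJ t) J0
  (labelK ext traj t) (fun q => g (label t q)) _ _ l01 _.
rewrite !(labelK ext traj) => -> //; last exact: itg_continuous.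
under eq_Rintegral do rewrite (flowK ext traj).
have [bcE|bcE] := bcP; first by have [-> ->] := label_dirichlet tT bcE.
rewrite label_periodic//; apply: int_window => // x; rewrite pg// /Jc /wc /wst.
by have [-> ->] := periodic_ab x bcE.
Qed.

Let flow_t_shift t x : 0 <= t <= T -> bc = Periodic -> flow_t t (x + 1) = flow_t t x.
Proof.
move=> tT bcE; rewrite /flow_t prim_periodic//.
  by rewrite (unit_mass ext traj good tT).2 addr0.
by move=> q; have [aq bq] := periodic_ab q bcE; rewrite /Jtc /Jc /wc /zc /wst /zst aq bq.
Qed.

Lemma lag_f_dirichlet t : 0 <= t <= T -> bc = Dirichlet -> lag_f t 0 = 0 /\ lag_f t 1 = 0.
Proof.
move=> tT bcE; have [l0 l1] := label_dirichlet tT bcE; rewrite /lag_f /velocity l0 l1.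
rewrite /flow_t prim0 (prim_pos _ ler01) (unit_mass ext traj good tT).2 addr0.
by rewrite /drift bcE.
Qed.

Lemma lag_f_periodic t : 0 <= t <= T -> bc = Periodic ->
  lag_f t 0 = lag_f t 1 /\ \int[mu]_(q in `[0, 1]) lag_f t q = 0.
Proof.
move=> tT bcE; rewrite /lag_f /velocity; split; first by rewrite label_periodic// flow_t_shift.
rewrite label_integral//; last by move=> _ x; exact: flow_t_shift.
have cp : continuous (prim (Jt t)).
  by apply: prim_continuous => ? ?; exact: itg_continuous.
have i1 : itg `[0, 1] (fun x => drift bc a b m M (y t) * J t x).
  by apply: itgZ => //; exact: itg_continuous.
have i2 : itg `[0, 1] (fun x => prim (Jt t) x * J t x).
  by apply: itg_continuous => x; apply: cvgM; [exact: cp|exact: cJ].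
rewrite /flow_t; under eq_Rintegral do rewrite mulrDl.
rewrite RintegralD; [|by []|exact: i1|exact: i2].
rewrite RintegralZl; [|by []|exact: itg_continuous].
(* The first integral is [drift], as [J] has integral 1; it is [Qc], the opposite of the second
   integral. *)
rewrite (unit_mass ext traj good tT).1 mulr1 /drift bcE /Qc addrC.
apply/eqP; rewrite subr_eq0; apply/eqP; apply: int_eq => x; rewrite /= in_itv/= => x01.
by rewrite clamp_id.
Qed.

(** The loop closes: the [Ic] that was put into the differential equation is the nonlocal term of
    the functions constructed from its solution. *)
Lemma lag_nonlocal t : 0 <= t <= T -> nonlocal (lag_fx t) (lag_rho t) = I t.
Proof.
move=> tT.
have bw := bl_wc ca cb aA bA A1 m1 M1; have bz := bl_zc ca cb aA bA A1 M1.
have bJ := bl_Jc ca cb aA bA A1 m0 m1 M1.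
pose g x := b x * J t x; pose h x := (zc a b M (y t) x) ^+ 2 * J t x ^+ 2.
have cg : continuous g by have [_ _] := blM (bl_fun cb bA) bJ; exact.
have ch : continuous h by have [_ _] := blM (blX 2 bz) (blX 2 bJ); exact.
rewrite /nonlocal /I /Ic; congr (_ - 2 * _).
- transitivity (\int[mu]_(q in `[0, 1]) g (label t q)).
    by apply: int_eq => q _; rewrite /lag_rho /g (JE good).
  rewrite (label_integral (g := g))//.
    by apply: int_eq => x _; rewrite /g expr2 mulrA.
  by move=> bcE x; have [aq bq] := periodic_ab x bcE; rewrite /g /Jc /wc /wst aq bq.
- transitivity (\int[mu]_(q in `[0, 1]) h (label t q)).
    by apply: int_eq => q _; rewrite /lag_fx /h (JE good)// (zcE good)// -exprMn sqrrN.
  rewrite (label_integral (g := h))//.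
    by apply: int_eq => x _; rewrite /h -mulrA -exprSr.
  move=> bcE x; have [aq bq] := periodic_ab x bcE.
  by rewrite /h /Jc /wc /zc /wst /zst aq bq.
Qed.

Lemma label0 q : label 0 q = q.
Proof.
have T00 : 0 <= (0 : R) <= T by rewrite lexx.
apply: (@flow_inj _ _ a b a' b' A m M B y ext traj 0).
rewrite (labelK ext traj) /flow int_point add0r.
have J1 x : J 0 x = 1 by rewrite (JE good)// /wst !(traj_init traj)/= ; field.
have -> : J 0 = fun=> 1 by apply/funext.
rewrite /prim; have [q0|/ltW q0] := leP 0 q.
  rewrite int_cst// subr0 mul1r; have [->|qN0] := eqVneq q 0; first by rewrite int_point subrr.
  by rewrite [X in _ = _ - X]int_empty ?subr0// lt_neqAle eq_sym qN0.
rewrite [X in _ = _ - X]int_cst// sub0r mul1r opprK.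
have [->|qN0] := eqVneq q 0; first by rewrite int_point add0r.
by rewrite int_empty ?add0r// lt_neqAle qN0.
Qed.

Lemma lag_initial q : lag_fx 0 q = a q /\ lag_rho 0 q = b q.
Proof.
by rewrite /lag_fx /lag_rho /lag_Z /lag_W label0 /wst /zst !(traj_init traj)/=; split; field.
Qed.

End LagrangianSolution.

Section Norms.
Context (R : realType).
Implicit Types (u v w : R -> R) (e : R).

Lemma H2_normE u v w : sqi 0 1 u -> sqi 0 1 v -> sqi 0 1 w ->
  H2_norm u v w = Num.sqrt (nsq 0 1 u + nsq 0 1 v + nsq 0 1 w).
Proof. by move=> su sv sw; rewrite /H2_norm !L2_norm_sqr. Qed.

Lemma H1_normE u v : sqi 0 1 u -> sqi 0 1 v ->
  H1_norm u v = Num.sqrt (nsq 0 1 u + nsq 0 1 v).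
Proof. by move=> su sv; rewrite /H1_norm !L2_norm_sqr. Qed.

Lemma sqrt_norm_lt (x e : R) : 0 < e -> x < e ^+ 2 -> `|Num.sqrt x| < e.
Proof.
move=> e0 xe; rewrite ger0_norm ?sqrtr_ge0//.
rewrite -(ltr_pXn2r (n := 2)) ?nnegrE ?sqrtr_ge0 ?(ltW e0)//.
have [x0|/ltW x0] := leP 0 x; first by rewrite sqr_sqrtr.
by rewrite (ler0_sqrtr x0) expr0n exprn_gt0.
Qed.

End Norms.

(** * The Lagrangian functions satisfy the definition of a solution *)

Section Existence.
Context (R : realType).
Local Notation mu := (@lebesgue_measure R).
Variables (bc : boundary_kind) (a b a' b' f0 rho0 : R -> R) (A m M B T : R).
Variable (y : R -> nat -> R).
Hypothesis ext : extended_data bc a b a' b' A.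
Hypothesis traj : trajectory a b m M y B.
Hypothesis T0 : 0 <= T.
Hypothesis good : forall t, 0 <= t <= T -> good_time a b m M (y t).
Hypothesis f0a : ac 0 1 f0 a.
Hypothesis rho0b : forall x, 0 <= x <= 1 -> rho0 x = b x.
Hypothesis f0_boundary : match bc with
  | Dirichlet => f0 0 = 0
  | Periodic => \int[mu]_(x in `[0, 1]) f0 x = 0 end.
Implicit Types (x s t q e : R).

Local Notation f := (lag_f bc a b m M y).
Local Notation fx := (lag_fx bc a b m M y).
Local Notation fxx := (lag_fxx bc a b a' b' m M y).
Local Notation rho := (lag_rho bc a b m M y).
Local Notation rhox := (lag_rhox bc a b a' b' m M y).

Let tfx := lag_fx_transported ext traj good.
Let trho := lag_rho_transported ext traj good.

Let bcP : bc = Dirichlet \/ bc = Periodic.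
Proof. by case: bc; [left|right]. Qed.

Let itv t (S : R) : t \in `[0, S] -> 0 <= t <= S. Proof. by rewrite in_itv. Qed.

Let acf t : 0 <= t <= T -> ac 0 1 (f t) (fx t).
Proof.
move=> tT; apply: derive_ac; first by move=> x _; exact: lag_f_derive ext traj good t x tT.
exact: ac_continuous (tr_ac tfx tT).
Qed.

Let sfx t : 0 <= t <= T -> sqi 0 1 (fx t).
Proof. by move=> tT; apply: sqi_within; exact: ac_continuous (tr_ac tfx tT). Qed.

Let sf t : 0 <= t <= T -> sqi 0 1 (f t).
Proof. by move=> tT; apply: sqi_within; exact: ac_continuous (acf tT). Qed.

Let srho t : 0 <= t <= T -> sqi 0 1 (rho t).
Proof. by move=> tT; apply: sqi_within; exact: ac_continuous (tr_ac trho tT). Qed.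

(** Both functions obey the same normalisation, so that their difference is controlled by its
    derivative. It serves for the increments of [f] in time and for its initial value. *)
Let mean_f g g' h h' x : ac 0 1 g g' -> ac 0 1 h h' -> sqi 0 1 g' -> sqi 0 1 h' ->
  (match bc with Dirichlet => g 0 = 0 /\ h 0 = 0
   | Periodic => \int[mu]_(x in `[0, 1]) g x = 0 /\ \int[mu]_(x in `[0, 1]) h x = 0 end) ->
  0 <= x <= 1 -> (g x - h x) ^+ 2 <= nsq 0 1 (fun x => g' x - h' x).
Proof.
move=> ag ah sg sh gh0 x01.
have agh : ac 0 1 (fun x => g x - h x) (fun x => g' x - h' x).
  by apply: eq_ac (acD ag (acZ (-1) ah)) => z _; ring.
apply: (ac_sub_mean agh) => //; first exact: sqiB.
case: bc gh0 => [[g0 h0]|[g0 h0]]; [right|left].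
  by rewrite g0 h0 subrr.
rewrite RintegralB; [|by []|exact: itg_cont (ac_continuous ag)|exact: itg_cont (ac_continuous ah)].
by rewrite g0 h0 subrr.
Qed.

Let match_and (P Q P' Q' : Prop) :
  match bc with Dirichlet => P | Periodic => Q end ->
  match bc with Dirichlet => P' | Periodic => Q' end ->
  match bc with Dirichlet => P /\ P' | Periodic => Q /\ Q' end.
Proof. by case: bc. Qed.

Let f_mean t : 0 <= t <= T ->
  match bc with Dirichlet => f t 0 = 0 | Periodic => \int[mu]_(x in `[0, 1]) f t x = 0 end.
Proof.
move=> tT; have [bcE|bcE] := bcP.
  by have [f00 _] := lag_f_dirichlet ext traj good tT bcE; move: f00; rewrite bcE.
by have [_ f00] := lag_f_periodic ext traj good tT bcE; move: f00; rewrite bcE.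
Qed.

Let f_sub s t x : 0 <= s <= T -> 0 <= t <= T -> 0 <= x <= 1 ->
  (f s x - f t x) ^+ 2 <= nsq 0 1 (fun x => fx s x - fx t x).
Proof.
move=> sT tT; apply: mean_f; try exact: acf; try exact: sfx.
exact: match_and (f_mean sT) (f_mean tT).
Qed.

Let nsq_f_sub s t : 0 <= s <= T -> 0 <= t <= T ->
  nsq 0 1 (f s \- f t) <= nsq 0 1 (fx s \- fx t).
Proof.
move=> sT tT; have n0 := nsq_ge0 0 1 (fx s \- fx t).
rewrite -[leRHS]sqr_sqrtr// -[leRHS]mulr1 -[X in _ * X]subr0.
apply: nsq_bounded => //; first exact: measurable_funB (sf sT).1 (sf tT).1.
by move=> x x01; rewrite -sqrtr_sqr ler_wsqrtr//; exact: f_sub.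
Qed.

Let I_eq t : 0 <= t <= T -> nonlocal (fx t) (rho t) = Ic a b m M (y t).
Proof. by move=> tT; exact: lag_nonlocal ext traj good t tT. Qed.

Let small_l2 (u ux d : R -> R -> R) t : 0 <= t <= T -> transported T f u ux d ->
  l2_small (within `[0, T] (nbhs t)) (fun s x => u s x - u t x).
Proof.
move=> tT tu; apply: sup_l2_small (tr_sup tu tT).
near=> s; have sT : 0 <= s <= T by near: s; exact: near_at_time.
by apply: measurable_funB; exact: tr_measurable tu _.
Unshelve. all: by end_near. Qed.

Lemma lagrangian_solution : solution bc f0 rho0 T f fx fxx rho rhox.
Proof.
have inner t : t \in `]0, T[ -> 0 < t < T by rewrite in_itv.
have le_inner t : 0 < t < T -> 0 <= t <= T by case/andP => ? ?; rewrite !ltW.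
split.
- move=> t /itv tT; split; apply/H1P; split.
  + exact: acf.
  + exact: sfx.
  + exact: (tr_ac tfx tT).
  + exact: (tr_sqi tfx tT).
(* Each of the three squared norms is at most [e ^+ 2 / 4], the one of [f] being bounded by the one
   of [f_x]. *)
- apply/vanishes_on_diagonalP => t tT e e0; have e3 : 0 < e ^+ 2 / 4 by rewrite divr_gt0// exprn_gt0.
  have h1 := small_l2 tT tfx e3; have h2 := tr_l2 tfx tT e3.
  near=> s; have sT : 0 <= s <= T by near: s; exact: near_at_time.
  have [s1 n1] : sqi 0 1 (fx s \- fx t) /\ nsq 0 1 (fx s \- fx t) <= e ^+ 2 / 4 by near: s.
  have [s2 n2] : sqi 0 1 (fxx s \- fxx t) /\ nsq 0 1 (fxx s \- fxx t) <= e ^+ 2 / 4 by near: s.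
  have s0 : sqi 0 1 (f s \- f t) by exact: sqiB (sf sT) (sf tT).
  have n0 := nsq_f_sub sT tT.
  rewrite H2_normE//; apply: sqrt_norm_lt => //; lra.
- move=> t /itv tT; have [k Hk] := tr_bounded tfx.
  have k0 : 0 <= k by apply: le_trans (Hk t 0 tT _) => //; rewrite lexx ler01.
  by have [] := Linf_bounded k0 (sfx tT).1 (fun x => Hk t x tT).
- apply/vanishes_on_diagonalP => t tT e e0; have e2 : 0 < e / 2 by rewrite divr_gt0.
  have h1 := tr_sup tfx tT e2.
  near=> s; have sT : 0 <= s <= T by near: s; exact: near_at_time.
  have n1 : forall x, 0 <= x <= 1 -> `|(fx s \- fx t) x| <= e / 2 by near: s.
  have [_ /andP[n0 n2]] := Linf_bounded (ltW e2) (measurable_funB (sfx sT).1 (sfx tT).1) n1.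
  by rewrite ger0_norm//; lra.
- move=> t /itv tT; apply/H1P; split; [exact: (tr_ac trho tT)|exact: (tr_sqi trho tT)].
- apply/vanishes_on_diagonalP => t tT e e0; have e3 : 0 < e ^+ 2 / 4 by rewrite divr_gt0// exprn_gt0.
  have h1 := small_l2 tT trho e3; have h2 := tr_l2 trho tT e3.
  near=> s; have sT : 0 <= s <= T by near: s; exact: near_at_time.
  have [s1 n1] : sqi 0 1 (rho s \- rho t) /\ nsq 0 1 (rho s \- rho t) <= e ^+ 2 / 4 by near: s.
  have [s2 n2] : sqi 0 1 (rhox s \- rhox t) /\ nsq 0 1 (rhox s \- rhox t) <= e ^+ 2 / 4 by near: s.
  rewrite H1_normE//; apply: sqrt_norm_lt => //; lra.
- move=> t /itv tT; have [bcE|bcE] := bcP.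
    have [f00 f01] := lag_f_dirichlet ext traj good tT bcE.
    have [l0 l1] := label_dirichlet ext traj good tT bcE.
    have [b0 b1] : b 0 = 0 /\ b 1 = 0 by have := ext_boundary ext; rewrite bcE.
    have BE u v r : [/\ u 0 = 0, u 1 = 0, r 0 = 0 & r 1 = 0] -> boundary_conditions (R := R) bc u v r.
      by rewrite bcE.
    by apply: BE; rewrite /lag_rho l0 l1 b0 b1 !mul0r.
  have [f01 fi] := lag_f_periodic ext traj good tT bcE.
  have l1 := label_periodic ext traj good tT bcE.
  have /(_ (label bc a b m M y t 0))[a1 b1] : forall x, a (x + 1) = a x /\ b (x + 1) = b x.
    by have := ext_boundary ext; rewrite bcE.
  have BE u v r : [/\ u 0 = u 1, v 0 = v 1, r 0 = r 1 & \int[mu]_(x in `[0, 1]) u x = 0] ->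
      boundary_conditions (R := R) bc u v r by rewrite bcE.
  by apply: BE; rewrite /lag_fx /lag_rho /lag_Z /lag_W l1 /wst /zst a1 b1.
- move=> x /itv x01; have T00 : 0 <= (0 : R) <= T by rewrite lexx.
  have [_ r0] := lag_initial ext traj T0 good x; rewrite r0 rho0b//; split=> //.
  have fa z : fx 0 z = a z by have [] := lag_initial ext traj T0 good z.
  have sa : sqi 0 1 a by apply: sqi_continuous; exact: ext_ca ext.
  (* At time 0 the construction gives [f_x = a]; [f] itself is identified through the normalisation
     it shares with [f0]. *)
  have H : (f 0 x - f0 x) ^+ 2 <= nsq 0 1 (fun x => fx 0 x - a x).
    apply: mean_f => //; [exact: acf|exact: sfx|].
    exact: match_and (f_mean T00) f0_boundary.
  have E0 : nsq 0 1 (fun x => fx 0 x - a x) = 0.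
    rewrite /nsq (@int_eq _ _ _ (fun=> 0)); first by rewrite int_cst ?mul0r.
    by move=> z _; rewrite fa subrr expr0n.
  apply/eqP; rewrite -subr_eq0 -sqrf_eq0; apply/eqP/le_anti.
  by rewrite sqr_ge0 -[X in _ <= X]E0 H.
- move=> t /inner tI; have tT := le_inner _ tI.
  exists (fun x => - rho t x + Ic a b m M (y t) + fx t x ^+ 2 - f t x * fxx t x).
    exact: (proj2 (L2_time_derivativeP _ tI sfx)) (tr_derivative tfx tI).
  by apply: aeW => x _; rewrite I_eq//; ring.
- move=> t /inner tI; have tT := le_inner _ tI.
  exists (fun x => rho t x * fx t x - f t x * rhox t x).
    exact: (proj2 (L2_time_derivativeP _ tI srho)) (tr_derivative trho tI).
  by apply: aeW => x _; ring.
Unshelve. all: by end_near. Qed.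

End Existence.

(** * Local existence *)

Section Gluing.
Context (R : realType).
Local Notation mu := (@lebesgue_measure R).
Implicit Types (u v f g : R -> R) (p q r x : R) (N k : nat).

Lemma eq_measurable_open p q f g : (forall x, p < x < q -> f x = g x) ->
  measurable_fun `[p, q] f -> measurable_fun `[p, q] g.
Proof.
move=> fg mf; apply: (@measurable_fun_itv_cc _ _ _ false true).
apply: (@eq_measurable_fun _ _ _ _ _ f); first by move=> x; rewrite inE/= in_itv/=; exact: fg.
by apply: (measurable_funS _ _ mf) => //; exact: subset_itv_oo_cc.
Qed.

Lemma eq_itg_open p q f g : (forall x, p < x < q -> f x = g x) -> itg `[p, q] f ->
  itg `[p, q] g /\ \int[mu]_(x in `[p, q]) f x = \int[mu]_(x in `[p, q]) g x.
Proof.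
move=> fg itgf; have mf := itg_measurable itgf; have mg := eq_measurable_open fg mf.
have sub : (`]p, q[ : set R) `<=` (`[p, q] : set R) by exact: subset_itv_oo_cc.
have open_int (h k : R -> \bar R) : (forall x, p < x < q -> h x = k x) ->
    measurable_fun `[p, q] h -> measurable_fun `[p, q] k ->
    (\int[mu]_(x in `[p, q]) h x = \int[mu]_(x in `[p, q]) k x)%E.
  move=> hk mh mk; rewrite !integral_itv_bndoo//; try exact: measurable_funS sub _.
  by apply: eq_integral => x; rewrite inE/= in_itv/=; exact: hk.
split; last first.
  rewrite /Rintegral; congr fine; apply: open_int.
  - by move=> x /fg ->.
  - exact/measurable_EFinP.
  - exact/measurable_EFinP.
apply/integrableP; split; first exact/measurable_EFinP.
rewrite -(open_int (fun x => `|(f x)%:E|)%E).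
- by have /integrableP[] := itgf.
- by move=> x /fg ->.
- by apply: measurableT_comp => //; exact/measurable_EFinP.
- by apply: measurableT_comp => //; exact/measurable_EFinP.
Qed.

Definition sobolev p q u v := ac p q u v /\ sqi p q v.

Lemma sobolev_sub p q r x u v : p <= r -> x <= q -> sobolev p q u v -> sobolev r x u v.
Proof. by move=> pr xq [A S]; split; [exact: ac_sub A|exact: sqi_sub S]. Qed.

(** The end points are a null set for the derivative, so that pieces can be glued whatever the
    values of the derivative at the junctions. *)
Lemma eq_sobolev p q u v u' v' : (forall x, p <= x <= q -> u x = u' x) ->
  (forall x, p < x < q -> v x = v' x) -> sobolev p q u v -> sobolev p q u' v'.
Proof.
move=> uu' vv' [[iv uE] [mv iv2]]; split; split.
- by have [] := eq_itg_open vv' iv.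
- move=> x z px xz zq; have xI : p <= x <= q by rewrite px (le_trans xz).
  have zI : p <= z <= q by rewrite zq (le_trans px).
  rewrite -(uu' _ xI) -(uu' _ zI) uE//.
  suff vv : forall r, x < r < z -> v r = v' r by case: (eq_itg_open vv (itg_sub px zq iv)).
  by move=> r /andP[xr rz]; apply: vv'; rewrite (le_lt_trans px)// (lt_le_trans rz).
- exact: eq_measurable_open vv' mv.
- have [] := @eq_itg_open p q (fun x => v x ^+ 2) (fun x => v' x ^+ 2) _ iv2 => //.
  by move=> x /vv' ->.
Qed.

Lemma sobolev_cat p q r u v : p <= q -> q <= r -> sobolev p q u v -> sobolev q r u v ->
  sobolev p r u v.
Proof.
move=> pq qr [[i1 u1] s1] [[i2 u2] s2].
have iv : itg `[p, r] v by exact: itg_cat i1 i2.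
split; split => //.
- move=> x z px xz zr; case/orP: (le_total z q) => zq; first exact: u1.
  case/orP: (le_total q x) => qx; first exact: u2.
  rewrite (int_cat qx zq (itg_sub px zr iv)) -u1// -u2//; ring.
- exact: itg_measurable iv.
- exact: itg_cat s1.2 s2.2.
Qed.

Lemma sobolev_shift p q r u v : p <= q -> sobolev p q u v ->
  sobolev (p + r) (q + r) (fun x => u (x - r)) (fun x => v (x - r)).
Proof.
move=> pq [[iv uE] sv].
have dX (x : R) : is_derive x 1 (fun x => x - r) ((fun=> 1) x).
  by have := is_deriveB (is_derive_id (x : R) 1) (is_derive_cst (r : R) (x : R) 1); rewrite subr0.
have cX : continuous (fun _ : R => 1 : R) by move=> x; exact: cvg_cst.
have X0 (x : R) : 0 < (fun _ : R => 1 : R) x by [].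
have XK : cancel (fun x => x + r) (fun x => x - r) by move=> x; rewrite addrK.
have itg_shift f x z : x <= z -> itg `[x, z] f -> itg `[x + r, z + r] (fun x => f (x - r)).
  move=> xz ig; have := @cov_itg _ _ _ _ dX cX X0 XK f (x + r) (z + r).
  rewrite !addrK lerD2r => /(_ xz ig); apply: eq_itg => // t _; exact: mulr1.
split; split.
- exact: itg_shift.
- move=> x z px xz zq.
  have := @cov_Rintegral _ _ _ _ dX cX X0 XK v x z xz.
  have px' : p <= x - r by rewrite lerBrDr.
  have zq' : z - r <= q by rewrite lerBlDr.
  move=> /(_ (itg_sub px' zq' iv)) E.
  rewrite uE ?lerD2r// E; apply: int_eq => t _; exact: mulr1.
- exact: itg_measurable (itg_shift _ _ _ pq (sqi_itg sv)).
- exact: itg_shift _ _ _ pq sv.2.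
Qed.

Lemma sobolev_line u v : (forall N, sobolev (- N%:R) (N%:R) u v) ->
  forall p q, sobolev p q u v.
Proof.
move=> H p q; pose N := (Num.truncn `|p| + Num.truncn `|q| + 2)%N.
have h (x : R) : `|x| <= (Num.truncn `|x| + 1)%:R.
  by rewrite addn1 ltW// truncnS_gt.
apply: sobolev_sub (H N); have := h p; have := h q; rewrite !ler_norml /N !natrD;
  have := ler0n R (Num.truncn `|p|); have := ler0n R (Num.truncn `|q|) =>
  ? ? /andP[? ?] /andP[? ?]; lra.
Qed.

(** Constants on both sides are glued to [u]; no condition on its boundary values is needed for
    continuity. *)
Lemma constant_extension u v : sobolev 0 1 u v ->
  exists v', forall p q, sobolev p q (fun x => u (clamp 0 1 x)) v'.
Proof.
move=> uv; exists (fun x => if 0 <= x <= 1 then v x else 0); apply: sobolev_line => N.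
have cst p q (c : R) : sobolev p q (fun=> c) (fun=> 0) by split; [exact: ac_cst|exact: sqi_cst].
pose n : R := (N + 1)%:R; have n1 : 1 <= n by rewrite ler1n addn1.
have : sobolev (- n) n (fun x => u (clamp 0 1 x)) (fun x => if 0 <= x <= 1 then v x else 0).
  have n0 : - n <= 0 by lra.
  apply: (sobolev_cat n0 (ler0n _ _)).
    apply: eq_sobolev (cst _ _ (u 0)) => x /andP[nx x0].
      by rewrite /clamp (min_idPl _) ?(max_idPl _)//; lra.
    by rewrite leNgt x0.
  apply: (sobolev_cat ler01 n1).
    apply: eq_sobolev uv => x x01; first by rewrite clamp_id.
    by case/andP: x01 => ? ?; rewrite !ltW.
  apply: eq_sobolev (cst _ _ (u 1)) => x /andP[x1 xn].
    by rewrite /clamp (min_idPr _)// (max_idPr _).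
  by rewrite [X in _ && X]leNgt x1 andbF.
by apply: sobolev_sub; rewrite ?lerN2 ler_nat leq_addr.
Qed.

Definition frac x : R := x - (Num.floor x)%:~R.

Lemma frac_itv x : 0 <= frac x < 1.
Proof.
rewrite /frac subr_ge0 floor_le/= ltrBlDl.
by have := floorD1_gt x; rewrite intrD.
Qed.

Lemma fracD1 x : frac (x + 1) = frac x.
Proof. by rewrite /frac floorDrz ?rpred1// floor1 intrD; ring. Qed.

Lemma frac_id x : 0 <= x < 1 -> frac x = x.
Proof. by move=> x01; rewrite /frac (@floor_def _ x 0) ?subr0. Qed.

Lemma periodic_extension u v : sobolev 0 1 u v -> u 0 = u 1 ->
  exists v', forall p q, sobolev p q (fun x => u (frac x)) v'.
Proof.
move=> uv u01; exists (fun x => v (frac x)); apply: sobolev_line => N.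
have piece (n : int) : sobolev n%:~R (n%:~R + 1) (fun x => u (frac x)) (fun x => v (frac x)).
  have fl x : n%:~R <= x < n%:~R + 1 -> frac x = x - n%:~R.
    by move=> xn; rewrite /frac (@floor_def _ x n)// intrD.
  have := sobolev_shift n%:~R ler01 uv; rewrite add0r addrC.
  apply: eq_sobolev => x /andP[nx xn].
    (* At the right end of a piece the fractional part has jumped back to 0, and the values match
       because [u 0 = u 1]. *)
    move: xn; rewrite le_eqVlt => /orP[/eqP ->|xn]; last by rewrite fl// nx.
    have -> : n%:~R + 1 - n%:~R = 1 :> R by ring.
    by rewrite fracD1 fl ?lexx ?ltrDl ?ltr01// subrr.
  by rewrite fl// (ltW nx).
have all_pieces k : sobolev (- N%:R) (- N%:R + k.+1%:R) (fun x => u (frac x)) (fun x => v (frac x)).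
  elim: k => [|k IH]; first by have := piece (- N%:Z); rewrite mulrNz.
  have -> : - N%:R + k.+2%:R = (- N%:Z + k.+1%:Z)%:~R + 1 :> R.
    by rewrite intrD mulrNz -[k.+2%:R]natr1 addrA.
  have E : (- N%:Z + k.+1%:Z)%:~R = - N%:R + k.+1%:R :> R by rewrite intrD mulrNz.
  apply: sobolev_cat IH _; rewrite -?E; last exact: piece.
    by rewrite E lerDl.
  by rewrite lerDl.
apply: sobolev_sub (all_pieces (N + N)%N) => //.
by rewrite -natr1 natrD; lra.
Qed.

End Gluing.

(** * Extension of the initial data to the real line *)

Section Extension.
Context (R : realType).
Local Notation mu := (@lebesgue_measure R).
Implicit Types (u v : R -> R) (x : R).

Lemma ac_line_continuous u v : (forall p q, ac p q u v) -> continuous u.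
Proof.
move=> auv x; apply/continuous_eps => e e0.
have /within_continuousP/(_ x) := ac_continuous (auv (x - 1) (x + 1)).
rewrite /= in_itv/= => /(_ _ e e0)[|d d0 dE]; first by apply/andP; split; lra.
exists (Num.min d 1); first by rewrite lt_min d0 ltr01.
move=> z; rewrite lt_min => /andP[zd z1]; apply: dE => //.
by move: z1; rewrite ltr_norml in_itv/= => /andP[? ?]; apply/andP; split; lra.
Qed.

(** An idempotent map [tau] of the line into [0,1] covers both cases: the clamp for Dirichlet, the
    fractional part for periodic conditions, where it identifies 0 and 1. The five properties listed
    are all that the rest of the proof uses of it. *)
Lemma data_extension (bc : boundary_kind) (f0 f0x f0xx rho0 rho0x : R -> R) (A : R) :
  H2 f0 f0x f0xx -> H1 rho0 rho0x -> boundary_conditions bc f0 f0x rho0 -> 1 <= A ->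
  (forall x, 0 <= x <= 1 -> `|f0x x| <= A) -> (forall x, 0 <= x <= 1 -> `|rho0 x| <= A) ->
  exists a b a' b', extended_data bc a b a' b' A /\
    forall x, 0 <= x <= 1 -> a x = f0x x /\ b x = rho0 x.
Proof.
move=> [/H1P[af _] /H1P sfx] /H1P srho bcs A1 fA rA.
have [tau [tau01 tauK tau_id tau_sobolev tau_bc]] : exists tau : R -> R, [/\
    forall x, 0 <= tau x <= 1, forall x, tau (tau x) = tau x,
    forall u, (bc = Periodic -> u 0 = u 1) -> forall x, 0 <= x <= 1 -> u (tau x) = u x :> R,
    forall u v, (bc = Periodic -> u 0 = u 1) -> sobolev 0 1 u v ->
      exists v', forall p q, sobolev p q (fun x => u (tau x)) v' &
    bc = Periodic -> forall x, tau (x + 1) = tau x].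
  case: bc bcs => bcs.
    exists (clamp 0 1); split => //.
    - by move=> x; exact: clamp_itv.
    - by move=> x; apply: clamp_id; exact: clamp_itv.
    - by move=> u _ x x01; rewrite clamp_id.
    - by move=> u v _; exact: constant_extension.
  exists (@frac R); split.
  - by move=> x; have /andP[-> /ltW] := frac_itv x.
  - by move=> x; apply: frac_id; exact: frac_itv.
  - move=> u /(_ erefl) u01 x /andP[x0]; rewrite le_eqVlt => /orP[/eqP ->|x1].
      by rewrite -[1]add0r fracD1 frac_id ?lexx ?ltr01// add0r.
    by rewrite frac_id// x0.
  - by move=> u v /(_ erefl) u01 uv; exact: periodic_extension uv u01.
  - by move=> _ x; exact: fracD1.
have fx01 : bc = Periodic -> f0x 0 = f0x 1 by move=> bcE; move: bcs; rewrite bcE => -[].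
have r01 : bc = Periodic -> rho0 0 = rho0 1 by move=> bcE; move: bcs; rewrite bcE => -[].
have [a' aa'] := tau_sobolev _ _ fx01 sfx; have [b' bb'] := tau_sobolev _ _ r01 srho.
exists (fun x => f0x (tau x)), (fun x => rho0 (tau x)), a', b'; split; last first.
  by move=> x x01; rewrite !tau_id.
split => //.
- by apply: (@ac_line_continuous _ a') => p q; case: (aa' p q).
- by apply: (@ac_line_continuous _ b') => p q; case: (bb' p q).
- by move=> x; exact: fA.
- by move=> x; exact: rA.
- by move=> p q; case: (aa' p q).
- by move=> p q; case: (bb' p q).
- by move=> p q; case: (aa' p q).
- by move=> p q; case: (bb' p q).
- rewrite (@int_eq _ _ _ f0x) => [|x]; last by rewrite /= in_itv/= => x01; rewrite tau_id.
  rewrite -(af.2 0 1)//; case: bc bcs {tau_sobolev tau_id tau_bc fx01 r01} => -[].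
    by move=> -> ->; rewrite subrr.
  by move=> ->; rewrite subrr.
- by move=> x; exists (tau x); rewrite ?tauK.
- case: bc bcs tau_id tau_bc {tau_sobolev fx01 r01} => bcs tau_id tau_bc.
    have t0 := tau_id rho0 _ 0; have t1 := tau_id rho0 _ 1.
    rewrite t0 ?lexx ?ler01// t1 ?lexx ?ler01//.
    by case: bcs.
  by move=> x; rewrite tau_bc.
Qed.

End Extension.

(** * The lifespan and the local solution *)

Section LocalExistence.
Context (R : realType).
Local Notation mu := (@lebesgue_measure R).
Implicit Types (x t : R).

Lemma trajectory_exists (a b : R -> R) (A m M : R) : continuous a -> continuous b ->
  (forall x, `|a x| <= A) -> (forall x, `|b x| <= A) -> 1 <= A -> 0 < m -> m <= 1 -> 1 <= M ->
  exists y, trajectory a b m M y (field_bound A m M).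
Proof.
move=> ca cb aA bA A1 m0 m1 M1.
have fB := field_le ca cb aA bA A1 m0 m1 M1.
have [y [y0 yL yD]] := cutoff_solution ca cb aA bA A1 m0 m1 M1 fB.
by exists y; split => //; apply: le_trans (fB (init R) 0%N).
Qed.

Lemma wst_dist (a b : R -> R) A (u v : nat -> R) d x : 1 <= A ->
  `|a x| <= A -> `|b x| <= A -> state_dist_le u v d ->
  `|wst a b u x - wst a b v x| <= 3 * A * d /\ `|zst a b u x - zst a b v x| <= 3 * A * d.
Proof.
move=> A1 aA bA uv.
have h i j k : `|1 * u i + - a x * u j + b x * u k - (1 * v i + - a x * v j + b x * v k)| <= 3 * A * d.
  have -> : 1 * u i + - a x * u j + b x * u k - (1 * v i + - a x * v j + b x * v k) =
    1 * (u i - v i) + - a x * (u j - v j) + b x * (u k - v k) by ring.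
  have H (c : R) l : `|c| <= A -> `|c * (u l - v l)| <= A * d.
    by move=> cA; rewrite normrM ler_pM.
  have -> : 3 * A * d = A * d + A * d + A * d by ring.
  by rewrite (le_trans (ler_normD _ _))// lerD ?H// (le_trans (ler_normD _ _))// lerD ?H// ?normr1 ?normrN.
by split; exact: h.
Qed.

(** The factors 2 are those of [data_bound], by which the suprema of [f0'] and [rho0] are at most
    twice the Sobolev norms; the summand 1 gives [1 <= A]. *)
Definition data_size (p r : R) := 1 + 2 * p + 2 * r.

(** Up to this time a coordinate of speed at most [field_bound A 2^-1 (2 * A)] moves by at most
    [1 / (6 A)]. As [w] combines three coordinates with coefficients at most [A], it stays within
    1/2 of its initial value 1. *)
Definition lifespan (p q r : R) : R :=
  let A := data_size `|p| `|r| in (6 * A * field_bound A 2^-1 (2 * A))^-1.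

Lemma data_size_ge1 (p r : R) : 1 <= data_size `|p| `|r|.
Proof. by rewrite /data_size -addrA lerDl addr_ge0// mulr_ge0. Qed.

Lemma field_bound_ge1 (A m M : R) : 0 <= A -> 0 < m -> 0 <= M -> 1 <= field_bound A m M.
Proof.
move=> A0 m0 M0; rewrite /field_bound -addrA lerDl addr_ge0// mulr_ge0//.
have mV : 0 <= m^-1 by rewrite invr_ge0 ltW.
by rewrite addr_ge0// mulr_ge0 ?exprn_ge0// mulr_ge0 ?exprn_ge0.
Qed.

Lemma lifespan_gt0 (p q r : R) : 0 < lifespan p q r.
Proof.
have A1 := data_size_ge1 p r; have A0 : 0 < data_size `|p| `|r| by exact: lt_le_trans A1.
rewrite /lifespan invr_gt0 mulr_gt0 ?mulr_gt0//.
by rewrite (lt_le_trans ltr01)// field_bound_ge1// ?invr_gt0// ?mulr_ge0// ltW.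
Qed.

Lemma good_initial (a b : R -> R) A x : 1 <= A -> `|a x| <= A ->
  wst a b (init R) x = 1 /\ `|zst a b (init R) x| <= A.
Proof.
move=> A1 aA; rewrite /wst /zst /=; split; first by ring.
by rewrite (_ : 1 * 0 + _ * 1 + _ * 0 = - a x) ?normrN//; ring.
Qed.

(** Initially [w = 1], [|w_t| <= A] and all coordinates are at most 1 in absolute value. Since
    [A >= 1], changes of at most 1/2 cross neither the level 1/2 nor the level [2 * A]. *)
Lemma short_time_good bc (a b a' b' : R -> R) A B y T :
  extended_data bc a b a' b' A -> trajectory a b 2^-1 (2 * A) y B -> 6 * A * B * T <= 1 ->
  forall t, 0 <= t <= T -> good_time a b 2^-1 (2 * A) (y t).
Proof.
move=> ext traj TB t /andP[t0 tT]; have A1 := ext_A1 ext.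
have B0 := traj_B0 traj.
have d : state_dist_le (y t) (init R) (B * t).
  move=> k; rewrite -(traj_init traj k).
  by have := traj_lip traj 0 t k; rewrite subr0 (ger0_norm t0).
have AB : 6 * A * (B * t) <= 1.
  have -> : 6 * A * (B * t) = 6 * A * B * t by ring.
  by rewrite (le_trans _ TB)// ler_wpM2l// !mulr_ge0// (le_trans _ A1).
have Bt : B * t <= 6^-1.
  have h0 : 0 <= B * t by exact: mulr_ge0.
  by nra.
split.
- move=> x; have [h _] := wst_dist A1 (ext_aA ext x) (ext_bA ext x) d.
  have [w1 _] := good_initial b A1 (ext_aA ext x).
  by move: h; rewrite w1 ler_norml => /andP[? ?]; apply/andP; split; lra.
- move=> x; have [_ h] := wst_dist A1 (ext_aA ext x) (ext_bA ext x) d.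
  have [_ z1] := good_initial b A1 (ext_aA ext x).
  by have := lerB_dist (zst a b (y t) x) (zst a b (init R) x); lra.
- move=> k _; have h := d k.
  have i1 : `|init R k| <= 1 by case: k {h} => [|[|[|[|[|k]]]]] /=; rewrite ?normr0 ?normr1.
  by have := lerB_dist (y t k) (init R k); lra.
Qed.

Lemma data_bound (u v : R -> R) (n : R) x : ac 0 1 u v -> sqi 0 1 v ->
  nsq 0 1 u + nsq 0 1 v <= n ^+ 2 -> 0 <= n -> 0 <= x <= 1 -> `|u x| <= 2 * n.
Proof.
move=> auv sv un n0 x01; have h := ac_sup_bound auv sv x01.
rewrite -(ler_pXn2r (n := 2)) ?nnegrE ?mulr_ge0// -normrX ger0_norm ?sqr_ge0//.
by rewrite (le_trans h)// exprMn; nra.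
Qed.

Section Data.
Variables (bc : boundary_kind) (f0 f0x f0xx rho0 rho0x : R -> R).
Hypotheses (hf : H2 f0 f0x f0xx) (hr : H1 rho0 rho0x).
Hypothesis bcs : boundary_conditions bc f0 f0x rho0.

Let A := data_size `|H2_norm f0 f0x f0xx| `|H1_norm rho0 rho0x|.

Lemma extended_data_exists : exists a b a' b', extended_data bc a b a' b' A /\
    forall x, 0 <= x <= 1 -> a x = f0x x /\ b x = rho0 x.
Proof.
have A1 : 1 <= A by exact: data_size_ge1.
have [[/H1P[af sfx] /H1P[afx sfxx]] /H1P[ar srx]] := (hf, hr).
have sf : sqi 0 1 f0 by exact: sqi_within (ac_continuous af).
have sr : sqi 0 1 rho0 by exact: sqi_within (ac_continuous ar).
have p0 := normr_ge0 (H2_norm f0 f0x f0xx); have r0 := normr_ge0 (H1_norm rho0 rho0x).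
apply: (data_extension hf hr bcs A1) => x x01.
  rewrite (le_trans (data_bound afx sfxx _ p0 x01)) ///A /data_size; last by lra.
  rewrite H2_normE// real_normK ?num_real// sqr_sqrtr ?addr_ge0 ?nsq_ge0//.
  by rewrite -addrA lerDr nsq_ge0.
rewrite (le_trans (data_bound ar srx _ r0 x01)) ///A /data_size; last by lra.
by rewrite H1_normE// real_normK ?num_real// sqr_sqrtr ?addr_ge0 ?nsq_ge0.
Qed.

Lemma initial_boundary : match bc with
  | Dirichlet => f0 0 = 0
  | Periodic => \int[mu]_(x in `[0, 1]) f0 x = 0 end.
Proof. by case: bc bcs => -[]. Qed.

Lemma data_ac (a : R -> R) : (forall x, 0 <= x <= 1 -> a x = f0x x) -> ac 0 1 f0 a.
Proof.
move=> aE; have [/H1P[af _] _] := hf.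
by apply: eq_ac af => // x x01; rewrite aE.
Qed.

Lemma local_existence : exists f fx fxx rho rhox,
  solution bc f0 rho0 (lifespan (H2_norm f0 f0x f0xx) (Linf_norm f0x) (H1_norm rho0 rho0x))
    f fx fxx rho rhox.
Proof.
have [a [b [a' [b' [ext abE]]]]] := extended_data_exists.
have A1 := ext_A1 ext; have A0 : 0 < A by exact: lt_le_trans A1.
have m0 : 0 < 2^-1 :> R by rewrite invr_gt0.
have m1 : 2^-1 <= 1 :> R by rewrite invf_le1 ?ler1n.
have M1 : 1 <= 2 * A by lra.
have [y traj] := trajectory_exists (ext_ca ext) (ext_cb ext) (ext_aA ext) (ext_bA ext) A1 m0 m1 M1.
set T := lifespan _ _ _; have T0 : 0 < T by exact: lifespan_gt0.
have TB : 6 * A * field_bound A 2^-1 (2 * A) * T <= 1.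
  rewrite /T /lifespan -/A divff// gt_eqF// mulr_gt0 ?mulr_gt0//.
  by rewrite (lt_le_trans ltr01)// field_bound_ge1// ?mulr_ge0// ltW.
have good := short_time_good ext traj TB.
do 5 eexists; apply: (lagrangian_solution ext traj (ltW T0) good).
- by apply: data_ac => x /abE[].
- by move=> x /abE[].
- exact: initial_boundary.
Qed.

End Data.

End LocalExistence.

(** * Continuation *)

Section IntegralComparison.
Context (R : realType).
Local Notation mu := (@lebesgue_measure R).

(* unlike [ge0_le_integral], this applies to [t |-> eLinf_norm (fx t)], the
   measurability of which is not known *)
Lemma ge0_le_integral_subset (D E : set R) (f g : R -> \bar R) : D `<=` E ->
  (forall x, D x -> 0 <= f x)%E -> (forall x, E x -> 0 <= g x)%E ->
  (forall x, D x -> f x <= g x)%E ->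
  (\int[mu]_(x in D) f x <= \int[mu]_(x in E) g x)%E.
Proof.
move=> DE f0 g0 fg; rewrite integral_mkcond [leRHS]integral_mkcond.
have f0' x : (0 <= (f \_ D) x)%E.
  by rewrite patchE; case: ifPn => //; rewrite inE; exact: f0.
have fg' x : ((f \_ D) x <= (g \_ E) x)%E.
  rewrite !patchE; case: ifPn => [|_].
    by rewrite inE => xD; rewrite mem_set; [exact: fg|exact: DE].
  by case: ifPn => //; rewrite inE; exact: g0.
rewrite !ge0_integralTE//; last by move=> x; exact: le_trans (fg' x).
apply: ereal_sup_le => _ [h hf <-]; exists h => // x.
exact: le_trans (hf x) (fg' x).
Qed.

Lemma periodic_int (g : R -> R) (n : int) x : (forall x, g (x + 1) = g x) ->
  g (x + n%:~R) = g x.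
Proof.
move=> pg; have pn (k : nat) z : g (z + k%:R) = g z.
  by elim: k => [|k IH]; rewrite ?addr0// -natr1 addrA pg.
case: n => k; first exact: pn.
by rewrite NegzE mulrNz -[in RHS](subrK (k.+1%:R) x) pn.
Qed.

End IntegralComparison.

(** Growth of [p^2 + q^2 + 1] along [p' = q], [q' = r - j p]; the summand 1 absorbs the source
    [r]. *)
Lemma oscillator_growth (R : realType) (p q j k r : R) : `|r| <= 1 -> `|j| <= k ->
  2 * p * q + 2 * q * (r - j * p) <= (2 + k) * (p * p + q * q + 1).
Proof.
rewrite !ler_norml => /andP[r1 r2] /andP[j1 j2].
have k0 : 0 <= k by lra.
have h1 : 2 * p * q <= p * p + q * q by have := sqr_ge0 (p - q); nra.
have h2 : - (2 * p * q) <= p * p + q * q by have := sqr_ge0 (p + q); nra.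
have h3 : 2 * q * r <= q * q + 1.
  have := sqr_ge0 (q - r); have : r * r <= 1 by nra.
  by nra.
have h4 : - (2 * p * q * j) <= k * (p * p + q * q).
  have [pq|/ltW pq] := leP 0 (p * q); nra.
have := sqr_ge0 p; rewrite expr2 => pp.
have -> : 2 * p * q + 2 * q * (r - j * p) = 2 * p * q + 2 * q * r + - (2 * p * q * j) by ring.
have -> : (2 + k) * (p * p + q * q + 1) =
  (p * p + q * q) + (q * q + 1) + k * (p * p + q * q) + (p * p + 1 + k) by ring.
lra.
Qed.

(** * A priori bounds along the trajectory *)

Section Apriori.
Context (R : realType).
Local Notation mu := (@lebesgue_measure R).
Variables (bc : boundary_kind) (a b a' b' f0 rho0 : R -> R) (A m M B Tstar M0 S : R).
Variable (y : R -> nat -> R).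
Variables (f fx fxx rho rhox : R -> R -> R).
Hypothesis ext : extended_data bc a b a' b' A.
Hypothesis traj : trajectory a b m M y B.
Hypothesis f0a : ac 0 1 f0 a.
Hypothesis rho0b : forall x, 0 <= x <= 1 -> rho0 x = b x.
Hypothesis f0_boundary : match bc with
  | Dirichlet => f0 0 = 0
  | Periodic => \int[mu]_(x in `[0, 1]) f0 x = 0 end.
Hypothesis M0_ge0 : 0 <= M0.
Hypothesis mass : (\int[mu]_(t in `[0%R, Tstar[) eLinf_norm (fx t) <= M0%:E)%E.
Hypotheses (S0 : 0 < S) (ST : S < Tstar).
Hypothesis sol : solution bc f0 rho0 S f fx fxx rho rhox.
Hypothesis good : forall t, 0 <= t <= S -> good_time a b m M (y t).
Implicit Types (x s t q : R).

Local Notation w t := (wst a b (y t)).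
Local Notation z t := (zst a b (y t)).
Local Notation J t := (Jc a b m M (y t)).
Local Notation I t := (Ic a b m M (y t)).
Local Notation flow := (flow bc a b m M y).
Local Notation label := (label bc a b m M y).

Let ca := ext_ca ext.
Let cb := ext_cb ext.
Let aA := ext_aA ext.
Let bA := ext_bA ext.
Let A1 := ext_A1 ext.
Let m0 := traj_m0 traj.
Let m1 := traj_m1 traj.
Let M1 := traj_M1 traj.
Let A0 : 0 <= A. Proof. exact: le_trans A1. Qed.

Let flow_mono t p q : p <= q -> flow t p <= flow t q.
Proof.
move=> pq; rewrite -subr_ge0.
have [|c _ ->] := @mean_value _ (flow t) (J t) p q; first by move=> r _; exact: (flow_derive ext traj).
by rewrite mulr_ge0 ?subr_ge0// invr_ge0 ltW// wc_gt0.
Qed.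

(** Bounds on [w] and [w_t] are needed on the whole line, whereas the given solution lives on [0,1].
    The labels of [0,1] fill [0,1] itself or one full period, and there [a] and [b] take all pairs
    of values that they take on the line. *)
Lemma label_cover t x : 0 <= t <= S ->
  exists2 q, 0 <= q <= 1 & a (label t q) = a x /\ b (label t q) = b x.
Proof.
move=> tS.
have [x1 x1I [ax bx]] : exists2 x1, label t 0 <= x1 <= label t 1 & a x1 = a x /\ b x1 = b x.
  have [bcE|bcE] : bc = Dirichlet \/ bc = Periodic by case: bc; [left|right].
    have [-> ->] := label_dirichlet ext traj good tS bcE.
    by have [x1 x1I [-> ->]] := ext_cover ext x; exists x1.
  rewrite (label_periodic ext traj good tS bcE); set p := label t 0.
  have pab r : a (r + 1) = a r /\ b (r + 1) = b r.
    by have := ext_boundary ext; rewrite bcE; exact.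
  exists (p + frac (x - p)).
    by have /andP[h1 h2] := frac_itv (x - p); rewrite lerDl h1 lerD2l ltW.
  have -> : p + frac (x - p) = x + (- Num.floor (x - p))%:~R.
    by rewrite /frac mulrNz; ring.
  by rewrite !periodic_int// => r; have [] := pab r.
exists (flow t x1); last by rewrite (flowK ext traj).
case/andP: x1I => /(@flow_mono t) + /(@flow_mono t).
by rewrite !(labelK ext traj) => -> ->.
Qed.

(** By uniqueness the given solution coincides with the Lagrangian one, whose [f_x] at a point is
    [- w_t / w] at its label. The given solution enters the a priori bounds through this
    inequality. *)
Lemma slope_le t x : 0 <= t <= S -> (`|z t x / w t x|%:E <= eLinf_norm (fx t))%E.
Proof.
move=> tS; have S0' := ltW S0.
have lag := lagrangian_solution ext traj S0' good f0a rho0b f0_boundary.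
have vf := solutionP sol; have vlag := solutionP lag.
have itv01 q : 0 <= q <= 1 -> q \in `[0, 1] by rewrite in_itv.
have [q q01 [aq bq]] := label_cover x tS.
have [||_ fxE _] := @solution_unique _ bc S _ _ _ _ _ _ _ _ _ _ vf vlag _ _ t q tS q01.
- by move=> r /itv01 r01; have [-> _] := sol_initial sol r01; have [-> _] := sol_initial lag r01.
- by move=> r /itv01 r01; have [_ ->] := sol_initial sol r01; have [_ ->] := sol_initial lag r01.
have := eLinf_norm_ge (ac_continuous (sv_fx vf tS)) q01.
by rewrite fxE normrN /lag_Z /lag_W /wst /zst aq bq.
Qed.

Let bl_time g x : bounded_lipschitz g -> continuous (fun t => g (y t) x).
Proof.
move=> [_ [L L0 gL] _]; apply: (@lipschitz_continuous _ (L * B)) => s t.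
by rewrite (le_trans (gL _ _ _ _ (state_dist traj t s)))// mulrA.
Qed.

Let bw := bl_wc ca cb aA bA A1 m1 M1.
Let bz := bl_zc ca cb aA bA A1 M1.
Let bJ := bl_Jc ca cb aA bA A1 m0 m1 M1.

Let inner t : 0 < t < S -> 0 <= t <= S.
Proof. by case/andP => ? ?; rewrite !ltW. Qed.

Let w0E x : w 0 x = 1. Proof. by rewrite /wst !(traj_init traj)/=; ring. Qed.
Let z0E x : z 0 x = - a x. Proof. by rewrite /zst !(traj_init traj)/=; ring. Qed.

Lemma log_bound t x : 0 <= t <= S -> `|ln (w t x)| <= M0.
Proof.
move=> /andP[]; rewrite le_eqVlt => /orP[/eqP <-|t0] tS; first by rewrite w0E ln1 normr0.
have tI : 0 <= t <= S by rewrite ltW.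
pose g s := zc a b M (y s) x * J s x.
have cg : continuous g by exact: bl_time (blM bz bJ).
have gE s : 0 <= s <= S -> g s = z s x / w s x.
  by move=> sS; rewrite /g (zcE good)// (JE good).
pose G s := \int[mu]_(r in `[0, s]) g r.
have [k k0 gk] := bl_bound (blM bz bJ).
have cG : continuous G.
  apply: (@lipschitz_continuous _ k) => r s.
  by apply: (int0_lipschitz (g := g)) => // q; exact: gk.
(* The clamped [wc] is positive at all times, which makes [phi] continuous on the whole line. On
   [[0, S]] it is [ln w] minus the integral of [w_t / w], hence constant. *)
pose phi s := ln (wc a b m M (y s) x) - G s.
have cphi : continuous phi.
  move=> s; apply: cvgB; last exact: cG.
  apply: (@continuous_comp _ _ _ (fun s => wc a b m M (y s) x) (@ln R)).
    exact: (@bl_time _ x bw s).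
  exact/continuous_ln/wc_gt0.
have dphi s : 0 < s < S -> is_derive s 1 phi 0.
  move=> sI; have sI' := inner sI; have /andP[s0 sS] := sI.
  have [d d0 dE] := inner_ball sI.
  have D1 : is_derive s 1 (fun s => ln (wc a b m M (y s) x)) ((w s x)^-1 * z s x).
    apply: (is_derive_near d0 (f := (@ln R) \o (fun s => w s x))).
      by move=> r /dE rI; rewrite /= (wcE good)// inner.
    apply: is_derive1_comp; last exact: wst_derive traj good s x sI.
    exact: is_derive1_ln (w_gt0 traj good x sI').
  have D2 : is_derive s 1 G (g s).
    by apply: (int_derive s0) => // [q|]; [exact: itg_continuous|exact: cg].
  by apply: (is_derive_eq (is_deriveB D1 D2)); rewrite gE// mulrC subrr.
have [|c _] := @MVT R phi (fun=> 0) 0 t t0 _ (continuous_within cphi).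
  move=> s; rewrite in_itv/= => /andP[s0 st]; apply: dphi.
  by rewrite s0 (lt_le_trans st).
rewrite mul0r => /eqP; rewrite subr_eq0 /phi (wcE good)// (wcE good) ?lexx ?(ltW S0)//.
rewrite w0E ln1 /G int_point subrr subr_eq0 => /eqP ->.
have ig : itg `[0, t] g by exact: itg_continuous.
rewrite (le_trans (int_norm _ ig))// -lee_fin.
have ign : itg `[0, t] (fun s => `|g s|) by exact: itg_norm.
rewrite /Rintegral fineK; last exact: integrable_fin_num ign.
apply: le_trans mass; apply: ge0_le_integral_subset => [s|s _|s _|s].
- rewrite /= !in_itv/= => /andP[-> st]; exact: le_lt_trans (le_trans st tS) ST.
- by rewrite lee_fin.
- exact: eLinf_norm_ge0.
- rewrite /= in_itv/= => /andP[s0 st].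
  have sS : 0 <= s <= S by rewrite s0 (le_trans st).
  by rewrite gE//; exact: slope_le.
Qed.

Lemma w_bounds t x : 0 <= t <= S -> expR (- M0) <= w t x <= expR M0.
Proof.
move=> tS; have w0 := w_gt0 traj good x tS.
have := log_bound x tS; rewrite ler_norml => /andP[h1 h2].
by rewrite -{1}(lnK (w0 : w t x \in Num.pos)) -{2}(lnK (w0 : w t x \in Num.pos)) !ler_expR h1.
Qed.

Let E1 : 1 <= expR M0.
Proof. by rewrite -[leLHS]expR0 ler_expR. Qed.

Let Tstar0 : 0 <= Tstar. Proof. by rewrite ltW// (lt_trans S0). Qed.

(** [2 * A] bounds the Wronskian at time 0, where it is [a x' - a x], and [2 * A * expR M0] bounds
    its time derivative. *)
Definition wronskian_bound := 2 * A * (1 + expR M0 * Tstar).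

(* [z(x) w(x') - w(x) z(x')] is a Wronskian of the linear equation [w'' = b - I w] *)
Let wronskian t x x' : 0 <= t <= S ->
  `|z t x * w t x' - w t x * z t x'| <= wronskian_bound.
Proof.
move=> /andP[]; rewrite le_eqVlt => /orP[/eqP <-|t0] tS.
  rewrite !w0E !z0E mulr1 mul1r opprK addrC /wronskian_bound.
  have h : `|a x' - a x| <= 2 * A by rewrite (le_trans (ler_normB _ _))//; have := aA x; have := aA x'; lra.
  by rewrite (le_trans h)// ler_peMr ?mulr_ge0// lerDl mulr_ge0// ltW// expR_gt0.
have tI : 0 <= t <= S by rewrite ltW.
pose W s := z s x * w s x' - w s x * z s x'.
pose W' s := b x * w s x' - w s x * b x'.
have comb_continuous i j k q : continuous (fun s => 1 * y s i + - a q * y s j + b q * y s k).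
  have cy := trajectory_continuous traj.
  move=> s; apply: cvgD; last by apply: cvgM; [exact: cvg_cst|exact: cy].
  by apply: cvgD; apply: cvgM; [exact: cvg_cst|exact: cy|exact: cvg_cst|exact: cy].
have cw q : continuous (fun s => w s q) by exact: comb_continuous.
have cz q : continuous (fun s => z s q) by exact: comb_continuous.
have cW : continuous W.
  move=> s; apply: cvgB; apply: cvgM; [exact: cz|exact: cw|exact: cw|exact: cz].
have [|c cI cE] := @MVT R W W' 0 t t0 _ (continuous_within cW).
  move=> s; rewrite in_itv/= => /andP[s0 st].
  have sI : 0 < s < S by rewrite s0 (lt_le_trans st).
  have Dw q := wst_derive traj good q sI; have Dz q := zst_derive traj good q sI.
  apply: (is_derive_eq (is_deriveB (is_deriveM (Dz x) (Dw x')) (is_deriveM (Dw x) (Dz x')))).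
  by rewrite /W' /GRing.scale/=; ring.
move: cI; rewrite in_itv/= => /andP[c0 ct].
have cS : 0 <= c <= S by rewrite (ltW c0) ltW// (lt_le_trans ct).
have wE q : `|w c q| <= expR M0.
  by have /andP[_ h] := w_bounds q cS; rewrite gtr0_norm// (w_gt0 traj good).
have W'b : `|W' c| <= 2 * A * expR M0.
  rewrite (le_trans (ler_normB _ _))// !normrM (mulrC `|w c x|).
  have -> : 2 * A * expR M0 = A * expR M0 + A * expR M0 by ring.
  by apply: lerD; apply: ler_pM.
have W0b : `|W 0| <= 2 * A.
  rewrite /W !w0E !z0E mulr1 mul1r opprK addrC (le_trans (ler_normB _ _))//.
  by have := aA x; have := aA x'; lra.
have WE : W t = W 0 + W' c * t by rewrite -[W t](subrK (W 0)) cE subr0 addrC.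
rewrite -[X in `|X|]/(W t) WE.
rewrite (le_trans (ler_normD _ _))// /wronskian_bound mulrDr mulr1 lerD//.
rewrite normrM (gtr0_norm t0) mulrA; apply: ler_pM => //; first exact: ltW.
exact: le_trans tS (ltW ST).
Qed.

(** Dividing the Wronskian by the two values of [w] costs [expR M0 ^+ 2]; passing from [w_t / w] to
    [w_t] costs one factor more. *)
Definition z_bound := wronskian_bound * expR M0 ^+ 3.

Lemma z_le t x : 0 <= t <= S -> `|z t x| <= z_bound.
Proof.
move=> tS; pose V q := z t q / w t q.
have J0 q : 0 < J t q by rewrite invr_gt0 wc_gt0.
have JE' q : J t q <= expR M0.
  have /andP[h _] := w_bounds q tS.
  have w0 := w_gt0 traj good q tS.
  by rewrite (JE good)// -[leRHS]invrK -expRN lef_pV2 ?posrE ?expR_gt0.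
have [K1 K0] := unit_mass ext traj good tS.
have cJ : continuous (J t) by have [_ _] := bJ; exact.
have cJt : continuous (Jtc a b m M (y t)).
  by have [_ _] := bl_Jtc ca cb aA bA A1 m0 m1 M1; exact.
have E0 : 0 <= expR M0 by rewrite ltW// expR_gt0.
(* The function [- J_t = (w_t / w) * J] has integral zero and [J] has integral 1, so that
   integrating these differences over [q] gives back [V x]. *)
have diff q : `|V x * J t q - (- Jtc a b m M (y t) q)| <= wronskian_bound * expR M0 ^+ 2 * J t q.
  have -> : V x * J t q - (- Jtc a b m M (y t) q) =
    (z t x * w t q - w t x * z t q) * (J t x * J t q) * J t q.
    rewrite /V /Jtc (zcE good)// !(JE good)//.
    by field; rewrite !gt_eqF// (w_gt0 traj good).
  rewrite !normrM !(gtr0_norm (J0 _)) ler_wpM2r ?(ltW (J0 q))//.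
  apply: ler_pM => //; [by rewrite mulr_ge0// ltW|exact: wronskian|].
  by rewrite expr2; apply: ler_pM => //; rewrite ltW.
have Vx : `|V x| <= wronskian_bound * expR M0 ^+ 2.
  have i1 : itg `[0, 1] (fun q => V x * J t q).
    by apply: itgZ => //; exact: itg_continuous.
  have i2 : itg `[0, 1] (fun q => - Jtc a b m M (y t) q).
    by apply: itgN => //; exact: itg_continuous.
  have -> : V x = \int[mu]_(q in `[0, 1]) (V x * J t q - (- Jtc a b m M (y t) q)).
    rewrite RintegralB; [|by []|exact: i1|exact: i2].
    rewrite RintegralZl; [|by []|exact: itg_continuous].
    rewrite intN; [|by []|exact: itg_continuous].
    by rewrite K1 K0 mulr1 oppr0 subr0.
  have -> : wronskian_bound * expR M0 ^+ 2 =
      \int[mu]_(q in `[0, 1]) (wronskian_bound * expR M0 ^+ 2 * J t q).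
    rewrite RintegralZl; [|by []|exact: itg_continuous].
    by rewrite K1 mulr1.
  rewrite (le_trans (int_norm _ (itgB _ i1 i2)))//; apply: int_le => //.
  - by apply: itg_norm => //; exact: itgB i1 i2.
  - by apply: itgZ => //; exact: itg_continuous.
have -> : z t x = V x * w t x by rewrite /V divfK// gt_eqF// (w_gt0 traj good).
rewrite normrM /z_bound exprSr mulrA ler_pM//.
by have /andP[_ h] := w_bounds x tS; rewrite gtr0_norm// (w_gt0 traj good).
Qed.

Definition I_bound := A * expR M0 ^+ 2 + 2 * (z_bound ^+ 2 * expR M0 ^+ 3).

Let I_le t : 0 <= t <= S -> `|I t| <= I_bound.
Proof.
move=> tS; have E0 : 0 <= expR M0 by rewrite ltW// expR_gt0.
have Jb q n : `|J t q ^+ n| <= expR M0 ^+ n.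
  have J0 : 0 < J t q by rewrite invr_gt0 wc_gt0.
  have /andP[h _] := w_bounds q tS.
  rewrite ger0_norm ?exprn_ge0 ?(ltW J0)// lerXn2r ?nnegrE ?(ltW J0)//.
  have w0 := w_gt0 traj good q tS.
  by rewrite (JE good)// -[leRHS]invrK -expRN lef_pV2 ?posrE ?expR_gt0.
have bI (g : (nat -> R) -> R -> R) k : bounded_lipschitz g -> (forall x, `|g (y t) x| <= k) ->
    `|\int[mu]_(x in `[0, 1]) g (y t) x| <= k.
  move=> [_ _ cg] gk; rewrite -[k]mulr1 -[X in _ <= k * X]subr0.
  by apply: int_bounded => //; apply: itg_measurable; exact: itg_continuous.
rewrite /Ic (le_trans (ler_normB _ _))// lerD//.
  apply: (bI (fun u x => b x * Jc a b m M u x ^+ 2)) => [|x].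
    exact: blM (bl_fun cb bA) (blX 2 bJ).
  by rewrite normrM ler_pM.
rewrite normrM ger0_norm// ler_wpM2l//.
apply: (bI (fun u x => zc a b M u x ^+ 2 * Jc a b m M u x ^+ 3)) => [|x].
  exact: blM (blX 2 bz) (blX 3 bJ).
have zb := z_le x tS.
rewrite normrM ler_pM// normrX lerXn2r ?nnegrE ?(zcE good)//.
exact: le_trans zb.
Qed.

(** The factor 2 bounds the initial value of [p^2 + q^2 + 1] for each pair of coordinates, and the
    exponential is the growth allowed by [oscillator_growth] up to [Tstar]. *)
Definition u_bound := 2 * expR ((2 + I_bound) * Tstar).

(** The coordinates [i] and [i + 3] form an oscillator [p'' = e - I p], with source [e = 1] for
    [i = 2] and [e = 0] for the other two. *)
Let coordinate_bound t i (e : R) : 0 <= t <= S -> (i < 3)%N -> `|e| <= 1 ->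
  (forall s, 0 < s < S -> is_derive s 1 (fun s => y s i) (y s (i + 3)%N) /\
    is_derive s 1 (fun s => y s (i + 3)%N) (e - I s * y s i)) ->
  y 0 i ^+ 2 + y 0 (i + 3)%N ^+ 2 <= 1 ->
  `|y t i| <= u_bound /\ `|y t (i + 3)%N| <= u_bound.
Proof.
move=> tS i3 e1 D y0.
have cy := trajectory_continuous traj.
pose E s := y s i * y s i + y s (i + 3)%N * y s (i + 3)%N + 1.
have cE : continuous E.
  move=> s; apply: cvgD; last exact: cvg_cst.
  by apply: cvgD; apply: cvgM; exact: cy.
have dE s : 0 < s < S -> is_derive s 1 E
    (2 * y s i * y s (i + 3)%N + 2 * y s (i + 3)%N * (e - I s * y s i)).
  move=> sI; have [D1 D2] := D s sI.
  have := is_deriveD (is_deriveD (is_deriveM D1 D1) (is_deriveM D2 D2)) (is_derive_cst (1 : R) s 1).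
  by move=> H; apply: (is_derive_eq H); rewrite /GRing.scale/=; ring.
have I0 : 0 <= I_bound by exact: le_trans (I_le tS).
have growth s : 0 < s < S -> 2 * y s i * y s (i + 3)%N + 2 * y s (i + 3)%N * (e - I s * y s i) <=
    (2 + I_bound) * E s.
  by move=> sI; apply: oscillator_growth => //; exact: I_le (inner sI).
have Eb := gronwall (continuous_within cE) dE growth tS.
have Et : E t <= u_bound.
  rewrite (le_trans Eb)// /u_bound; apply: ler_pM.
  - by rewrite /E addr_ge0// addr_ge0// -expr2 sqr_ge0.
  - by rewrite ltW// expR_gt0.
  - by move: y0; rewrite /E !expr2; lra.
  - rewrite ler_expR; apply: ler_wpM2l; first exact: addr_ge0.
    by case/andP: tS => _ tS; exact: le_trans tS (ltW ST).
move: Et; rewrite /E; move: (y t i) (y t (i + 3)%N) => p q pq.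
have pp := sqr_ge0 p; have qq := sqr_ge0 q; rewrite !expr2 in pp qq.
have le_sq (r : R) : `|r| <= r * r + 1.
  have := sqr_ge0 (`|r| - 1); rewrite sqrrB1 real_normK ?num_real// expr2.
  by have := normr_ge0 r; lra.
by have := le_sq p; have := le_sq q; split; lra.
Qed.

Lemma u_le t k : 0 <= t <= S -> (k < 6)%N -> `|y t k| <= u_bound.
Proof.
move=> tS k6.
have clampE s i : 0 <= s <= S -> (i < 6)%N -> clamp (- M) M (y s i) = y s i.
  by move=> sS i6; apply: clamp_id; rewrite -ler_norml; have [_ _ ->] := good sS.
have D s i : 0 < s < S -> is_derive s 1 (fun s => y s i) (field a b m M (y s) i).
  by case/andP => s0 _; exact: traj_derive traj s i s0.
have z1 : `|0 : R| <= 1 by rewrite normr0.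
have o1 : `|1 : R| <= 1 by rewrite normr1.
have pair i (e : R) : (i < 3)%N -> `|e| <= 1 ->
    (forall s, 0 < s < S -> field a b m M (y s) i = y s (i + 3)%N /\
      field a b m M (y s) (i + 3)%N = e - I s * y s i) ->
    init R i ^+ 2 + init R (i + 3)%N ^+ 2 <= 1 ->
    `|y t i| <= u_bound /\ `|y t (i + 3)%N| <= u_bound.
  move=> i3 e1 fE ini; apply: (coordinate_bound tS i3 e1); last by rewrite !(traj_init traj).
  by move=> s sI; have [<- <-] := fE s sI; split; exact: D.
have [] := @pair 0 0 isT z1.
- by move=> s /inner sI; rewrite /= !clampE// sub0r.
- by rewrite /= expr1n expr0n addr0.
move=> h0 h3; have [] := @pair 1 0 isT z1.
- by move=> s /inner sI; rewrite /= !clampE// sub0r.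
- by rewrite /= expr1n expr0n add0r.
move=> h1 h4; have [] := @pair 2 1 isT o1.
- by move=> s /inner sI; rewrite /= !clampE.
- by rewrite /= expr0n addr0.
by move=> h2 h5; case: k k6 => [|[|[|[|[|[|]]]]]].
Qed.

End Apriori.

(** * The continuation criterion *)

Section Continuation.
Context (R : realType).
Local Notation mu := (@lebesgue_measure R).
Variables (bc : boundary_kind) (a b a' b' f0 rho0 : R -> R) (A Tstar M0 : R).
Variables (f fx fxx rho rhox : R -> R -> R).
Hypothesis ext : extended_data bc a b a' b' A.
Hypothesis f0a : ac 0 1 f0 a.
Hypothesis rho0b : forall x, 0 <= x <= 1 -> rho0 x = b x.
Hypothesis f0_boundary : match bc with
  | Dirichlet => f0 0 = 0
  | Periodic => \int[mu]_(x in `[0, 1]) f0 x = 0 end.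
Hypothesis M0_ge0 : 0 <= M0.
Hypothesis mass : (\int[mu]_(t in `[0%R, Tstar[) eLinf_norm (fx t) <= M0%:E)%E.
Hypothesis Tstar0 : 0 < Tstar.
Hypothesis sol : forall S, 0 < S < Tstar -> solution bc f0 rho0 S f fx fxx rho rhox.
Implicit Types (x s t : R).

(** There is no circularity between bounds and clamps: [Z] and [U] depend on [A], [Tstar] and [M0]
    only, so that the clamp levels can be chosen after them. The margin is at least [m] everywhere,
    since [expR (- M0) = 2 * m] and [M] exceeds each upper bound by at least 1. *)
Let Z := z_bound A Tstar M0.
Let U := u_bound A Tstar M0.
Let m := expR (- M0) / 2.
Let M := 1 + expR M0 + Z + U.
Let B := field_bound A m M.

Let A1 : 1 <= A := ext_A1 ext.
Let A0 : 0 <= A. Proof. exact: le_trans A1. Qed.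
Let E1 : 1 <= expR M0. Proof. by rewrite -[leLHS]expR0 ler_expR. Qed.
Let E0 : 0 <= expR M0. Proof. exact: le_trans E1. Qed.
Let EN1 : expR (- M0) <= 1. Proof. by rewrite -[leRHS]expR0 ler_expR oppr_le0. Qed.

Let Z_ge : A <= Z.
Proof.
have h1 : 1 <= expR M0 ^+ 3 by rewrite exprn_ege1.
have h2 : 0 <= expR M0 * Tstar by rewrite mulr_ge0// ltW.
have h3 : A <= wronskian_bound A Tstar M0.
  rewrite /wronskian_bound -mulrA mulrCA ler_peMr//; lra.
by rewrite (le_trans h3)// ler_peMr// (le_trans A0).
Qed.

Let U_ge : 1 <= U.
Proof.
have Z0 : 0 <= Z by exact: le_trans Z_ge.
have I0 : 0 <= I_bound A Tstar M0.
  have e n : 0 <= expR M0 ^+ n by exact: exprn_ge0.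
  by rewrite /I_bound -/Z addr_ge0// mulr_ge0// mulr_ge0// exprn_ge0.
have h : 1 <= expR ((2 + I_bound A Tstar M0) * Tstar).
  rewrite -[leLHS]expR0 ler_expR; apply: mulr_ge0; [exact: addr_ge0|exact: ltW].
by rewrite /U /u_bound; lra.
Qed.

Let m0 : 0 < m. Proof. by rewrite divr_gt0// expR_gt0. Qed.
Let m1 : m <= 2^-1. Proof. by rewrite /m ler_pdivrMr// mulVf. Qed.
Let M1 : 1 <= M. Proof. by rewrite /M; have := Z_ge; have := U_ge; have := E0; have := A0; lra. Qed.
Let m_le1 : m <= 1. Proof. by rewrite (le_trans m1)// invf_le1 ?ler1n. Qed.

Record strictly_good (u : nat -> R) : Prop := {
  strict_w : forall x, expR (- M0) <= wst a b u x <= expR M0;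
  strict_z : forall x, `|zst a b u x| <= Z;
  strict_u : forall k, (k < 6)%N -> `|u k| <= U }.

Let strict_near u v d : strictly_good u -> state_dist_le v u d -> 3 * A * d <= m ->
  good_time a b m M v.
Proof.
move=> [uw uz uU] vu dm; have d0 := state_dist_ge0 vu.
have zg := Z_ge; have ug := U_ge; have e0 := E0; have a1 := A1; have mh := m1; have me : expR (- M0) = m + m by rewrite /m; field.
split.
- move=> x; have [h _] := wst_dist A1 (ext_aA ext x) (ext_bA ext x) vu.
  have /andP[w1 w2] := uw x; move: h; rewrite ler_norml => /andP[h1 h2].
  by apply/andP; rewrite /M; split; lra.
- move=> x; have [_ h] := wst_dist A1 (ext_aA ext x) (ext_bA ext x) vu.
  by have := uz x; have := lerB_dist (zst a b v x) (zst a b u x); rewrite /M; lra.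
- move=> k k6; have h1 := uU k k6; have h2 := vu k.
  have dm' : d <= m by rewrite (le_trans _ dm)// ler_peMl//; have := A1; lra.
  by have := lerB_dist (v k) (u k); rewrite /M; lra.
Qed.

Section Bootstrap.
Variable y : R -> nat -> R.
Hypothesis traj : trajectory a b m M y B.

Let strict0 : strictly_good (y 0).
Proof.
have yE : y 0 = init R by apply/funext => k; rewrite (traj_init traj).
have ug := U_ge; rewrite yE; split.
- by move=> x; have [-> _] := good_initial b A1 (ext_aA ext x); rewrite EN1.
- by move=> x; have [_ h] := good_initial b A1 (ext_aA ext x); rewrite (le_trans h).
- by move=> k _; rewrite (le_trans _ ug)//; case: k => [|[|[|[|[|k]]]]] /=; rewrite ?normr0 ?normr1.
Qed.

Let strict_on S : 0 < S < Tstar -> (forall t, 0 <= t <= S -> good_time a b m M (y t)) ->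
  strictly_good (y S).
Proof.
move=> SI good; have /andP[S0 ST] := SI; have sS := sol SI.
have SS : 0 <= S <= S by rewrite lexx ltW.
split.
- by move=> x; exact: (w_bounds ext traj f0a rho0b f0_boundary M0_ge0 mass S0 ST sS good x SS).
- by move=> x; exact: (z_le ext traj f0a rho0b f0_boundary M0_ge0 mass S0 ST sS good x SS).
- by move=> k k6; exact: (u_le ext traj f0a rho0b f0_boundary M0_ge0 mass S0 ST sS good SS k6).
Qed.

(* the a priori bounds improve the clamps by a fixed margin, hence the good times
   extend by steps of fixed length *)
Lemma good_until_Tstar t : 0 <= t <= Tstar -> good_time a b m M (y t).
Proof.
have B1 : 1 <= B by rewrite field_bound_ge1// (le_trans _ M1).
have B0 : 0 < B by exact: lt_le_trans B1.
have AB : 0 < 3 * A * B by rewrite !mulr_gt0// (lt_le_trans _ A1).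
(* During a time [eta] each coordinate moves by at most [B * eta], hence [w] and [w_t] by at most
   [3 * A * B * eta = m], the margin of [strict_near]. *)
pose eta := m / (3 * A * B); have eta0 : 0 < eta by rewrite divr_gt0.
have step n : forall t, 0 <= t <= Tstar -> t <= n%:R * eta -> good_time a b m M (y t).
  elim: n => [|n IH] {}t /andP[t0 tT].
    rewrite mul0r => t0'; have -> : t = 0 by apply/le_anti; rewrite t0 t0'.
    by apply: (strict_near strict0 (d := 0)); [move=> k; rewrite subrr normr0|rewrite mulr0 ltW].
  move=> tn; have [tn'|tn'] := leP t (n%:R * eta); first by apply: IH; rewrite ?t0.
  set s := n%:R * eta in IH tn'.
  have s0 : 0 <= s by rewrite mulr_ge0// ltW.
  have sT : s < Tstar by exact: lt_le_trans tT.
  have ss : strictly_good (y s).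
    have [s_pos|s_neg] := ltP 0 s; last first.
      by have -> : s = 0 by apply/le_anti; rewrite s0 s_neg.
    apply: strict_on => [|r /andP[r0 rs]]; first by rewrite s_pos.
    by apply: IH => //; rewrite r0 (le_trans rs)// ltW.
  apply: (strict_near ss (state_dist traj s t)).
  have ts : `|t - s| <= eta.
    rewrite ger0_norm ?subr_ge0 ?(ltW tn')// lerBlDr.
    by move: tn; rewrite -natr1 mulrDl mul1r addrC.
  rewrite mulrA (le_trans (ler_wpM2l (ltW AB) ts))//.
  by rewrite /eta mulrC divfK// gt_eqF.
move=> tI; apply: (step (Num.truncn (Tstar / eta)).+1 t tI).
case/andP: tI => _ tT; rewrite (le_trans tT)// -ler_pdivrMr//.
by rewrite ltW// truncnS_gt.
Qed.

End Bootstrap.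

Lemma continuation : exists F Fx Fxx Rho Rhox : R -> R -> R,
  solution bc f0 rho0 Tstar F Fx Fxx Rho Rhox /\
  forall t x : R, t \in `[0, Tstar[ -> x \in `[0, 1] -> F t x = f t x /\ Rho t x = rho t x.
Proof.
have [y traj] := trajectory_exists (ext_ca ext) (ext_cb ext) (ext_aA ext) (ext_bA ext)
  A1 m0 m_le1 M1.
have good := good_until_Tstar traj.
have lag := lagrangian_solution ext traj (ltW Tstar0) good f0a rho0b f0_boundary.
do 5 eexists; split; first exact: lag.
move=> t x; rewrite !in_itv/= => /andP[t0 tT] x01.
(* The given solution is known on closed intervals ending before [Tstar]; the midpoint provides one
   that contains [t], to which uniqueness applies. *)
pose S := (t + Tstar) / 2.
have SI : 0 < S < Tstar by rewrite /S; apply/andP; split; lra.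
have tS : 0 <= t <= S by rewrite t0 /S; lra.
have S0 : 0 <= S by case/andP: SI => /ltW.
have goodS s : 0 <= s <= S -> good_time a b m M (y s).
  case/andP: SI => _ ST /andP[s0 sS].
  by apply: good; rewrite s0 (le_trans sS)// ltW.
have lagS := lagrangian_solution ext traj S0 goodS f0a rho0b f0_boundary.
have solS := sol SI.
have itv01 (q : R) : 0 <= q <= 1 -> q \in `[0, 1] by rewrite in_itv.
have [||fE _ rE] := @solution_unique _ bc S _ _ _ _ _ _ _ _ _ _
  (solutionP lagS) (solutionP solS) _ _ t x tS x01; last by split.
- by move=> r /itv01 r01; have [-> _] := sol_initial solS r01; have [-> _] := sol_initial lagS r01.
- by move=> r /itv01 r01; have [_ ->] := sol_initial solS r01; have [_ ->] := sol_initial lagS r01.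
Qed.

End Continuation.

(** Agreement is asserted for [f] and [rho], as [fxx] and [rhox] are determined only almost
    everywhere. For the criterion, a solution before [Tstar] means one on every [[0, S]] with
    [S < Tstar]; the content is that the closed end is reached with the regularity and the boundary
    conditions preserved. *)
Theorem theorem1p1 (R : realType) (bc : boundary_kind) :
  exists lifespan : R -> R -> R -> R,
    (forall a b c, 0 < lifespan a b c) /\
    forall f0 f0x f0xx rho0 rho0x : R -> R,
      H2 f0 f0x f0xx -> Linf f0x -> H1 rho0 rho0x ->
      boundary_conditions bc f0 f0x rho0 ->
      let T := lifespan (H2_norm f0 f0x f0xx) (Linf_norm f0x)
                        (H1_norm rho0 rho0x) in
      (exists f fx fxx rho rhox : R -> R -> R,
         solution bc f0 rho0 T f fx fxx rho rhox /\
         forall g gx gxx sigma sigmax : R -> R -> R,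
           solution bc f0 rho0 T g gx gxx sigma sigmax ->
           forall t x : R, t \in `[0, T] -> x \in `[0, 1] ->
             g t x = f t x /\ sigma t x = rho t x) /\
      (forall (Tstar : R) (f fx fxx rho rhox : R -> R -> R),
         0 < Tstar ->
         (forall S, 0 < S < Tstar -> solution bc f0 rho0 S f fx fxx rho rhox) ->
         (\int[@lebesgue_measure R]_(t in `[0%R, Tstar[) eLinf_norm (fx t)
            < +oo)%E ->
         exists F Fx Fxx Rho Rhox : R -> R -> R,
           solution bc f0 rho0 Tstar F Fx Fxx Rho Rhox /\
           forall t x : R, t \in `[0, Tstar[ -> x \in `[0, 1] ->
             F t x = f t x /\ Rho t x = rho t x).
Proof.
exists (@lifespan R); split; first by move=> p q r; exact: lifespan_gt0.
move=> f0 f0x f0xx rho0 rho0x hf _ hr bcs T; split.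
  have [f [fx [fxx [rho [rhox sol]]]]] := local_existence hf hr bcs.
  exists f, fx, fxx, rho, rhox; split => // g gx gxx sigma sigmax sol' t x.
  rewrite !in_itv/= => tT x01.
  have itv01 (q : R) : 0 <= q <= 1 -> q \in `[0, 1] by rewrite in_itv.
  have [||gE _ sE] := @solution_unique _ bc T _ _ _ _ _ _ _ _ _ _
    (solutionP sol') (solutionP sol) _ _ t x tT x01; last by split.
  - by move=> r /itv01 r01; have [-> _] := sol_initial sol r01; have [-> _] := sol_initial sol' r01.
  - by move=> r /itv01 r01; have [_ ->] := sol_initial sol r01; have [_ ->] := sol_initial sol' r01.
move=> Tstar f fx fxx rho rhox Tstar0 sol mass.
have [a [b [a' [b' [ext abE]]]]] := extended_data_exists hf hr bcs.
set I := (X in (X < _)%E) in mass.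
have I0 : (0 <= I)%E by apply: integral_ge0 => t _; exact: eLinf_norm_ge0.
have If : I \is a fin_num by rewrite ge0_fin_numE.
apply: (continuation ext (fx := fx) (M0 := fine I) _ _ _ _ _ Tstar0 sol).
- by apply: (data_ac hf) => x /abE[].
- by move=> x /abE[].
- exact: initial_boundary bcs.
- exact: fine_ge0.
- by rewrite fineK.
Qed.
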